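(* Let $0<\epsilon<1$, and let every stage of the multi-stage algorithm described in the context use the Euclidean distance-generating function $v(x)=\frac12\|x\|_2^2$. Suppose that $u$ follows the Rademacher distribution (independent coordinates, uniform on $\{-1,1\}$), that assumptions (A1), (A2), (A3) of the context hold (with $p=q=2$), and that there is a common constant $\beta>0$ such that every iterate $x$ generated in every stage satisfies $\beta\|c(x)\|_2\le\mathrm{dist}_2(\nabla c(x)^\top c(x),-\mathcal N_X(x))$. Let the parameters be chosen as in the context (''Stagewise parameters''). Then, from an arbitrary starting point in $X$, the multi-stage algorithm returns an $\epsilon$-KKT point with oracle complexity (total number of evaluations of stochastic function values $F(\cdot;\xi)$ over all stages) of order $\mathcal O(d\,\epsilon^{-3})$.
   Context: Problem. Let $d\ge3$ and $m\ge1$. Consider $\min_{x\in X}\Phi(x):=f(x)+h(x)$ subject to $c(x)=0$, where $f(x)=\mathbb E_\xi[F(x;\xi)]$, $X\subset\mathbb R^d$ is convex, $f:\mathbb R^d\to\mathbb R$ and $c=(c_1,\ldots,c_m):\mathbb R^d\to\mathbb R^m$ are continuously differentiable, $\xi\sim\mathbb P$ is a random variable independent of $x$, $F(\cdot;\xi)$ is continuously differentiable for almost every $\xi$, and $h:\mathbb R^d\to\mathbb R\cup\{\infty\}$ is convex. Write $\nabla c(x)^\top\lambda=\sum_i\lambda_i\nabla c_i(x)$. $\mathcal N_X(x)$ is the normal cone of $X$ at $x$ and $\mathrm{dist}_2(a,B)=\inf_{b\in B}\|a-b\|_2$. Let $\mathbb P_u$ be the sampling distribution of $u\in\mathbb R^d$;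 for $\nu>0$ let $X_\nu=\{x+t\nu u: x\in X,\ t\in[0,1],\ u\text{ in the range of }\mathbb P_u\}$ and let $\mathcal O_\nu$ be an open set containing $X_\nu$. Assumptions (for the values of $\nu$ used in the stages). (A1) $X$ is nonempty, closed, convex and $\|x\|_2\le D_X$ for all $x\in X$ ($D_X>0$). $\|\nabla f(x)-\nabla f(y)\|_2\le L_f\|x-y\|_2$ and $|f(x)-f(y)|\le M_f\|x-y\|_2$ for all $x,y\in\mathcal O_\nu$ ($L_f,M_f>0$). $h$ is proper, lower semicontinuous and convex over $X$, and for all $x\in X$, $\partial h(x)\neq\emptyset$ and $\sup_{g\in\partial h(x)}\|g\|_2\le M_h$ ($M_h>0$). For $i=1,\ldots,m$ and $x,y\in X$: $|c_i(x)|\le\bar M_c$, $\|\nabla c_i(x)\|_2\le M_c$, $\|\nabla c_i(x)-\nabla c_i(y)\|_2\le L_c\|x-y\|_2$ ($\bar M_c,M_c,L_c>0$). $\Phi$ has a finite lower bound $\Phi_{\inf}$ over $X$. (A2) For all $x\in\mathcal O_\nu$: $\mathbb E_\xi[\nabla F(x;\xi)]=\nabla f(x)$ and $\mathbb E_\xi[\|\nabla F(x;\xi)-\nabla f(x)\|_2^2]\le\sigma^2$ ($\sigma>0$). (A3) $(\mathbb E_\xi[\|\nabla F(x;\xi)-\nabla F(y;\xi)\|_2^2])^{1/2}\le L_f\|x-y\|_2$ for all $x,y\in\mathcal O_\nu$. Single-stage algorithm. Let $G_\nu(x;u,\xi)=\frac{F(x+\nu u;\xi)-F(x;\xi)}{\nu}u$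 and $V(x,y)=\frac12\|x-y\|_2^2$. Inputs: $x^0\in X$, $\lambda^0=0\in\mathbb R^m$, $\mu,\eta,\nu>0$, $\alpha\in(0,1]$, $\rho_k\in(0,\mu)$, positive integers $K,n_0,n$. All random directions $u_j^k\sim\mathbb P_u$ and samples $\xi_j^k\sim\mathbb P$ are mutually independent. For $k=0,\ldots,K-1$: $s^0=\frac1{n_0}\sum_{j=1}^{n_0}G_\nu(x^0;u_j^0,\xi_j^0)$, and for $k\ge1$, $s^k=\frac1n\sum_{j=1}^n[G_\nu(x^k;u_j^k,\xi_j^k)+(1-\alpha)(s^{k-1}-G_\nu(x^{k-1};u_j^k,\xi_j^k))]$; $x^{k+1}=\arg\min_{x\in X}\langle s^k+\nabla c(x^k)^\top(\lambda^k+\mu c(x^k)),x\rangle+h(x)+\frac1\eta V(x^k,x)$; $\lambda^{k+1}=\lambda^k+\rho_kc(x^k)$. Output $x^R$, with $R$ uniform on $\{0,\ldots,K-1\}$. Multi-stage algorithm. Given any starting point $\tilde x^0\in X$, set $x_1^0=\tilde x^0$, $\mu_1=\mu_{\rm base}$, $\mu_\star=\max\{\mu_{\rm base},\gamma/\epsilon\}$. For $s=1,2,\ldots$: set $\epsilon_s=\gamma/\mu_s$, $\lambda_s^0=0$; run the single-stage algorithm from $x_s^0$ with penalty $\mu_s$, iteration number $K_s$, parameters $\nu_s,\eta_s,\alpha_s,n_{0,s},n_s$, dual stepsizes $\rho_{s,k}$ and fresh independent samples; call the output $\tilde x^s$. If $\mu_s\ge\mu_\star$, terminate and return $\tilde x^T$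 with $T=s$; otherwise set $x_{s+1}^0=\tilde x^s$ and $\mu_{s+1}=\min\{2\mu_s^2,\mu_\star\}$. Stagewise parameters. Fix a constant $\rho>0$. Set $\gamma=\frac{\sqrt{40(M_f^2+M_h^2+m^2\rho^2\bar M_c^2M_c^2)}}{\beta}$, $\mu_{\rm base}=\max\{1,\gamma,\sqrt{\frac{110}{27\beta^2}},\sqrt{\frac{8}{\beta^2}}\}$, $B_X=\sup_{x\in X}\{f(x)+h(x)-\Phi_{\inf}\}+2m\rho\bar M_c^2$, $\bar\Delta_1=B_X+\mu_1m\bar M_c^2/2$, $\bar\Delta_s=B_X+\gamma^2$ for $s\ge2$, $\bar C_1=m\bar M_c^2$, $\bar C_s=\frac{2\gamma^2}{\mu_s}$ for $s\ge2$. In stage $s$: $L_{\mu_s}=L_f+m(\mu_sM_c^2+\mu_s\bar M_cL_c+\rho\bar M_cL_c)$; $\bar\sigma_s^2=\frac{\epsilon_s^2}{16}+4d(\sigma^2+M_f^2)+2M_f^2$; $\eta_s^2=\min\{\frac1{4L_{\mu_s}^2},\frac1{96L_f^2},\frac{d\,\epsilon_s^2}{23040L_f^2\bar\sigma_s^2}\}$; $\alpha_s=96L_f^2\eta_s^2$; $n_{0,s}=\lceil\frac{5\bar\sigma_s^2}{4\epsilon_s^2}\rceil$; $n_s=d$; $\nu_s^2=\min\{\frac{\epsilon_s^2}{4(4L_f^2+3\eta_s^{-2})\mathbb E_u[\|u\|_2^6]},\frac{\beta^2\mu_s^2\eta_s^2\epsilon_s^2}{60\,\mathbb E_u[\|u\|_2^6]}\}$;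 $K_s=\lceil\max\{\frac{108\bar\Delta_s}{\eta_s\epsilon_s^2},\frac{5\bar C_s}{\epsilon_s^2},\frac1{L_f^2\eta_s^2}\}\rceil$; $\rho_{s,k}=\rho/K_s$ for $k=0,\ldots,K_s-1$. $\epsilon$-KKT point. With $\mathcal G_X(x,g,\eta)=\frac1\eta(x-x^+)$, $x^+=\arg\min_{y\in X}\langle g,y\rangle+h(y)+\frac1\eta V(x,y)$, a (random) point $x\in X$ is an $\epsilon$-KKT point if there is a (random) $\lambda\in\mathbb R^m$ with $\mathbb E[\|\mathcal G_X(x,\nabla f(x)+\nabla c(x)^\top\lambda,\eta)\|_2^2]\le\epsilon^2$ and $\mathbb E[\|c(x)\|_2^2]\le\epsilon^2$; here $\eta=\eta_T$, the step parameter of the final stage, and the expectation is over all randomness of the algorithm. Convention. $\mathcal O(\cdot)$ hides a constant independent of $\epsilon,d$, depending only on $L_f,M_f,M_h,M_c,\bar M_c,L_c,m,\sigma,\beta,\rho$ and $\sup_{x\in X}\{f(x)+h(x)-\Phi_{\inf}\}$. *)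

(* Defs.v *)
From HB Require Import structures.
From mathcomp Require Import all_boot all_order all_algebra.
From mathcomp Require Import all_classical all_reals all_analysis.

Set Implicit Arguments.
Unset Strict Implicit.
Unset Printing Implicit Defensive.

Import Order.TTheory GRing.Theory Num.Theory.
Import numFieldNormedType.Exports.

Local Open Scope classical_set_scope.
Local Open Scope ring_scope.

(* The library norm on 'rV[R]_n is the sup norm; it is only used through the
   topology, differentiability and continuity, for which the two norms agree. *)
Section euclidean.
Context {R : realType} {n : nat}.
Implicit Types (x y v a : 'rV[R]_n) (A B : set 'rV[R]_n).

Definition dotv x y : R := \sum_(i < n) x ord0 i * y ord0 i.

Definition norm2 x : R := Num.sqrt (dotv x x).

Definition dist2 a B : R := inf [set norm2 (a - b) | b in B].

Definition grad (g : 'rV[R]_n -> R) x : 'rV[R]_n :=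
  \row_(i < n) 'D_(delta_mx ord0 i) g x.

Definition continuously_differentiable (g : 'rV[R]_n -> R) :=
  (forall x, differentiable g x) /\ continuous (grad g).

Definition normal_cone A x : set 'rV[R]_n :=
  [set v | forall y, A y -> dotv v (y - x) <= 0].

Definition econvex (h : 'rV[R]_n -> \bar R) :=
  forall x y (t : R), 0 <= t <= 1 ->
    (h (t *: x + (1 - t) *: y)%R <= t%:E * h x + (1 - t)%:E * h y)%E.

Definition subdifferential (h : 'rV[R]_n -> \bar R) x : set 'rV[R]_n :=
  [set g | forall y, (h x + (dotv g (y - x))%:E <= h y)%E].

Definition bregman x y : R := 2^-1 * norm2 (x - y) ^+ 2.

Definition argmin A (phi : 'rV[R]_n -> \bar R) : set 'rV[R]_n :=
  [set y | A y /\ forall z, A z -> (phi y <= phi z)%E].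

(* The argmin is a singleton when A is nonempty, closed and convex, h is
   proper, lsc and convex on A, and 0 < eta; otherwise the value is junk. *)
Definition prox A (h : 'rV[R]_n -> \bar R) (eta : R) g x : 'rV[R]_n :=
  xget x (argmin A
    (fun y => (dotv g y)%:E + h y + (eta^-1 * bregman x y)%:E)%E).

Definition gradient_mapping A (h : 'rV[R]_n -> \bar R) (eta : R) x g :=
  eta^-1 *: (x - prox A h eta g x).

End euclidean.

(* R^n with the sigma-algebra generated by the coordinates, i.e. the Borel
   sets; the carrier is convertible to 'rV[R]_n. *)
Definition coordinate_cylinders (R : realType) (n : nat) :
    set (set 'rV[R]_n) :=
  \bigcup_(i in [set: 'I_n])
    preimage_set_system setT (fun v : 'rV[R]_n => v ord0 i) measurable.

Notation rvec R n := (g_sigma_algebraType (@coordinate_cylinders R n)).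

Section probability.
Context {R : realType}.

Definition mutually_independent {d} {T : measurableType d}
    (P : probability T R) (I : eqType) (D : set I)
    (F : I -> set (set T)) :=
  forall s : seq I, uniq s -> (forall i, i \in s -> D i) ->
  forall A : I -> set T, (forall i, i \in s -> F i (A i)) ->
    (P (\bigcap_(i in [set` s]) A i) = \prod_(i <- s) P (A i))%E.

Definition generated_by {d d'} {T : measurableType d}
    {T' : measurableType d'} (X : T -> T') : set (set T) :=
  preimage_set_system setT X measurable.

(* Measurable up to a null set: F(.; xi) is only regular for almost every xi,
   so the iterates are random vectors for the completion of P. *)
Definition random_vector {d} {T : measurableType d} {n : nat}
    (P : probability T R) (X : T -> 'rV[R]_n) :=
  exists Y : {RV P >-> rvec R n}, {ae P, forall w, X w = Y w}.

Definition rademacher {n} (Pu : probability (rvec R n) R) :=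
  mutually_independent Pu setT
    (fun i : 'I_n => generated_by (fun v : rvec R n => v ord0 i : R)) /\
  forall i : 'I_n,
    Pu [set v : 'rV[R]_n | v ord0 i = 1] = (2^-1)%:E /\
    Pu [set v : 'rV[R]_n | v ord0 i = -1] = (2^-1)%:E.

Definition range_of {n} (Pu : probability (rvec R n) R) : set 'rV[R]_n :=
  [set v | forall e : R, 0 < e ->
    (0 < Pu [set w : 'rV[R]_n | norm2 (w - v) < e]%R)%E].

Definition sixth_moment {n} (Pu : probability (rvec R n) R) : R :=
  fine ('E_Pu[fun v : 'rV[R]_n => (norm2 v ^+ 6)%R])%E.

End probability.

(* [so] is F, [obj] is f, [reg] is h and [con] is c. *)
Record problem (R : realType) (d m : nat) (Xi : Type) := Problem {
  feas : set 'rV[R]_d;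
  so : 'rV[R]_d -> Xi -> R;
  obj : 'rV[R]_d -> R;
  reg : 'rV[R]_d -> \bar R;
  con : 'rV[R]_d -> 'rV[R]_m
}.

Section problem_theory.
Context {R : realType} {d m : nat} {Xi : Type}.
Variable p : problem R d m Xi.

Definition con_i (i : 'I_m) (x : 'rV[R]_d) : R := con p x ord0 i.

Definition con_gradT (x : 'rV[R]_d) (l : 'rV[R]_m) : 'rV[R]_d :=
  \sum_(i < m) l ord0 i *: grad (con_i i) x.

Definition composite (x : 'rV[R]_d) : \bar R := ((obj p x)%:E + reg p x)%E.

End problem_theory.

Definition standing_assumptions (R : realType) (d m : nat)
    (dXi : measure_display) (Xi : measurableType dXi)
    (p : problem R d m Xi) (PXi : probability Xi R) :=
  [/\ convex_set (feas p : set (convex_lmodType 'rV[R]_d)),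
      forall x, PXi.-integrable setT (EFin \o so p x) /\
                ('E_PXi[so p x] = (obj p x)%:E)%E,
      continuously_differentiable (obj p) /\
      forall i, continuously_differentiable (con_i p i),
      {ae PXi, forall xi, continuously_differentiable (so p ^~ xi)} &
      (forall x, reg p x != -oo%E) /\ econvex (reg p)].

(* The quantities which the hidden constant in the complexity bound may depend
   on, besides m; [Mbc] bounds |c_i| and [gap] is the supremum over X of
   f + h - Phi_inf. *)
Record constants (R : realType) := Constants {
  Lf : R; Mf : R; Mh : R; Mc : R; Mbc : R; Lc : R;
  sigma : R; beta : R; rho : R; gap : R
}.

Section assumptions.
Context {R : realType} {d m : nat} {dXi : measure_display}
  {Xi : measurableType dXi}.
Variables (k : constants R) (p : problem R d m Xi) (PXi : probability Xi R).
Implicit Types (O : set 'rV[R]_d).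

Definition constants_positive :=
  [/\ [/\ 0 < Lf k, 0 < Mf k & 0 < Mh k],
      [/\ 0 < Mc k, 0 < Mbc k & 0 < Lc k] &
      [/\ 0 < sigma k, 0 < beta k & 0 < rho k]].

Definition A1_feasible_set (DX : R) :=
  [/\ feas p !=set0, closed (feas p),
      convex_set (feas p : set (convex_lmodType 'rV[R]_d)) &
      forall x, feas p x -> norm2 x <= DX].

Definition A1_objective O :=
  forall x y, O x -> O y ->
    norm2 (grad (obj p) x - grad (obj p) y) <= Lf k * norm2 (x - y) /\
    `|obj p x - obj p y| <= Mf k * norm2 (x - y).

Definition A1_regularizer :=
  [/\ exists2 x, feas p x & (reg p x < +oo)%E,
      lower_semicontinuous (reg p : subspace (feas p) -> \bar R) &
      forall x, feas p x -> subdifferential (reg p) x !=set0 /\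
        forall g, subdifferential (reg p) x g -> norm2 g <= Mh k].

Definition A1_constraints :=
  forall (i : 'I_m) x y, feas p x -> feas p y ->
    [/\ `|con_i p i x| <= Mbc k,
        norm2 (grad (con_i p i) x) <= Mc k &
        norm2 (grad (con_i p i) x - grad (con_i p i) y)
          <= Lc k * norm2 (x - y)].

Definition A1_lower_bound (Phiinf : R) :=
  forall x, feas p x -> (Phiinf%:E <= composite p x)%E.

Definition A2 O :=
  forall x, O x ->
    (forall i, 'E_PXi[fun xi => grad (so p ^~ xi) x ord0 i]
               = (grad (obj p) x ord0 i)%:E)%E /\
    ('E_PXi[fun xi => (norm2 (grad (so p ^~ xi) x - grad (obj p) x) ^+ 2)%R]
      <= (sigma k ^+ 2)%:E)%E.

Definition A3 O :=
  forall x y, O x -> O y ->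
    (poweR 'E_PXi[fun xi =>
         (norm2 (grad (so p ^~ xi) x - grad (so p ^~ xi) y) ^+ 2)%R] 2^-1
      <= (Lf k * norm2 (x - y))%:E)%E.

(* X_nu *)
Definition enlarged_set (Pu : probability (rvec R d) R) (nu : R) :
    set 'rV[R]_d :=
  [set z | exists x t u, [/\ feas p x, 0 <= t <= 1, range_of Pu u &
                             z = x + (t * nu) *: u]].

End assumptions.

Record stage_parameters (R : realType) := StageParameters {
  st_mu : R; st_eta : R; st_nu : R; st_alpha : R; st_rho : nat -> R;
  st_K : nat; st_n0 : nat; st_n : nat
}.

Section algorithm.
Context {R : realType} {d m : nat} {Xi : Type}.
Variable p : problem R d m Xi.

Definition zo_estimator (nu : R) (x u : 'rV[R]_d) (xi : Xi) : 'rV[R]_d :=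
  ((so p (x + nu *: u) xi - so p x xi) / nu) *: u.

(* (x^k, s^k, lambda^k) *)
Record state := State {
  st_x : 'rV[R]_d; st_s : 'rV[R]_d; st_lambda : 'rV[R]_m
}.

Section single_stage.
Variables (th : stage_parameters R) (x0 : 'rV[R]_d)
  (u : nat -> nat -> 'rV[R]_d) (xi : nat -> nat -> Xi).

Let G := zo_estimator (st_nu th).

Fixpoint single_stage (k : nat) : state :=
  match k with
  | 0 => State x0
      ((st_n0 th)%:R^-1 *: \sum_(j < st_n0 th) G x0 (u 0 j) (xi 0 j)) 0
  | k'.+1 =>
      let: State x s l := single_stage k' in
      let x' := prox (feas p) (reg p) (st_eta th)
                  (s + con_gradT p x (l + st_mu th *: con p x)) x in
      let s' := (st_n th)%:R^-1 *: \sum_(j < st_n th)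
                  (G x' (u k j) (xi k j) +
                   (1 - st_alpha th) *: (s - G x (u k j) (xi k j))) in
      State x' s' (l + st_rho th k' *: con p x)
  end.

End single_stage.

(* The stages are numbered from 1; [stage_output s] is \tilde x^s, and is the
   starting point \tilde x^0 for s = 0.  The samples are indexed by the stage,
   the iteration and the position in the batch; [r s] is the index of the
   output iterate of stage s. *)
Section multi_stage.
Variables (th : nat -> stage_parameters R) (x0 : 'rV[R]_d)
  (u : nat -> nat -> nat -> 'rV[R]_d) (xi : nat -> nat -> nat -> Xi)
  (r : nat -> nat).

Fixpoint stage_output (s : nat) : 'rV[R]_d :=
  match s with
  | 0 => x0
  | s'.+1 => st_x (single_stage (th s) (stage_output s') (u s) (xi s) (r s))
  end.

Definition stage_iterate (s k : nat) : 'rV[R]_d :=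
  st_x (single_stage (th s) (stage_output s.-1) (u s) (xi s) k).

End multi_stage.

End algorithm.

(* An evaluation of the estimator costs two evaluations of F(.; xi); s^0 uses
   n0 of them, and each of s^1, ..., s^(K-1) uses 2 * n of them. *)
Definition oracle_calls (R : realType) (th : stage_parameters R) : nat :=
  2 * st_n0 th + (st_K th).-1 * (2 * (2 * st_n th)).

Section parameters.
Context {R : realType}.
Variables (k : constants R) (m d : nat) (Eu6 eps : R).

Definition gamma : R :=
  Num.sqrt (40 * (Mf k ^+ 2 + Mh k ^+ 2 +
                  m%:R ^+ 2 * rho k ^+ 2 * Mbc k ^+ 2 * Mc k ^+ 2)) / beta k.

Definition mu_base : R :=
  Num.max (Num.max 1 gamma)
    (Num.max (Num.sqrt (110 / (27 * beta k ^+ 2)))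
             (Num.sqrt (8 / beta k ^+ 2))).

Definition mu_star : R := Num.max mu_base (gamma / eps).

Definition mu (s : nat) : R :=
  iter s.-1 (fun t => Num.min (2 * t ^+ 2) mu_star) mu_base.

Definition stage_run (s : nat) :=
  (1 <= s)%N /\ forall s', (1 <= s' < s)%N -> mu s' < mu_star.

Definition last_stage (T : nat) := stage_run T /\ mu_star <= mu T.

Definition eps_ (s : nat) : R := gamma / mu s.

Definition B_X : R := gap k + 2 * m%:R * rho k * Mbc k ^+ 2.

Definition Delta_bar (s : nat) : R :=
  if s == 1%N then B_X + mu s * m%:R * Mbc k ^+ 2 / 2 else B_X + gamma ^+ 2.

Definition C_bar (s : nat) : R :=
  if s == 1%N then m%:R * Mbc k ^+ 2 else 2 * gamma ^+ 2 / mu s.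

Definition L_mu (s : nat) : R :=
  Lf k + m%:R * (mu s * Mc k ^+ 2 + mu s * Mbc k * Lc k +
                 rho k * Mbc k * Lc k).

Definition sigma2_bar (s : nat) : R :=
  eps_ s ^+ 2 / 16 + 4 * d%:R * (sigma k ^+ 2 + Mf k ^+ 2) + 2 * Mf k ^+ 2.

Definition eta (s : nat) : R :=
  Num.sqrt
    (Num.min (1 / (4 * L_mu s ^+ 2))
      (Num.min (1 / (96 * Lf k ^+ 2))
        (d%:R * eps_ s ^+ 2 / (23040 * Lf k ^+ 2 * sigma2_bar s)))).

Definition nu (s : nat) : R :=
  Num.sqrt
    (Num.min
      (eps_ s ^+ 2 / (4 * (4 * Lf k ^+ 2 + 3 * eta s ^- 2) * Eu6))
      (beta k ^+ 2 * mu s ^+ 2 * eta s ^+ 2 * eps_ s ^+ 2 / (60 * Eu6))).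

Definition nceil (x : R) : nat := `|Num.ceil x|%N.

Definition K_ (s : nat) : nat :=
  nceil (Num.max (108 * Delta_bar s / (eta s * eps_ s ^+ 2))
          (Num.max (5 * C_bar s / eps_ s ^+ 2)
                   (1 / (Lf k ^+ 2 * eta s ^+ 2)))).

Definition stagewise (s : nat) : stage_parameters R := {|
  st_mu := mu s;
  st_eta := eta s;
  st_nu := nu s;
  st_alpha := 96 * Lf k ^+ 2 * eta s ^+ 2;
  st_rho := fun _ => rho k / (K_ s)%:R;
  st_K := K_ s;
  st_n0 := nceil (5 * sigma2_bar s / (4 * eps_ s ^+ 2));
  st_n := d
|}.

End parameters.

(* The randomness of a run: [run s] tells that stage s is executed.  Only the
   samples that are actually drawn are constrained. *)
Section sampling.
Context {R : realType} {d : nat} {dXi dOm : measure_display}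
  {Xi : measurableType dXi} {Om : measurableType dOm}.
Variables (P : probability Om R) (Pu : probability (rvec R d) R)
  (PXi : probability Xi R) (run : nat -> Prop)
  (th : nat -> stage_parameters R)
  (u : nat -> nat -> nat -> {RV P >-> rvec R d})
  (xi : nat -> nat -> nat -> {RV P >-> Xi})
  (r : nat -> {RV P >-> nat}).

Definition sample_drawn (s k j : nat) :=
  [/\ run s, (k < st_K (th s))%N &
      (j < if k == 0 then st_n0 (th s) else st_n (th s))%N].

Definition source : Type :=
  ((nat * nat * nat) + (nat * nat * nat) + nat)%type.

Definition source_used : set source := fun i =>
  match i with
  | inl (inl (s, k, j)) | inl (inr (s, k, j)) => sample_drawn s k j
  | inr s => run s
  end.

Definition source_events (i : source) : set (set Om) :=
  match i with
  | inl (inl (s, k, j)) => generated_by (u s k j)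
  | inl (inr (s, k, j)) => generated_by (xi s k j)
  | inr s => generated_by (r s)
  end.

Definition sampling_scheme :=
  [/\ forall s k j, sample_drawn s k j -> forall A, measurable A ->
        distribution P (u s k j) A = Pu A,
      forall s k j, sample_drawn s k j -> forall A, measurable A ->
        distribution P (xi s k j) A = PXi A,
      forall s, run s -> forall k, (k < st_K (th s))%N ->
        distribution P (r s) [set k] = ((st_K (th s))%:R^-1)%:E &
      @mutually_independent R _ _ P source source_used source_events].

End sampling.

Definition eps_KKT (R : realType) (d m : nat) (Xi : Type)
    (p : problem R d m Xi) (dOm : measure_display) (Om : measurableType dOm)
    (P : probability Om R) (eps eta : R) (x : Om -> 'rV[R]_d) :=
  [/\ random_vector P x,
      forall w, feas p (x w) &
      exists2 l : Om -> 'rV[R]_m, random_vector P l &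
        ('E_P[fun w => (norm2 (gradient_mapping (feas p) (reg p) eta (x w)
            (grad (obj p) (x w) + con_gradT p (x w) (l w))) ^+ 2)%R]
           <= (eps ^+ 2)%:E)%E /\
        ('E_P[fun w => (norm2 (con p (x w)) ^+ 2)%R] <= (eps ^+ 2)%:E)%E].

(* Main.v *)
(* Let e_k = s^k - E[G_nu(x^k)] be the error of the recursive estimator. For
   Rademacher directions the two-point estimator has second moment of order d and
   is Lipschitz in mean square with constant of order sqrt d, so batches of d
   samples give E|e_k|^2 <= (1 - alpha)^2 E|e_(k-1)|^2 + 6 L_f^2 E|x^k - x^(k-1)|^2
   + a term of order alpha^2 sigma_bar^2 / d. The proximal steps decrease the
   augmented Lagrangian, which bounds the sum of |x^(k+1) - x^k|^2 by the sum of
   the errors; the two estimates close because alpha = 96 L_f^2 eta^2. The gradient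
   mapping at x^k is controlled by the step length and the error, and the
   optimality condition of the step together with the constraint qualification
   bounds |c(x^(k+1))| by 1 / (beta mu) times bounded quantities. Hence the random
   output of a stage with penalty mu_s is an eps_s-KKT point with
   eps_s = gamma / mu_s, and E|c|^2 <= eps_s^2 = O(1 / mu_(s+1)) makes the initial
   value of the next augmented Lagrangian bounded although mu_(s+1) = 2 mu_s^2.
   Stage s costs O(d mu_s^3) evaluations, and these costs grow at least
   geometrically up to mu_star = O(1 / eps).

   F( . ; xi) is only smooth for almost every xi; it is replaced by 0 on a null
   set, which changes the algorithm on a null event only. *)
Require Import Defs.
From HB Require Import structures.
From mathcomp Require Import all_boot all_order all_algebra.
From mathcomp Require Import all_classical all_reals all_analysis.
From mathcomp Require Import measurable_realfun zify ring lra.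

Set Implicit Arguments.
Unset Strict Implicit.
Unset Printing Implicit Defensive.

Import Order.TTheory GRing.Theory Num.Theory.
Import numFieldNormedType.Exports.

Local Open Scope classical_set_scope.
Local Open Scope ring_scope.

(** * Integration and independence *)

Section expectation_tools.
Local Open Scope ereal_scope.
Context {R : realType}.

(* The integral of a nonnegative function is a supremum over the simple functions
   below it. The integrands of A2, A3 and [eps_KKT] need not be measurable. *)
Lemma le_integral_nomeas {d} {T : measurableType d}
    (mu : {measure set T -> \bar R}) (f g : T -> \bar R) :
  (forall x, 0 <= f x) -> (forall x, f x <= g x) ->
  \int[mu]_x f x <= \int[mu]_x g x.
Proof.
move=> f0 fg.
have g0 x : 0 <= g x by exact: le_trans (f0 x) (fg x).
rewrite !ge0_integralTE//.
apply: le_ereal_sup => /= _ [h hf <-]; exists h => // x.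
exact: le_trans (hf x) (fg x).
Qed.

Lemma sub_sigma_sub {d} {T : measurableType d} (G : set (set T)) :
  G `<=` measurable -> (<<s G >> : set (set T)) `<=` measurable.
Proof.
move=> Gm; apply: smallest_sub => //; split.
- exact: measurable0.
- by move=> A mA; rewrite setTD; exact: measurableC.
- by move=> F mF; exact: bigcup_measurable.
Qed.

Lemma freezing {d d1 d2} {T : measurableType d} {T1 : measurableType d1}
    {T2 : measurableType d2} (P : probability T R) (J : T -> T1)
    (Z : {RV P >-> T2}) (phi : T1 * T2 -> \bar R) :
  measurable_fun setT J ->
  (forall A B, measurable A -> measurable B ->
     P (J @^-1` A `&` Z @^-1` B) = P (J @^-1` A) * P (Z @^-1` B)) ->
  measurable_fun setT phi -> (forall z, 0 <= phi z) ->
  \int[P]_w phi (J w, Z w) = \int[P]_w \int[distribution P Z]_z phi (J w, z).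
Proof.
move=> mJ ind mphi phi0.
pose J' : {mfun T >-> T1} := mfun_Sub (mem_set mJ).
have mpair : measurable_fun setT (fun w => (J' w, Z w)).
  by apply: measurable_fun_pair => //.
pose JZ : {mfun T >-> (T1 * T2)%type} := mfun_Sub (mem_set mpair).
have -> : \int[P]_w phi (J w, Z w) = \int[distribution P JZ]_z phi z.
  by rewrite ge0_integral_pushforward.
have -> : \int[distribution P JZ]_z phi z =
          \int[distribution P J' \x distribution P Z]_z phi z.
  apply: eq_measure_integral => A mA _.
  by apply/esym/product_measure_unique => // B C mB mC; exact: ind.
rewrite fubini_tonelli1//.
rewrite ge0_integral_pushforward//=.
- by apply: measurable_fun_fubini_tonelli_F.
- by move=> y _; apply: integral_ge0 => z _; exact: phi0.
Qed.

End expectation_tools.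

Section independence.
Local Open Scope ereal_scope.
Context {R : realType} {d} {T : measurableType d} (P : probability T R).
Context {I : eqType} (F : I -> set (set T)).

Definition history (D : set I) : set (set T) :=
  [set A | exists2 i, D i & F i A].

Hypothesis FT : forall i, F i setT.
Hypothesis FI : forall i, setI_closed (F i).
Hypothesis Fm : forall i, F i `<=` measurable.

Lemma history_measurable D : history D `<=` measurable.
Proof. by move=> A [i _ /Fm]. Qed.

Let cylinders (D : set I) : set (set T) :=
  [set A | exists (s : seq I) (E : I -> set T),
     [/\ uniq s, forall i, i \in s -> D i, forall i, i \in s -> F i (E i) &
         A = \bigcap_(i in [set` s]) E i]].

Let setI_closed_cylinders D : setI_closed (cylinders D).
Proof.
move=> _ _ [s [E [us sD sF ->]]] [t [E' [ut tD tF ->]]].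
exists (undup (s ++ t)), (fun i => (if i \in s then E i else setT) `&`
  (if i \in t then E' i else setT)); split.
- exact: undup_uniq.
- by move=> i; rewrite mem_undup mem_cat => /orP[/sD|/tD].
- move=> i _; apply: FI; [case: ifPn => // /sF //|case: ifPn => // /tF //].
- apply/seteqP; split => w.
    move=> [h1 h2] i /= _; split; case: ifPn => // ?; [exact: h1|exact: h2].
  move=> h; split => i /= ii.
    have := h i; rewrite /= mem_undup mem_cat ii /= => /(_ isT)[].
    by [].
  have := h i; rewrite /= mem_undup mem_cat ii orbT /= => /(_ isT)[].
  by [].
Qed.

Lemma independent_history (D D' : set I) i A B :
  mutually_independent P D F -> D' `<=` D -> D i -> ~ D' i ->
  (<<s history D' >> : set (set T)) A -> F i B -> P (A `&` B) = P A * P B.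
Proof.
move=> indD D'D Di D'i sA FB.
pose H : set (set T) :=
  [set A | measurable A /\ P (A `&` B) = P A * P B].
suff : (<<s cylinders D' >> : set (set T)) `<=` H.
  move=> sub; have [] := sub A; last by [].
  apply: (smallest_sub (@smallest_sigma_algebra _ setT (cylinders D'))) sA.
  move=> E [j D'j Fj]; apply: sub_sigma_algebra.
  exists [:: j], (fun=> E); split => //.
  - by move=> k; rewrite inE => /eqP ->.
  - by move=> k; rewrite inE => /eqP ->.
  - by rewrite set_cons1 bigcap_set1.
rewrite -setI_closed_g_dynkin_g_sigma_algebra; last exact: setI_closed_cylinders.
have mB := Fm FB.
have PB : P B \is a fin_num by exact: fin_num_measure.
apply: smallest_sub.
  split.
  - by split => //; rewrite setTI probability_setT mul1e.
  - move=> E [mE PE]; split; first exact: measurableC.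
    have -> : ~` E `&` B = B `\` (E `&` B).
      apply/seteqP; split => w; rewrite /setC /setD /setI /=; tauto.
    have -> : P (B `\` (E `&` B)) = P B - P (E `&` B).
      rewrite measureD//; [|exact: measurableI|by rewrite ltey_eq PB].
      by rewrite setICA setIid.
    by rewrite PE probability_setC// muleBl ?mul1e// fin_num_adde_defr.
  - move=> E tE HE; split; first by apply: bigcup_measurable => k _; exact: (HE k).1.
    rewrite setI_bigcupl measure_semi_bigcup//; last 3 first.
      by move=> k; apply: measurableI => //; exact: (HE k).1.
      exact: trivIset_setIr.
      by apply: bigcup_measurable => k _; apply: measurableI => //; exact: (HE k).1.
    rewrite measure_semi_bigcup//; last 2 first.
      by move=> k; exact: (HE k).1.
      by apply: bigcup_measurable => k _; exact: (HE k).1.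
    rewrite -[P B](fineK PB) muleC -nneseriesZl//.
    apply: eq_eseriesr => k _; apply: (etrans (HE k).2).
    by rewrite muleC fineK.
move=> _ [s [E [us sD sF ->]]]; split.
  apply: fin_bigcap_measurable; first exact: finite_seq.
  by move=> k ks; exact: (Fm (sF _ ks)).
have is_ : i \notin s by apply/negP => /sD.
have := indD (i :: s) _ _ (fun j => if j == i then B else E j).
rewrite /= is_ us => /(_ isT).
have h1 j : j \in i :: s -> D j.
  by rewrite inE => /orP[/eqP ->//|/sD /D'D].
have h2 j : j \in i :: s -> F j (if j == i then B else E j).
  by rewrite inE; case: eqP => [->//|_ /= /sF].
move=> /(_ h1 h2).
have := indD s us _ E => /(_ (fun j js => D'D _ (sD j js)) sF) ->.
rewrite big_cons eqxx.
have -> : \bigcap_(i0 in [set` i :: s]) (if i0 == i then B else E i0) =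
  \bigcap_(i in [set` s]) E i `&` B.
  apply/seteqP; split => w.
    move=> h; split; last by have := h i; rewrite /= mem_head eqxx; apply.
    move=> j /= js; have := h j; rewrite /= inE js orbT => /(_ isT).
    by rewrite ifF//; apply/negbTE; apply: contraNneq is_ => <-.
  move=> [h wB] j /=; rewrite inE; case: eqP => //= _ js; exact: h.
move=> ->; rewrite muleC; congr (_ * _).
rewrite !big_seq; apply: eq_bigr => j js.
by rewrite ifF//; apply/negbTE; apply: contraNneq is_ => <-.
Qed.

End independence.

(** * Euclidean geometry and proximal steps *)

Section euclidean_space.
Context {R : realType} {n : nat}.
Implicit Types (x y z v w : 'rV[R]_n) (a b : R).

Lemma dotvC x y : dotv x y = dotv y x.
Proof. by apply: eq_bigr => i _; rewrite mulrC. Qed.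

Lemma dotvDl x y z : dotv (x + y) z = dotv x z + dotv y z.
Proof. by rewrite -big_split; apply: eq_bigr => i _; rewrite mxE mulrDl. Qed.

Lemma dotvZl a x y : dotv (a *: x) y = a * dotv x y.
Proof. by rewrite mulr_sumr; apply: eq_bigr => i _; rewrite mxE mulrA. Qed.

Lemma dotvDr x y z : dotv x (y + z) = dotv x y + dotv x z.
Proof. by rewrite dotvC dotvDl !(dotvC _ x). Qed.

Lemma dotvZr a x y : dotv x (a *: y) = a * dotv x y.
Proof. by rewrite dotvC dotvZl dotvC. Qed.

Lemma dotvNl x y : dotv (- x) y = - dotv x y.
Proof. by rewrite -scaleN1r dotvZl mulN1r. Qed.

Lemma dotvNr x y : dotv x (- y) = - dotv x y.
Proof. by rewrite dotvC dotvNl dotvC. Qed.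

Lemma dotvBl x y z : dotv (x - y) z = dotv x z - dotv y z.
Proof. by rewrite dotvDl dotvNl. Qed.

Lemma dotvBr x y z : dotv x (y - z) = dotv x y - dotv x z.
Proof. by rewrite dotvDr dotvNr. Qed.

Lemma dotv0l x : dotv 0 x = 0.
Proof. by rewrite -(scale0r 0) dotvZl mul0r. Qed.

Lemma dotv0r x : dotv x 0 = 0.
Proof. by rewrite dotvC dotv0l. Qed.

Lemma dotv_suml (I : Type) (r : seq I) (P : pred I) (F : I -> 'rV[R]_n) y :
  dotv (\sum_(i <- r | P i) F i) y = \sum_(i <- r | P i) dotv (F i) y.
Proof.
elim/big_rec2: _ => [|i u v _ <-]; first exact: dotv0l.
by rewrite dotvDl.
Qed.

Lemma dotvv_ge0 x : 0 <= dotv x x.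
Proof. by apply: sumr_ge0 => i _; exact: sqr_ge0. Qed.

Lemma norm2_sqr x : norm2 x ^+ 2 = dotv x x.
Proof. by rewrite sqr_sqrtr// dotvv_ge0. Qed.

Lemma norm2_ge0 x : 0 <= norm2 x.
Proof. exact: sqrtr_ge0. Qed.

Lemma norm2_le x a : 0 <= a -> (norm2 x <= a) = (dotv x x <= a ^+ 2).
Proof.
by move=> a0; rewrite -norm2_sqr ler_pXn2r// nnegrE ?norm2_ge0.
Qed.

Lemma norm2Z a x : norm2 (a *: x) = `|a| * norm2 x.
Proof.
by rewrite /norm2 dotvZl dotvZr mulrA -expr2 sqrtrM ?sqr_ge0// sqrtr_sqr.
Qed.

Lemma norm2N x : norm2 (- x) = norm2 x.
Proof. by rewrite /norm2 dotvNl dotvNr opprK. Qed.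

Lemma norm2_0 : norm2 (0 : 'rV[R]_n) = 0.
Proof. by rewrite /norm2 dotv0l sqrtr0. Qed.

Lemma distC2 x y : norm2 (x - y) = norm2 (y - x).
Proof. by rewrite -opprB norm2N. Qed.

Lemma coord_le_norm2 x i : `|x ord0 i| <= norm2 x.
Proof.
rewrite -sqrtr_sqr ler_wsqrtr// /dotv (bigD1 i)//= -expr2 lerDl.
by apply: sumr_ge0 => j _; exact: sqr_ge0.
Qed.

Lemma norm2_eq0 x : norm2 x = 0 -> x = 0.
Proof.
move=> x0; apply/rowP => i; rewrite mxE; apply/eqP; rewrite -normr_le0.
by rewrite -x0 coord_le_norm2.
Qed.

Lemma dotv_young x y a : 0 < a -> dotv x y <= a / 2 * dotv x x + (2 * a)^-1 * dotv y y.
Proof.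
move=> a0; have := dotvv_ge0 (a *: x - y).
rewrite !(dotvBl, dotvBr, dotvZl, dotvZr) (dotvC y x) => h.
rewrite -subr_ge0.
have -> : a / 2 * dotv x x + (2 * a)^-1 * dotv y y - dotv x y =
  (2 * a)^-1 * (a * (a * dotv x x) - a * dotv x y - (a * dotv x y - dotv y y)).
  by field; rewrite gt_eqF.
by apply: mulr_ge0; [rewrite invr_ge0; lra | lra].
Qed.

Lemma cauchy_schwarz x y : dotv x y <= norm2 x * norm2 y.
Proof.
have [x0|x0] := eqVneq (norm2 x) 0.
  by rewrite (norm2_eq0 x0) dotv0l norm2_0 mul0r.
have [y0|y0] := eqVneq (norm2 y) 0.
  by rewrite (norm2_eq0 y0) dotv0r norm2_0 mulr0.
have px : 0 < norm2 x by rewrite lt_def x0 norm2_ge0.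
have py : 0 < norm2 y by rewrite lt_def y0 norm2_ge0.
apply: le_trans (dotv_young x y (divr_gt0 py px)) _.
rewrite -!norm2_sqr le_eqVlt; apply/orP; left; apply/eqP.
by field; rewrite x0 y0.
Qed.

Lemma norm_dotv x y : `|dotv x y| <= norm2 x * norm2 y.
Proof.
by rewrite ler_norml lerNl -dotvNl cauchy_schwarz -[norm2 x]norm2N cauchy_schwarz.
Qed.

Lemma norm2D x y : norm2 (x + y) <= norm2 x + norm2 y.
Proof.
rewrite norm2_le ?addr_ge0 ?norm2_ge0//.
rewrite dotvDl !dotvDr (dotvC y x) -!norm2_sqr.
have := cauchy_schwarz x y; lra.
Qed.

Lemma norm2_sum (I : Type) (r : seq I) (P : pred I) (F : I -> 'rV[R]_n) :
  norm2 (\sum_(i <- r | P i) F i) <= \sum_(i <- r | P i) norm2 (F i).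
Proof.
elim/big_rec2: _ => [|i u v _ h]; first by rewrite norm2_0.
by apply: le_trans (norm2D _ _) _; rewrite lerD2l.
Qed.

Lemma norm2B_le x y z : norm2 (x - z) <= norm2 (x - y) + norm2 (y - z).
Proof. by apply: le_trans (norm2D _ _); rewrite addrA subrK. Qed.

Lemma sqr_norm2D x y : norm2 (x + y) ^+ 2 <= 2 * norm2 x ^+ 2 + 2 * norm2 y ^+ 2.
Proof.
have := dotvv_ge0 (x - y); rewrite !norm2_sqr.
by rewrite !(dotvBl, dotvBr, dotvDl, dotvDr) (dotvC y x); lra.
Qed.

Lemma norm2_le_mx_norm x : norm2 x <= n%:R * `|x|.
Proof.
rewrite [X in norm2 X]row_sum_delta.
apply: le_trans (norm2_sum _ _ _) _.
have -> : n%:R * `|x| = \sum_(i < n) `|x|.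
  by rewrite sumr_const card_ord mulr_natl.
apply: ler_sum => i _.
rewrite norm2Z /norm2 /dotv (bigD1 i)//= mxE !eqxx mulr1 big1 ?addr0 ?sqrtr1 ?mulr1.
  rewrite [`|x|]mx_normrE.
  exact: (le_bigmax _ (fun ij : 'I_1 * 'I_n => `|x ij.1 ij.2|) (ord0, i)).
by move=> j ji; rewrite mxE (negbTE ji) andbF mul0r.
Qed.

Lemma mx_norm_le_norm2 x : `|x| <= norm2 x.
Proof.
rewrite [`|x|]mx_normrE; apply: bigmax_le; first exact: norm2_ge0.
by move=> [i j] _ /=; rewrite ord1 coord_le_norm2.
Qed.

End euclidean_space.

Lemma lipschitz_continuous2 {R : realType} {n} (V : normedModType R)
    (f : 'rV[R]_n -> V) (a : R) :
  (forall x y, `|f x - f y| <= a * norm2 (x - y)) -> continuous f.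
Proof.
move=> fL x; apply/(@cvgrPdist_le _ _ _ _ (nbhs_filter x)) => e e0.
have b0 : 0 < (`|a| + 1) * (n%:R + 1) by rewrite mulr_gt0// ltr_wpDl.
near=> y.
apply: le_trans (fL _ _) _.
have h : `|x - y| <= e / ((`|a| + 1) * (n%:R + 1)).
  near: y; apply/nbhs_ballP; exists (e / ((`|a| + 1) * (n%:R + 1))).
    exact: divr_gt0.
  by move=> z; rewrite mx_norm_ball /ball_ /= => /ltW.
have := norm2_le_mx_norm (x - y) => h2.
have [a1 na] : a <= `|a| + 1 /\ 0 <= `|a| by rewrite normr_ge0 (le_trans (ler_norm a))// lerDl.
apply: (@le_trans _ _ ((`|a| + 1) * ((n%:R + 1) * `|x - y|))).
  apply: le_trans (ler_wpM2r (norm2_ge0 _) a1) _.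
  apply: ler_wpM2l; first by rewrite addr_ge0.
  by apply: le_trans h2 _; rewrite ler_wpM2r// lerDl.
by rewrite mulrA mulrC -ler_pdivlMr.
Unshelve. all: by end_near.
Qed.

Lemma lipschitz2_continuous {R : realType} {n m} (f : 'rV[R]_n -> 'rV[R]_m)
    (a : R) :
  (forall x y, norm2 (f x - f y) <= a * norm2 (x - y)) -> continuous f.
Proof.
move=> fL; apply: (@lipschitz_continuous2 _ _ _ f a) => x y.
exact: le_trans (mx_norm_le_norm2 _) (fL x y).
Qed.

Lemma dotv_continuous {R : realType} {n} (v : 'rV[R]_n) :
  continuous (fun x => dotv x v).
Proof.
apply: (@lipschitz_continuous2 _ _ _ (fun x => dotv x v : R) (norm2 v)) => x y.
by rewrite -dotvBl mulrC norm_dotv.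
Qed.

Lemma norm2_continuous {R : realType} {n} : continuous (@norm2 R n).
Proof.
apply: (@lipschitz_continuous2 _ _ _ (fun x => norm2 x : R) 1) => x y.
have := norm2D (x - y) y; have := norm2D (y - x) x.
rewrite !subrK mul1r (distC2 y x) => h1 h2; rewrite ler_norml; apply/andP; split; lra.
Qed.

Section taylor.
Context {R : realType} {n : nat}.
Implicit Types (x v : 'rV[R]_n) (g : 'rV[R]_n -> R).

Lemma derive_grad g x v : differentiable g x -> 'D_v g x = dotv (grad g x) v.
Proof.
move=> dg; rewrite deriveE// [in LHS](row_sum_delta v) linear_sum /=.
apply: eq_bigr => i _; rewrite linearZ /= mxE deriveE// mulrC.
by [].
Qed.

Lemma is_derive_line g x v (t : R) : differentiable g (x + t *: v) ->
  is_derive t (1 : R) (fun s : R => g (x + s *: v)) (dotv (grad g (x + t *: v)) v).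
Proof.
move=> dg; have dv : derivable g (x + t *: v) v by exact: diff_derivable.
have e : (fun h : R => h^-1 *: (g (h *: v + (x + t *: v)) - g (x + t *: v))) =
   (fun h : R => h^-1 *: (g (x + (h *: (1 : R) + t) *: v) - g (x + t *: v))).
  apply/funext => h; congr (_ *: (g _ - _)).
  by rewrite scalerDl addrCA /GRing.scale /= mulr1.
apply: DeriveDef; first by move: dv; rewrite /derivable e.
by rewrite -derive_grad// /derive e.
Qed.

Lemma taylor_bound g x v (L : R) :
  (forall y, differentiable g y) ->
  (forall t : R, 0 <= t <= 1 ->
     norm2 (grad g (x + t *: v) - grad g x) <= L * (t * norm2 v)) ->
  `|g (x + v) - g x - dotv (grad g x) v| <= L / 2 * norm2 v ^+ 2.
Proof.
move=> dg gL.
suff main (s : R) : `|s| = 1 ->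
    s * (g (x + v) - g x - dotv (grad g x) v) <= L / 2 * norm2 v ^+ 2.
  rewrite ler_norml lerNl -mulN1r main ?normrN1//=.
  by rewrite -[X in X <= _]mul1r main// normr1.
move=> s1.
pose k := L / 2 * norm2 v ^+ 2.
pose phi := (fun t : R => s * g (x + t *: v) - s * dotv (grad g x) v * t - k * t ^+ 2).
pose dphi := (fun t : R => s * dotv (grad g (x + t *: v)) v
   - s * dotv (grad g x) v - k * (2 * t)).
have dphiP (t : R) : is_derive t (1 : R) phi (dphi t).
  have dl := @is_derive_line g x v t (dg _).
  rewrite /phi /dphi.
  apply: is_derive_eq.
  rewrite /GRing.scale /=; ring.
have [|c c01] := @MVT R phi dphi 0 1 ltr01 (fun t _ => dphiP t).
  by apply: derivable_within_continuous => t _; exact: ex_derive.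
rewrite subr0 mulr1 /phi scale1r scale0r addr0 expr0n expr1n /= !mulr0 !mulr1 !subr0.
move=> e.
have {e}-> : s * (g (x + v) - g x - dotv (grad g x) v) = dphi c + k by lra.
rewrite -/k gerDr /dphi.
have [c0 c1] : 0 <= c /\ c <= 1 by rewrite !ltW ?(itvP c01).
have -> : s * dotv (grad g (x + c *: v)) v - s * dotv (grad g x) v =
  s * dotv (grad g (x + c *: v) - grad g x) v by rewrite dotvBl mulrBr.
rewrite subr_le0; apply: le_trans (ler_norm _) _.
rewrite normrM s1 mul1r; apply: le_trans (norm_dotv _ _) _.
apply: le_trans (ler_wpM2r (norm2_ge0 _) (gL c _)) _; first by rewrite c0 c1.
by rewrite /k le_eqVlt; apply/orP; left; apply/eqP; field.
Qed.

Lemma mean_value_bound g x v (M : R) :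
  (forall y, differentiable g y) ->
  (forall t : R, 0 <= t <= 1 -> norm2 (grad g (x + t *: v)) <= M) ->
  `|g (x + v) - g x| <= M * norm2 v.
Proof.
move=> dg gM.
have [|c c01] := @MVT R (fun t : R => g (x + t *: v))
    (fun t => dotv (grad g (x + t *: v)) v) 0 1 ltr01
    (fun t _ => @is_derive_line g x v t (dg _)).
  apply: derivable_within_continuous => t _.
  exact: (@ex_derive _ _ _ _ _ _ _ (@is_derive_line g x v t (dg _))).
rewrite subr0 mulr1 scale1r scale0r addr0 => ->.
apply: le_trans (norm_dotv _ _) _; apply: ler_wpM2r; first exact: norm2_ge0.
by apply: gM; rewrite !ltW ?(itvP c01).
Qed.

Lemma heine_nat (q : R -> R) (e : R) : continuous q -> 0 < e ->
  \forall N \near \oo, forall t s : R, 0 <= t <= 1 ->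
    `|s - t| <= N.+1%:R^-1 -> `|q s - q t| <= e.
Proof.
move=> cq e0.
have : near_covering (`[0, 1]%classic : set R).
  by apply/compact_near_coveringP; exact: segment_compact.
move=> /(_ nat \oo (fun N t => forall s, `|s - t| <= N.+1%:R^-1 ->
  `|q s - q t| <= e) _) H.
suff : \forall N \near \oo, `[0, 1]%classic `<=`
    (fun t => forall s, `|s - t| <= N.+1%:R^-1 -> `|q s - q t| <= e).
  move=> h; near=> N => t s t01; move: s.
  by have := near h N; apply => //; rewrite /= in_itv.
apply: H => t0 _.
have e20 : 0 < e / 2 by exact: divr_gt0.
have /nbhs_ballP[r /= r0 rP] : \forall s \near t0, `|q t0 - q s| <= e / 2.
  by move: (cq t0) => /cvgrPdist_le; apply.
have r20 : 0 < r / 2 by exact: divr_gt0.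
exists (ball t0 (r / 2), [set N | N.+1%:R^-1 < r / 2]).
  split => /=; first exact: nbhsx_ballx.
  near=> N; rewrite /=.
  near: N; exact: near_infty_natSinv_lt (PosNum r20).
move=> [t N] /= [tt0 Nr] s st.
have h1 : `|q t0 - q t| <= e / 2.
  by apply: rP; rewrite /ball /=; apply: lt_trans tt0 _; rewrite ltr_pdivrMr// ltr_pMr// ltr1n.
have h2 : `|q t0 - q s| <= e / 2.
  apply: rP; rewrite /ball /=.
  have -> : t0 - s = (t0 - t) - (s - t) by ring.
  apply: le_lt_trans (ler_normB _ _) _.
  rewrite /ball /= in tt0.
  by rewrite [X in _ < X](splitr r) ltrD// (le_lt_trans st).
have -> : q s - q t = (q t0 - q t) - (q t0 - q s) by ring.
apply: le_trans (ler_normB _ _) _.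
by rewrite [X in _ <= X](splitr e) lerD.
Unshelve. all: by end_near.
Qed.

Lemma riemann_sum_line g x v :
  (forall y, differentiable g y) -> continuous (grad g) ->
  (fun N : nat => N.+1%:R^-1 * \sum_(i < N.+1)
     dotv (grad g (x + (i%:R / N.+1%:R) *: v)) v) @ \oo --> (g (x + v) - g x).
Proof.
move=> dg cg.
pose q := (fun t : R => dotv (grad g (x + t *: v)) v).
have cq : continuous q.
  move=> t.
  apply: (@continuous_comp _ _ _ (fun t : R => grad g (x + t *: v)) (fun y => dotv y v)); last exact: dotv_continuous.
  apply: (@continuous_comp _ _ _ (fun t : R => x + t *: v) (grad g)); last exact: cg.
  by apply: cvgD; [exact: cvg_cst | apply: cvgZr_tmp; exact: cvg_id].
apply/cvgrPdist_le => e e0.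
have := heine_nat cq e0; apply: filterS => N hN.
have N0 : 0 < N.+1%:R :> R by rewrite ltr0n.
have -> : g (x + v) - g x = \sum_(i < N.+1)
    (g (x + (i.+1%:R / N.+1%:R) *: v) - g (x + (i%:R / N.+1%:R) *: v)).
  rewrite -(big_mkord xpredT (fun i => g (x + (i.+1%:R / N.+1%:R) *: v) - g (x + (i%:R / N.+1%:R) *: v))).
  rewrite telescope_sumr// divff ?gt_eqF// scale1r mul0r scale0r addr0.
  by [].
rewrite mulr_sumr -sumrB; apply: le_trans (ler_norm_sum _ _ _) _.
have -> : e = \sum_(i < N.+1) (N.+1%:R^-1 * e).
  by rewrite sumr_const card_ord -[RHS]mulr_natl mulrA divff ?gt_eqF// mul1r.
apply: ler_sum => i _.
have lti : i%:R / N.+1%:R < i.+1%:R / N.+1%:R :> R.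
  by rewrite ltr_pM2r ?invr_gt0// ltr_nat.
have [|c c01 ->] := @MVT R (fun t : R => g (x + t *: v)) q _ _ lti
    (fun t _ => @is_derive_line g x v t (dg _)).
  apply: derivable_within_continuous => t _.
  exact: (@ex_derive _ _ _ _ _ _ _ (@is_derive_line g x v t (dg _))).
have -> : i.+1%:R / N.+1%:R - i%:R / N.+1%:R = N.+1%:R^-1 :> R.
  by rewrite -mulrBl -natrB// subSnn mul1r.
rewrite mulrC -mulrBr normrM gtr0_norm ?invr_gt0//.
rewrite ler_pM2l ?invr_gt0//; apply: hN.
  by rewrite divr_ge0//= ler_pdivrMr// mul1r ler_nat ltnW.
have [c0 c1] : i%:R / N.+1%:R < c /\ c < i.+1%:R / N.+1%:R by rewrite !(itvP c01).
rewrite ger0_norm ?subr_ge0 ?(ltW c0)// lerBlDr.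
apply: le_trans (ltW c1) _.
by rewrite -natr1 mulrDl mul1r addrC.
Unshelve. all: by end_near.
Qed.

End taylor.

Section prox_theory.
Context {R : realType} {n : nat}.
Implicit Types (x y z v w g : 'rV[R]_n) (A : set 'rV[R]_n).

Lemma lipschitz_within (f : 'rV[R]_n -> R) A (a : R) :
  (forall x y, A x -> A y -> `|f x - f y| <= a * norm2 (x - y)) ->
  {within A, continuous f}.
Proof.
move=> fL; apply/subspace_continuousP => x Ax.
apply/cvgrPdist_le => e e0.
have cn : {for x, continuous (fun y => a * norm2 (x - y))}.
  apply: (@lipschitz_continuous2 _ _ _ (fun y => a * norm2 (x - y) : R) `|a|) => y z.
  rewrite -mulrBr normrM ler_wpM2l//.
  have := norm2B_le x z y; have := norm2B_le x y z.
  rewrite (distC2 z y) => h1 h2; rewrite ler_norml; apply/andP; split; lra.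
move: cn => /(@cvgrPdist_le _ _ _ _ (nbhs_filter x))/(_ _ e0).
rewrite subrr norm2_0 mulr0 /within /=.
apply: filterS => y; rewrite sub0r normrN => h Ay.
apply: le_trans (fL _ _ Ax Ay) _; exact: le_trans (ler_norm _) h.
Qed.

Lemma compact_norm2_bounded A (D : R) : closed A ->
  (forall x, A x -> norm2 x <= D) -> compact A.
Proof.
move=> cA AD; apply: bounded_closed_compact => //.
exists D; split; first exact: num_real.
move=> M DM x Ax; apply: ltW; apply: le_lt_trans DM.
exact: le_trans (mx_norm_le_norm2 _) (AD _ Ax).
Qed.

Definition prox_regular A (h : 'rV[R]_n -> \bar R) :=
  [/\ A !=set0, compact A,
      forall x y (t : R), A x -> A y -> 0 <= t <= 1 ->
        A (t *: x + (1 - t) *: y),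
      econvex h &
      (forall x, A x -> h x \is a fin_num) /\
      exists M : R, forall x y, A x -> A y ->
        fine (h x) - fine (h y) <= M * norm2 (x - y)].

Lemma prox_regular0 A (h : 'rV[R]_n -> \bar R) :
  prox_regular A h -> prox_regular A (fun=> 0%E).
Proof.
move=> [A0 cA cvA _ _]; split => //.
  by move=> x y t _; rewrite !mule0 adde0.
by split => //; exists 0 => x y _ _; rewrite subrr mul0r.
Qed.

Section prox_points.
Variables (A : set 'rV[R]_n) (h : 'rV[R]_n -> \bar R).
Hypothesis Ah : prox_regular A h.
Variable (eta : R).
Hypothesis eta0 : 0 < eta.

Lemma prox_argmin g x : argmin A
    (fun y => (dotv g y)%:E + h y + (eta^-1 * bregman x y)%:E)%E
    (prox A h eta g x).
Proof.
have [A0 cA cvA ch [hf [M hM]]] := Ah.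
apply: (@xgetPex _ x).
pose f := (fine \o h) + (fun y => dotv y g + eta^-1 * bregman x y).
have cf : {within A, continuous f}.
  move=> z; apply: continuousD _.
    apply: (@lipschitz_within _ A M) => y1 y2 A1 A2.
    have := hM _ _ A1 A2; have := hM _ _ A2 A1.
    by rewrite (distC2 y2) /= => h1 h2; rewrite ler_norml; apply/andP; split; lra.
  move: z; apply: continuous_subspaceT => z.
  apply: (@continuousD _ R^o _ (fun y => dotv y g : R^o)
    (fun y => eta^-1 * bregman x y : R^o)); first exact: dotv_continuous.
  apply: (@continuous_comp _ _ _ (fun y => norm2 (x - y))
    (fun t : R => eta^-1 * (2^-1 * t ^+ 2))); last first.
    move=> t; apply: cvgM; first exact: cvg_cst.
    by apply: cvgM; [exact: cvg_cst|exact: exprn_continuous].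
  apply: (@continuous_comp _ _ _ (fun y => x - y) (@norm2 R n)); last exact: norm2_continuous.
  apply: (@lipschitz2_continuous _ _ _ (fun y => x - y) 1) => u v.
  by rewrite mul1r opprB addrC addrA subrK distC2.
have [c Ac cmin] := EVT_min_rV A0 cA cf.
exists c; split; first by rewrite inE in Ac.
move=> z Az; have := cmin z; rewrite inE => /(_ Az).
rewrite inE in Ac.
by rewrite -(fineK (hf _ Ac)) -(fineK (hf _ Az)) -!EFinD lee_fin /f !(dotvC g) /= !fctE; lra.
Qed.

Lemma prox_feas g x : A (prox A h eta g x).
Proof. by have [] := prox_argmin g x. Qed.

Lemma prox_vi g x y (p := prox A h eta g x) : A y ->
  dotv g (p - y) + fine (h p) - fine (h y) <= eta^-1 * dotv (x - p) (p - y).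
Proof.
move=> Ay; have [A0 cA cvA ch [hf _]] := Ah.
have [Ap pmin] := prox_argmin g x; rewrite -/p in Ap pmin.
set D := dotv (y - p) (y - p).
set b := (X in _ <= X); set a := (X in X <= _).
have D0 : 0 <= D by exact: dotvv_ge0.
have key (t : R) : 0 < t <= 1 -> a <= b + t * (eta^-1 * D).
  move=> /andP[t0 t1].
  have At : A (t *: y + (1 - t) *: p) by apply: cvA => //; rewrite (ltW t0).
  have := pmin _ At; have := ch y p t; rewrite (ltW t0) t1 => /(_ isT).
  rewrite -(fineK (hf _ Ap)) -(fineK (hf _ At)) -(fineK (hf _ Ay)).
  rewrite -!EFinM -!EFinD !lee_fin.
  have -> : t *: y + (1 - t) *: p = p + t *: (y - p).
    by rewrite scalerBl scale1r scalerBr addrCA addrA addrC.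
  rewrite /bregman !norm2_sqr opprD addrA.
  rewrite -(addrA x) -opprD.
  have -> : x - (p + t *: (y - p)) = (x - p) - t *: (y - p).
    by rewrite opprD addrA.
  rewrite !(dotvBl (x - p), dotvBr _ (x - p), dotvZl, dotvZr, dotvDr g p) -/D.
  rewrite (dotvC (y - p) (x - p)) /a /b.
  have -> : dotv (x - p) (p - y) = - dotv (x - p) (y - p) by rewrite -dotvNr opprB.
  have -> : dotv g (p - y) = - dotv g (y - p) by rewrite -dotvNr opprB.
  set P := dotv (x - p) (y - p); set G := dotv g (y - p).
  move: (fine (h p)) (fine (h y)) (fine (h (p + t *: (y - p)))) => hp hy ht h1 h2.
  have e0 : 0 < eta^-1 by rewrite invr_gt0.
  rewrite -(ler_pM2l t0).
  have tD : 0 <= eta^-1 * (t * (t * D)) by rewrite !mulr_ge0 ?(ltW t0) ?(ltW e0).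
  move: h1 h2 tD; move: (eta^-1) => ie; move: (dotv (x - p) (x - p)) (dotv g p) => Q gp.
  nra.
have eD : 0 <= eta^-1 * D by rewrite mulr_ge0// invr_ge0 ltW.
apply/ler_addgt0Pr => e e0.
have c0 : 0 < eta^-1 * D + 1 by rewrite ltr_wpDl.
pose t := Num.min 1 (e / (eta^-1 * D + 1)).
have t01 : 0 < t <= 1.
  by rewrite /t lt_min ltr01 divr_gt0//= ge_min lexx.
apply: le_trans (key t t01) _; rewrite lerD2l.
apply: (@le_trans _ _ (e / (eta^-1 * D + 1) * (eta^-1 * D))).
  by rewrite ler_wpM2r// /t ge_min lexx orbT.
rewrite -mulrA ler_piMr// ?(ltW e0)// mulrC ler_pdivrMr// mul1r; lra.
Qed.

Lemma prox_nonexpansive g x g' x' :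
  norm2 (prox A h eta g x - prox A h eta g' x') <=
  norm2 ((x - eta *: g) - (x' - eta *: g')).
Proof.
have := @prox_vi g x _ (prox_feas g' x').
have := @prox_vi g' x' _ (prox_feas g x).
move: (prox A h eta g x) (prox A h eta g' x') => p p' /= h1 h2.
set r := (X in _ <= norm2 X).
have : dotv (p - p') (p - p') <= dotv r (p - p').
  move: h1 h2; rewrite !ler_pdivlMl// /r !(dotvBl, dotvBr, dotvZl, dotvZr) (dotvC p' p).
  move: (fine (h p)) (fine (h p')) => hp hp'; lra.
rewrite -norm2_sqr => h3.
have := le_trans h3 (cauchy_schwarz _ _).
have [->|d0] := eqVneq (norm2 (p - p')) 0; first by rewrite norm2_ge0.
have dp : 0 < norm2 (p - p') by rewrite lt_def d0 norm2_ge0.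
by rewrite expr2 ler_pM2r.
Qed.

Lemma prox_shift g x : prox A h eta g x = prox A h eta 0 (x - eta *: g).
Proof.
apply/eqP; rewrite -subr_eq0; apply/eqP/norm2_eq0/eqP.
rewrite eq_le norm2_ge0 andbT; apply: le_trans (prox_nonexpansive _ _ _ _) _.
by rewrite scaler0 subr0 subrr norm2_0.
Qed.

End prox_points.
End prox_theory.

Section normal_cone_theory.
Context {R : realType} {n : nat}.
Implicit Types (x y z v w g : 'rV[R]_n) (A : set 'rV[R]_n).

Lemma closed_norm2_ball w (M : R) : closed [set v | norm2 (w + v) <= M].
Proof.
have -> : [set v | norm2 (w + v) <= M] =
    (fun v => norm2 (w + v)) @^-1` [set t | t <= M] by [].
apply: closed_comp; last exact: closed_le.
move=> v _.
apply: (@continuous_comp _ _ _ (fun v => w + v) (@norm2 R n));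
  last exact: norm2_continuous.
apply: (@lipschitz2_continuous _ _ _ (fun v => w + v) 1) => x y.
by rewrite mul1r opprD addrACA subrr add0r.
Qed.

(* If y_t projects x - t w onto A, then -w - (y_t - x)/t is normal at y_t; let
   t tend to 0. *)
Lemma normal_cone_near A (h : 'rV[R]_n -> \bar R) w x (M : R) :
  prox_regular A h -> A x ->
  (forall y, A y -> 0 <= dotv w (y - x) + M * norm2 (y - x)) ->
  0 <= M ->
  exists2 v, normal_cone A x v & norm2 (w + v) <= M.
Proof.
move=> Ah Ax vi M0.
have A0 := prox_regular0 Ah.
pose tau (N : nat) : R := N.+1%:R^-1.
have tau0 N : 0 < tau N by rewrite invr_gt0.
pose y_ N := prox A (fun=> 0%E) (tau N) w x.
pose t_ N := (tau N)^-1 *: (y_ N - x).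
pose n_ N := - w - t_ N.
have Ay N : A (y_ N) by exact: prox_feas.
have yx N : y_ N - x = tau N *: t_ N by rewrite scalerA divff ?scale1r// gt_eqF.
have viy N y : A y -> dotv (n_ N) (y - y_ N) <= 0.
  move=> Ayy; have := prox_vi A0 (tau0 N) w x Ayy; rewrite -/(y_ N) /= subr0 addr0.
  rewrite -(opprB (y_ N) x) (dotvNl (y_ N - x)) mulrN -dotvZl -/(t_ N) /n_.
  by rewrite -opprD dotvNl -dotvNr opprB dotvDl; lra.
have tM N : norm2 (t_ N) <= M.
  have := viy N x Ax; rewrite -opprB dotvNr yx dotvZr oppr_le0 pmulr_rge0//.
  rewrite /n_ dotvBl dotvNl -norm2_sqr => h1.
  have := vi _ (Ay N); rewrite yx dotvZr norm2Z gtr0_norm// mulrCA -mulrDr pmulr_rge0//.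
  move=> h2; rewrite leNgt; apply/negP => h3.
  have : 0 < norm2 (t_ N) * (norm2 (t_ N) - M).
    by apply: mulr_gt0; [apply: le_lt_trans h3|rewrite subr_gt0].
  nra.
have nM N : norm2 (w + n_ N) <= M by rewrite /n_ addrA subrr sub0r norm2N.
have cB : compact [set v | norm2 (w + v) <= M].
  apply: (@compact_norm2_bounded _ _ _ (M + norm2 w)); first exact: closed_norm2_ball.
  move=> v /= h1; have -> : v = (w + v) - w by rewrite addrAC subrr add0r.
  by apply: le_trans (norm2D _ _) _; rewrite norm2N lerD2r.
have [|v [Mv clv]] := cB (n_ @ \oo) _; first by exists 0%N => // N _; exact: nM.
exists v => // y Ayy.
rewrite leNgt; apply/negP => e0; set e := dotv v (y - x) in e0.
have e20 : 0 < e / 2 by exact: divr_gt0.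
pose C := (M + norm2 w) * M + 1.
have C0 : 0 < C by rewrite ltr_wpDl// mulr_ge0// addr_ge0// norm2_ge0.
have small : \forall N \near \oo, dotv (n_ N) (y - x) <= e / 2.
  have eC : 0 < e / 2 / C by exact: divr_gt0.
  have := near_infty_natSinv_lt (PosNum eC); apply: filterS => N /= hN.
  have -> : y - x = (y - y_ N) + (y_ N - x) by rewrite addrA subrK.
  rewrite dotvDr; apply: (@le_trans _ _ (dotv (n_ N) (y_ N - x))).
    by rewrite gerDr viy.
  rewrite yx dotvZr.
  apply: (@le_trans _ _ (tau N * C)).
    rewrite ler_pM2l//; apply: le_trans (cauchy_schwarz _ _) _.
    apply: (@le_trans _ _ ((M + norm2 w) * M)); last by rewrite lerDl.
    apply: ler_pM => //; try exact: norm2_ge0.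
    have -> : n_ N = (w + n_ N) - w by rewrite addrAC subrr add0r.
    by apply: le_trans (norm2D _ _) _; rewrite norm2N lerD2r.
  by rewrite -ler_pdivlMr// ltW.
have nb : nbhs v [set v' | e / 2 < dotv v' (y - x)].
  apply: (@dotv_continuous R n (y - x) v [set t : R | e / 2 < t]).
  apply: open_nbhs_nbhs; split; first exact: open_gt.
  by rewrite /= -/e ltr_pdivrMr// ltr_pMr// ltr1n.
have [u [/= h1 h2]] := clv [set v' | dotv v' (y - x) <= e / 2] _ small nb.
by move: (lt_le_trans h2 h1); rewrite ltxx.
Qed.

End normal_cone_theory.

(** * Random vectors *)

Section vector_measurability.
Context {R : realType}.

Lemma measurable_coord {n} (i : 'I_n) :
  measurable_fun setT (fun v : rvec R n => (v : 'rV[R]_n) ord0 i).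
Proof.
move=> _ B mB; apply: sub_sigma_algebra.
by exists i => //; exists B => //; rewrite setTI.
Qed.

Context {d} {T : measurableType d}.

Lemma measurable_rvec {n} (X : T -> rvec R n) :
  (forall i, measurable_fun setT (fun w => (X w : 'rV[R]_n) ord0 i)) ->
  measurable_fun setT X.
Proof.
move=> mX _ A mA; rewrite setTI.
suff : (<<s @coordinate_cylinders R n >> : set (set 'rV[R]_n)) `<=`
    [set A | measurable (X @^-1` A)] by move/(_ A mA).
apply: smallest_sub.
  split => /=.
  - by rewrite preimage_set0; exact: measurable0.
  - by move=> B mB; rewrite setTD preimage_setC; exact: measurableC.
  - by move=> F mF; rewrite preimage_bigcup; exact: bigcup_measurable.
move=> _ [i _ [B mB <-]] /=.
by have := mX i measurableT B mB; rewrite !setTI.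
Qed.

Lemma measurable_coord_comp {n} (X : T -> rvec R n) i :
  measurable_fun setT X -> measurable_fun setT (fun w => (X w : 'rV[R]_n) ord0 i).
Proof. by move=> mX; apply: (measurableT_comp (measurable_coord i)). Qed.

Let round {n} (N : nat) (x : 'rV[R]_n) : 'rV[R]_n :=
  \row_i ((Num.floor (N.+1%:R * x ord0 i))%:~R / N.+1%:R).

Let round_cvg n (x : 'rV[R]_n) (N : nat) : `|x - round N x| <= N.+1%:R^-1.
Proof.
rewrite [`|_|]mx_normrE; apply: bigmax_le; first by rewrite invr_ge0.
move=> [i j] _ /=; rewrite ord1 !mxE.
set y := N.+1%:R * x ord0 j.
have N0 : 0 < N.+1%:R :> R by rewrite ltr0n.
have -> : x ord0 j - (Num.floor y)%:~R / N.+1%:R = N.+1%:R^-1 * (y - (Num.floor y)%:~R).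
  by rewrite mulrBr /y mulrA mulVf ?gt_eqF// mul1r mulrC [_^-1 * _]mulrC.
rewrite normrM gtr0_norm ?invr_gt0// ler_piMr ?invr_ge0 ?ltW//.
have /andP[h1] := floor_itv y; rewrite intrD mulr1z => h2.
rewrite ger0_norm ?subr_ge0//; lra.
Qed.

(* The vector argument is rounded to a countable grid, which is refined. *)
Lemma measurable_caratheodory {n} (phi : 'rV[R]_n -> T -> R) (X : T -> rvec R n) :
  (forall x, measurable_fun setT (phi x)) ->
  (forall t, continuous (phi ^~ t)) ->
  measurable_fun setT X ->
  measurable_fun setT (fun t => phi (X t) t).
Proof.
move=> mphi cphi mX.
apply: (@measurable_fun_cvg _ _ _ _ (fun N t => phi (round N (X t)) t)).
  move=> N _ B mB; rewrite setTI.
  pose E (z : 'rV[int]_n) : set T :=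
    (\bigcap_(i in [set: 'I_n]) ((fun t => N.+1%:R * (X t : 'rV[R]_n) ord0 i) @^-1`
         `[(z ord0 i)%:~R, (z ord0 i + 1)%:~R[%classic)) `&`
    (phi (\row_i ((z ord0 i)%:~R / N.+1%:R)) @^-1` B).
  have -> : (fun t => phi (round N (X t)) t) @^-1` B =
      \bigcup_k (if unpickle k is Some z then E z else set0).
    apply/seteqP; split => [t /= Bx|t [k _]].
      exists (pickle (\row_i Num.floor (N.+1%:R * (X t : 'rV[R]_n) ord0 i))) => //.
      rewrite pickleK; split => [i _|] /=; first by rewrite mxE in_itv /= floor_itv.
      move: Bx; congr (B (phi _ t)).
      by apply/rowP => i; rewrite !mxE.
    case: unpickle => // z [/= zx Bz].
    move: Bz; congr (B (phi _ t)).
    apply/rowP => i; rewrite !mxE.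
    by have := zx i I; rewrite /= in_itv /= => /floor_def ->.
  apply: bigcup_measurable => k _; case: unpickle => // z.
  apply: measurableI; last by rewrite -[X in measurable X]setTI; exact: mphi.
  apply: fin_bigcap_measurable; first exact: finite_finset.
  move=> i _; rewrite -[X in measurable X]setTI.
  have : measurable_fun setT (fun t => N.+1%:R * (X t : 'rV[R]_n) ord0 i).
    by apply: measurable_funM => //; exact: measurable_coord_comp.
  by apply => //; exact: measurable_itv.
move=> t _ /=.
apply: (@cvg_comp _ _ _ (fun N => round N (X t)) (phi ^~ t) _ (nbhs (X t : 'rV[R]_n)));
  last exact: cphi.
apply/cvgrPdist_le => e e0.
have := near_infty_natSinv_lt (PosNum e0); apply: filterS => N /= hN.
exact: le_trans (round_cvg (X t) N) (ltW hN).
Qed.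

Lemma measurable_continuous {n} (g : 'rV[R]_n -> R) (X : T -> rvec R n) :
  continuous g -> measurable_fun setT X -> measurable_fun setT (fun t => g (X t)).
Proof.
by move=> cg mX; apply: (@measurable_caratheodory _ (fun x _ => g x)).
Qed.

Lemma measurable_vec_continuous {n m} (g : 'rV[R]_n -> 'rV[R]_m) (X : T -> rvec R n) :
  continuous g -> measurable_fun setT X ->
  measurable_fun setT (fun t => g (X t) : rvec R m).
Proof.
move=> cg mX; apply: measurable_rvec => i.
apply: (@measurable_continuous _ (fun x => g x ord0 i)) => // x.
by apply: (@continuous_comp _ _ _ g (fun y => y ord0 i)); [exact: cg|exact: coord_continuous].
Qed.

Lemma measurable_vecD {n} (X Y : T -> rvec R n) :
  measurable_fun setT X -> measurable_fun setT Y ->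
  measurable_fun setT (fun t => (X t : 'rV[R]_n) + Y t : rvec R n).
Proof.
move=> mX mY; apply: measurable_rvec => i; under eq_fun do rewrite mxE.
by apply: measurable_funD; exact: measurable_coord_comp.
Qed.

Lemma measurable_vecZ {n} (a : T -> R) (X : T -> rvec R n) :
  measurable_fun setT a -> measurable_fun setT X ->
  measurable_fun setT (fun t => a t *: (X t : 'rV[R]_n) : rvec R n).
Proof.
move=> ma mX; apply: measurable_rvec => i; under eq_fun do rewrite mxE.
by apply: measurable_funM => //; exact: measurable_coord_comp.
Qed.

Lemma measurable_vecN {n} (X : T -> rvec R n) :
  measurable_fun setT X ->
  measurable_fun setT (fun t => - (X t : 'rV[R]_n) : rvec R n).
Proof.
move=> mX; apply: measurable_rvec => i; under eq_fun do rewrite mxE.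
by apply: measurableT_comp => //; exact: measurable_coord_comp.
Qed.

Lemma measurable_vecB {n} (X Y : T -> rvec R n) :
  measurable_fun setT X -> measurable_fun setT Y ->
  measurable_fun setT (fun t => (X t : 'rV[R]_n) - Y t : rvec R n).
Proof.
by move=> mX mY; apply: measurable_vecD => //; exact: measurable_vecN.
Qed.

Lemma measurable_vec_sum {n} (I : Type) (r : seq I) (X : I -> T -> rvec R n) :
  (forall i, measurable_fun setT (X i)) ->
  measurable_fun setT (fun t => \sum_(i <- r) (X i t : 'rV[R]_n) : rvec R n).
Proof.
move=> mX; elim: r => [|i r ih].
  by under eq_fun do rewrite big_nil; exact: measurable_cst.
by under eq_fun do rewrite big_cons; exact: measurable_vecD.
Qed.

Lemma measurable_dotv {n} (X Y : T -> rvec R n) :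
  measurable_fun setT X -> measurable_fun setT Y ->
  measurable_fun setT (fun t => dotv (X t : 'rV[R]_n) (Y t)).
Proof.
move=> mX mY; apply: measurable_sum => i.
by apply: measurable_funM; exact: measurable_coord_comp.
Qed.

Lemma measurable_norm2 {n} (X : T -> rvec R n) :
  measurable_fun setT X -> measurable_fun setT (fun t => norm2 (X t : 'rV[R]_n)).
Proof. exact: measurable_continuous (@norm2_continuous R n). Qed.

End vector_measurability.

Section sign_vectors.
Context {R : realType} {d : nat}.
Implicit Types (e : {ffun 'I_d -> bool}) (a b : 'rV[R]_d).

Definition sign_vec e : 'rV[R]_d := \row_i (-1) ^+ e i.

Definition sign_mean (F : {ffun 'I_d -> bool} -> R) : R :=
  (2 ^+ d)^-1 * \sum_e F e.

Lemma sign_mean_cst (x : R) : sign_mean (fun=> x) = x.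
Proof.
rewrite /sign_mean sumr_const card_ffun card_bool card_ord -[x *+ _]mulr_natl mulrA natrX.
by rewrite mulVf ?mul1r// expf_neq0.
Qed.

Lemma sign_meanD F G : sign_mean (fun e => F e + G e) = sign_mean F + sign_mean G.
Proof. by rewrite /sign_mean big_split mulrDr. Qed.

Lemma sign_meanZ (x : R) F : sign_mean (fun e => x * F e) = x * sign_mean F.
Proof. by rewrite /sign_mean -mulr_sumr mulrCA. Qed.

Lemma eq_sign_mean F G : F =1 G -> sign_mean F = sign_mean G.
Proof. by move=> FG; congr (_ * _); apply: eq_bigr. Qed.

Lemma sign_mean_le F G : (forall e, F e <= G e) -> sign_mean F <= sign_mean G.
Proof.
by move=> FG; rewrite ler_wpM2l ?invr_ge0 ?exprn_ge0//; apply: ler_sum.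
Qed.

Lemma sign_mean_sum (I : finType) (F : I -> {ffun 'I_d -> bool} -> R) :
  sign_mean (fun e => \sum_i F i e) = \sum_i sign_mean (F i).
Proof. by rewrite /sign_mean exchange_big mulr_sumr. Qed.

Lemma sign_vec_sqr e i : sign_vec e ord0 i * sign_vec e ord0 i = 1.
Proof. by rewrite mxE -expr2 sqrr_sign. Qed.

Lemma dotv_sign_vec e : dotv (sign_vec e) (sign_vec e) = d%:R.
Proof.
by rewrite /dotv (eq_bigr (fun=> 1)) ?sumr_const ?card_ord// => i _; exact: sign_vec_sqr.
Qed.

Lemma sign_mean_coord i j :
  sign_mean (fun e => sign_vec e ord0 i * sign_vec e ord0 j) = (i == j)%:R.
Proof.
have [->|ij] := eqVneq i j.
  by rewrite (eq_sign_mean (G := fun=> 1)) ?sign_mean_cst// => e; exact: sign_vec_sqr.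
pose flip e : {ffun 'I_d -> bool} := [ffun l => if l == i then ~~ e l else e l].
have flipK : involutive flip.
  by move=> e; apply/ffunP => l; rewrite !ffunE; case: eqP => // _; rewrite negbK.
apply/eqP; rewrite -[_ == _]orFb -(@mulrn_eq0 R _ 2) mulr2n /sign_mean.
rewrite {1}(reindex_inj (inv_inj flipK)) -mulrDr -big_split big1 ?mulr0// => e _ /=.
rewrite !mxE !ffunE eqxx (negbTE (_ : j != i)) 1?eq_sym//.
by case: (e i) => /=; rewrite ?expr0 ?expr1; ring.
Qed.

Lemma sign_mean_dotv a b :
  sign_mean (fun e => dotv a (sign_vec e) * dotv b (sign_vec e)) = dotv a b.
Proof.
rewrite (eq_sign_mean (G := fun e => \sum_i \sum_j (a ord0 i * b ord0 j) *
    (sign_vec e ord0 i * sign_vec e ord0 j))); last first.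
  move=> e; rewrite /dotv mulr_suml; apply: eq_bigr => i _; rewrite mulr_sumr.
  by apply: eq_bigr => j _; rewrite mulrACA.
rewrite sign_mean_sum; apply: eq_bigr => i _; rewrite sign_mean_sum (bigD1 i)//=.
rewrite sign_meanZ sign_mean_coord eqxx mulr1 big1 ?addr0// => j ji.
by rewrite sign_meanZ sign_mean_coord eq_sym (negbTE ji) mulr0.
Qed.

End sign_vectors.

Section rademacher_law.
Context {R : realType} {d : nat}.
Variable Pu : probability (rvec R d) R.
Hypothesis rad : rademacher Pu.
Local Open Scope ereal_scope.

Lemma measurable_vec_set1 (v : 'rV[R]_d) : measurable ([set v] : set (rvec R d)).
Proof.
have -> : [set v] = \bigcap_(i in [set: 'I_d])
    ((fun u : rvec R d => (u : 'rV[R]_d) ord0 i) @^-1` [set v ord0 i]).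
  apply/seteqP; split => [u -> //|u h]; apply/rowP => i; exact: (h i I).
apply: fin_bigcap_measurable; first exact: finite_finset.
by move=> i _; rewrite -[X in measurable X]setTI; apply: measurable_coord => //.
Qed.

Lemma rademacher_set1 e : Pu [set sign_vec e] = ((2 ^+ d)^-1)%:E.
Proof.
have [ind half] := rad.
have := ind (enum 'I_d) (enum_uniq _) (fun _ _ => I)
  (fun i => [set v : rvec R d | (v : 'rV[R]_d) ord0 i = ((-1) ^+ e i)%R]) _.
have h i : i \in enum 'I_d -> generated_by (fun v : rvec R d => (v : 'rV[R]_d) ord0 i : R)
    [set v : rvec R d | (v : 'rV[R]_d) ord0 i = ((-1) ^+ e i)%R].
  by move=> _; exists [set ((-1) ^+ e i)%R] => //; rewrite setTI.
move=> /(_ h).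
have -> : \bigcap_(i in [set` enum 'I_d]) [set v : rvec R d | (v : 'rV[R]_d) ord0 i = ((-1) ^+ e i)%R]
    = [set sign_vec e].
  apply/seteqP; split => [v hv|v ->].
    by apply/rowP => i; rewrite mxE; apply: hv; rewrite /= mem_enum.
  by move=> i _; rewrite /= mxE.
move=> ->; rewrite (eq_bigr (fun=> (2^-1)%:E)); last first.
  by move=> i _; have [h1 h2] := half i; case: (e i); rewrite ?expr0 ?expr1.
by rewrite prodEFin big_const_seq count_predT -cardE card_ord iter_mulr_1 exprVn.
Qed.

Lemma rademacher_integral (phi : rvec R d -> \bar R) :
  measurable_fun setT phi -> (forall v, 0 <= phi v) ->
  \int[Pu]_v phi v = \sum_(e : {ffun 'I_d -> bool}) ((2 ^+ d)^-1)%:E * phi (sign_vec e).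
Proof.
move=> mphi phi0.
pose F (e : {ffun 'I_d -> bool}) : set (rvec R d) := [set sign_vec e].
pose r := enum {ffun 'I_d -> bool}.
pose S := \big[setU/set0]_(e <- r) F e.
have mF e : measurable (F e) by exact: measurable_vec_set1.
have mS : measurable S by exact: bigsetU_measurable.
have sign_vec_inj : injective (@sign_vec R d).
  move=> e e' /rowP ee'; apply/ffunP => i; have := ee' i; rewrite !mxE.
  case: (e i) (e' i) => -[] //=; rewrite expr0 expr1 => /eqP.
    by rewrite eqNr oner_eq0.
  by rewrite eq_sym eqNr oner_eq0.
have tF : trivIset [set` r] F.
  apply/trivIsetP => e e' _ _ ee'; apply/seteqP; split => // v [-> /sign_vec_inj].
  by move/eqP; rewrite (negbTE ee').
have PF : \sum_(e <- r) Pu (F e) = 1.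
  under eq_bigr do rewrite rademacher_set1.
  rewrite sumEFin big_enum; congr EFin.
  rewrite -[RHS](@sign_mean_cst R d 1%R) /sign_mean mulr_sumr.
  by apply: eq_bigr => e _; rewrite mulr1.
have PS : Pu S = 1.
  rewrite -[LHS]mul1e -(integral_cst Pu mS) ge0_integral_bigsetU//; last first.
    by rewrite /r enum_uniq.
  by rewrite -[RHS]PF; apply: eq_bigr => e _; rewrite integral_cst// mul1e.
have PSC : Pu (~` S) = 0 by rewrite probability_setC// PS subee.
have -> : \int[Pu]_v phi v = \int[Pu]_(v in S) phi v.
  rewrite (@ge0_negligible_integral _ _ _ Pu setT (~` S) phi (measurableC mS)
    measurableT mphi (fun v _ => phi0 v) PSC).
  by rewrite setTD setCK.
rewrite ge0_integral_bigsetU//; last 2 first.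
  by rewrite /r enum_uniq.
  exact: measurable_funTS.
rewrite big_enum; apply: eq_bigr => e _.
rewrite (eq_integral (cst (phi (sign_vec e)))); last first.
  by move=> v; rewrite inE => ->.
by rewrite integral_cst// muleC; congr (_ * _); exact: rademacher_set1.
Qed.

Lemma rademacher_range e : range_of Pu (sign_vec e).
Proof.
move=> r r0; apply: (@lt_le_trans _ _ (Pu [set sign_vec e])).
  by rewrite rademacher_set1 lte_fin invr_gt0 exprn_gt0.
apply: le_measure; rewrite ?inE.
- exact: measurable_vec_set1.
- have -> : [set w : rvec R d | (norm2 ((w : 'rV[R]_d) - sign_vec e) < r)%R] =
    setT `&` (fun w : rvec R d => norm2 ((w : 'rV[R]_d) - sign_vec e)) @^-1` `]-oo, r[%classic.
    by rewrite setTI; apply/seteqP; split => w /=; rewrite in_itv.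
  have : measurable_fun setT (fun w : rvec R d => norm2 ((w : 'rV[R]_d) - sign_vec e)).
    by apply: measurable_norm2; apply: measurable_vecB => //; exact: measurable_id.
  by apply => //; exact: measurable_itv.
- by move=> w -> /=; rewrite subrr norm2_0.
Qed.

Lemma rademacher_sixth_moment : sixth_moment Pu = (d%:R ^+ 3)%R.
Proof.
rewrite /sixth_moment unlock rademacher_integral; last 2 first.
- apply/measurable_EFinP; apply: measurable_funX; apply: measurable_norm2.
  exact: measurable_id.
- by move=> v; rewrite lee_fin exprn_ge0// norm2_ge0.
under eq_bigr => e _.
  rewrite (_ : norm2 (sign_vec e) ^+ 6 = d%:R ^+ 3)%R; last first.
    by rewrite (exprM _ 2 3) norm2_sqr dotv_sign_vec.
  over.
rewrite -EFinM sumEFin /= -mulr_sumr -/(sign_mean (fun=> _)).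
exact: sign_mean_cst.
Qed.

End rademacher_law.

Section nonnegative_means.
Context {R : realType} {d} {T : measurableType d} (P : probability T R).
Implicit Types (f g : T -> R).

(* Nonnegative with finite mean; [mean] is then its expectation (and 0 when the
   expectation is infinite). *)
Definition summable1 f := [/\ measurable_fun setT f, forall x, 0 <= f x &
  (\int[P]_x (f x)%:E < +oo)%E].

Definition mean f : R := fine (\int[P]_x (f x)%:E)%E.

Lemma summable1_mean f : summable1 f -> (\int[P]_x (f x)%:E)%E = (mean f)%:E.
Proof.
move=> [mf f0 foo]; rewrite /mean fineK// ge0_fin_numE//.
by apply: integral_ge0 => x _; rewrite lee_fin.
Qed.

Lemma mean_ge0 f : (forall x, 0 <= f x) -> 0 <= mean f.
Proof. by move=> f0; apply: fine_ge0; apply: integral_ge0 => x _; rewrite lee_fin. Qed.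

Lemma summable1_le f g : measurable_fun setT f -> (forall x, 0 <= f x <= g x) ->
  summable1 g -> summable1 f.
Proof.
move=> mf fg [mg g0 goo]; split => // [x|]; first by have /andP[] := fg x.
apply: le_lt_trans goo; apply: ge0_le_integral => //.
- by move=> x _; rewrite lee_fin; have /andP[] := fg x.
- exact/measurable_EFinP.
- exact/measurable_EFinP.
- by move=> x _; rewrite lee_fin; have /andP[] := fg x.
Qed.

Lemma mean_le f g : summable1 f -> summable1 g -> (forall x, f x <= g x) ->
  mean f <= mean g.
Proof.
move=> sf sg fg; rewrite -lee_fin -!summable1_mean//.
have [mf f0 _] := sf; have [mg g0 _] := sg.
apply: ge0_le_integral => //; try (by move=> x _; rewrite lee_fin).
- exact/measurable_EFinP.
- exact/measurable_EFinP.
Qed.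

Lemma mean_ae_le f g : summable1 f -> summable1 g -> {ae P, forall x, f x <= g x} ->
  mean f <= mean g.
Proof.
move=> sf sg fg; rewrite -lee_fin -!summable1_mean//.
have [mf f0 _] := sf; have [mg g0 _] := sg.
apply: ae_ge0_le_integral => //; try (by move=> x _; rewrite lee_fin).
- exact/measurable_EFinP.
- exact/measurable_EFinP.
- by apply: filterS fg => x h _; rewrite lee_fin.
Qed.

Lemma integral_cst_probability (a : R) : (\int[P]_x a%:E = a%:E)%E.
Proof.
rewrite (integral_cst P measurableT) -[RHS]mule1; congr (_ * _)%E.
exact: probability_setT.
Qed.

Lemma summable1_cst (a : R) : 0 <= a -> summable1 (fun=> a).
Proof.
move=> a0; split => //.
by rewrite integral_cst_probability ltry.
Qed.

Lemma mean_cst (a : R) : mean (fun=> a) = a.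
Proof. by rewrite /mean integral_cst_probability. Qed.

Lemma summable1D f g : summable1 f -> summable1 g -> summable1 (fun x => f x + g x).
Proof.
move=> [mf f0 foo] [mg g0 goo]; split => //.
- exact: measurable_funD.
- by move=> x; rewrite addr_ge0.
under eq_integral do rewrite EFinD.
rewrite ge0_integralD//; try (by move=> x _; rewrite lee_fin).
- exact: lte_add_pinfty.
- exact/measurable_EFinP.
- exact/measurable_EFinP.
Qed.

Lemma meanD f g : summable1 f -> summable1 g ->
  mean (fun x => f x + g x) = mean f + mean g.
Proof.
move=> sf sg; apply: EFin_inj; rewrite EFinD -!summable1_mean//; last exact: summable1D.
under eq_integral do rewrite EFinD.
move: sf sg => [mf f0 foo] [mg g0 goo].
rewrite ge0_integralD//; try (by move=> x _; rewrite lee_fin).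
- exact/measurable_EFinP.
- exact/measurable_EFinP.
Qed.

Lemma meanZ (a : R) f : 0 <= a -> measurable_fun setT f -> (forall x, 0 <= f x) ->
  (\int[P]_x (a * f x)%:E)%E = (a%:E * \int[P]_x (f x)%:E)%E.
Proof.
move=> a0 mf f0; under eq_integral do rewrite EFinM.
rewrite ge0_integralZl_EFin//; first by move=> x _; rewrite lee_fin.
exact/measurable_EFinP.
Qed.

Lemma summable1Z (a : R) f : 0 <= a -> summable1 f -> summable1 (fun x => a * f x).
Proof.
move=> a0 [mf f0 foo]; split => //.
- exact: measurable_funM.
- by move=> x; rewrite mulr_ge0.
rewrite meanZ// lte_mul_pinfty//.
Qed.

Lemma mean_scale (a : R) f : 0 <= a -> summable1 f -> mean (fun x => a * f x) = a * mean f.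
Proof.
move=> a0 sf; apply: EFin_inj.
rewrite EFinM -!summable1_mean//; last exact: summable1Z.
by have [mf f0 _] := sf; rewrite meanZ.
Qed.

Lemma summable1_sum (I : Type) (r : seq I) (f : I -> T -> R) :
  (forall i, summable1 (f i)) -> summable1 (fun x => \sum_(i <- r) f i x).
Proof.
move=> sf; elim: r => [|i r ih].
  by under eq_fun do rewrite big_nil; exact: summable1_cst.
by under eq_fun do rewrite big_cons; exact: summable1D.
Qed.

Lemma mean_sum (I : Type) (r : seq I) (f : I -> T -> R) :
  (forall i, summable1 (f i)) ->
  mean (fun x => \sum_(i <- r) f i x) = \sum_(i <- r) mean (f i).
Proof.
move=> sf; elim: r => [|i r ih].
  by under eq_fun do rewrite big_nil; rewrite big_nil mean_cst.
under eq_fun do rewrite big_cons.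
rewrite big_cons meanD//; last exact: summable1_sum.
by rewrite ih.
Qed.

Lemma limn_einf_le (u : nat -> \bar R) (C : \bar R) :
  (forall n, u n <= C)%E -> (limn_einf u <= C)%E.
Proof.
move=> uC; rewrite limn_einf_lim; apply: lime_le; first exact: is_cvg_einfs.
apply: nearW => n; apply: le_trans (uC n).
by apply: ereal_inf_lbound; exists n => /=.
Qed.

Lemma mean_fatou (f_ : nat -> T -> R) f (C : R) :
  (forall n, summable1 (f_ n)) -> (forall n, mean (f_ n) <= C) ->
  (forall x, f_ ^~ x @ \oo --> f x) ->
  summable1 f /\ mean f <= C.
Proof.
move=> sf mC cf.
have mf : measurable_fun setT f.
  apply: (@measurable_fun_cvg _ _ _ _ f_) => [n|x _]; last exact: cf.
  by have [] := sf n.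
have f0 x : 0 <= f x.
  rewrite -(cvg_lim _ (cf x))//; apply: limr_ge; first exact: cvgP (cf x).
  by apply: nearW => n; have [] := sf n.
have h : (\int[P]_x (f x)%:E <= C%:E)%E.
  have -> : (\int[P]_x (f x)%:E = \int[P]_x limn_einf (fun n => (f_ n x)%:E))%E.
    apply: eq_integral => x _.
    have cx : (fun n => (f_ n x)%:E) @ \oo --> (f x)%:E.
      by apply: cvg_EFin; [exact: nearW|exact: cf].
    rewrite is_cvg_limn_einfE; last exact: cvgP cx.
    by apply/esym/cvg_lim.
  apply: le_trans (fatou P measurableT _ _) _.
  - by move=> n; apply/measurable_EFinP; have [] := sf n.
  - by move=> n x _; rewrite lee_fin; have [] := sf n.
  by apply: limn_einf_le => n; rewrite summable1_mean// lee_fin.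
have sf' : summable1 f by split => //; apply: le_lt_trans h _; rewrite ltry.
by split => //; rewrite -lee_fin -summable1_mean.
Qed.

End nonnegative_means.

(** * The two-point estimator *)

Lemma measurable_grad {R : realType} {d : nat} {dXi : measure_display}
    {Xi : measurableType dXi} (F : 'rV[R]_d -> Xi -> R) (x : 'rV[R]_d) :
  (forall y, measurable_fun setT (F y)) ->
  (forall z, differentiable (F ^~ z) x) ->
  measurable_fun setT (fun z => grad (F ^~ z) x : rvec R d).
Proof.
move=> mF dF; apply: measurable_rvec => i.
pose h (N : nat) : R := N.+1%:R^-1.
apply: (@measurable_fun_cvg _ _ _ _ (fun N z =>
  (h N)^-1 *: (F (h N *: delta_mx ord0 i + x) z - F x z))).
  by move=> N; apply: measurable_funM => //; exact: measurable_funB.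
move=> z _; rewrite mxE.
have := diff_derivable (v := delta_mx ord0 i) (dF z).
rewrite /derivable => /cvg_ex[l cl].
have -> : 'D_(delta_mx ord0 i) (F ^~ z) x = l by rewrite /derive; apply/cvg_lim.
apply/cvgrPdist_le => r r0.
move/cvgrPdist_le : cl => /(_ r r0) /nbhs_ballP[s /= s0 sP].
have := near_infty_natSinv_lt (PosNum s0); apply: filterS => N /= hN.
have h0 : 0 < h N by rewrite invr_gt0.
apply: sP; last by rewrite gt_eqF.
by rewrite /ball /= sub0r normrN gtr0_norm.
Qed.

Section oracle.
Context {R : realType} {d : nat} {dXi : measure_display} {Xi : measurableType dXi}.
Variables (PXi : probability Xi R) (F : 'rV[R]_d -> Xi -> R) (f : 'rV[R]_d -> R).
Variables (X O : set 'rV[R]_d) (L S2 nu : R).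
Implicit Types (x y a c : 'rV[R]_d) (e : {ffun 'I_d -> bool}).

Definition grad_F x (z : Xi) : rvec R d := grad (F ^~ z) x.

Record regular_oracle : Prop := RegularOracle {
  ro_L : 0 <= L; ro_nu : 0 < nu;
  ro_meas : forall x, measurable_fun setT (F x);
  ro_diff : forall z x, differentiable (F ^~ z) x;
  ro_cont : forall z, continuous (grad (F ^~ z));
  ro_int : forall x, PXi.-integrable setT (EFin \o F x);
  ro_mean : forall x, (\int[PXi]_z (F x z)%:E = (f x)%:E)%E;
  ro_moment : forall x, O x ->
    (\int[PXi]_z ((norm2 (grad_F x z)) ^+ 2)%:E <= S2%:E)%E;
  ro_lip : forall x y, O x -> O y ->
    (\int[PXi]_z ((norm2 ((grad_F x z : 'rV[R]_d) - grad_F y z)) ^+ 2)%:E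
      <= (L ^+ 2 * norm2 (x - y) ^+ 2)%:E)%E;
  ro_segment : forall x e (t : R), X x -> 0 <= t <= 1 ->
    O (x + t *: (nu *: sign_vec e))
}.

Hypothesis ro : regular_oracle.

Lemma ro_sub x : X x -> O x.
Proof.
move=> Xx; have := ro_segment ro [ffun=> true] Xx (t := 0).
by rewrite lexx ler01 scale0r addr0; apply.
Qed.

Lemma measurable_grad_F x : measurable_fun setT (grad_F x).
Proof. by apply: measurable_grad; [exact: (ro_meas ro)|move=> z; exact: (ro_diff ro)]. Qed.

Lemma summable_grad_sqr x : O x ->
  summable1 PXi (fun z => norm2 (grad_F x z) ^+ 2) /\
  mean PXi (fun z => norm2 (grad_F x z) ^+ 2) <= S2.
Proof.
move=> Ox; have := ro_moment ro Ox => h.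
have s : summable1 PXi (fun z => norm2 (grad_F x z) ^+ 2).
  split; [|by move=> z; exact: sqr_ge0|by apply: le_lt_trans h _; rewrite ltry].
  by apply: measurable_funX; apply: measurable_norm2; exact: measurable_grad_F.
by split => //; rewrite -lee_fin -summable1_mean.
Qed.

Lemma summable_grad_diff x y : O x -> O y ->
  summable1 PXi (fun z => norm2 ((grad_F x z : 'rV[R]_d) - grad_F y z) ^+ 2) /\
  mean PXi (fun z => norm2 ((grad_F x z : 'rV[R]_d) - grad_F y z) ^+ 2)
    <= L ^+ 2 * norm2 (x - y) ^+ 2.
Proof.
move=> Ox Oy; have := ro_lip ro Ox Oy => h.
have s : summable1 PXi (fun z => norm2 ((grad_F x z : 'rV[R]_d) - grad_F y z) ^+ 2).
  split; [|by move=> z; exact: sqr_ge0|by apply: le_lt_trans h _; rewrite ltry].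
  by apply: measurable_funX; apply: measurable_norm2; apply: measurable_vecB;
    exact: measurable_grad_F.
by split => //; rewrite -lee_fin -summable1_mean.
Qed.

Definition quotient x e z : R := (F (x + nu *: sign_vec e) z - F x z) / nu.

Definition remainder x e z : R :=
  quotient x e z - dotv (grad_F x z : 'rV[R]_d) (sign_vec e).

Lemma measurable_quotient x e : measurable_fun setT (quotient x e).
Proof.
apply: measurable_funM => //; apply: measurable_funB; exact: (ro_meas ro).
Qed.

Let sqr_mean (n : nat) (u : 'I_n.+1 -> R) :
  (n.+1%:R^-1 * \sum_i u i) ^+ 2 <= n.+1%:R^-1 * \sum_i u i ^+ 2.
Proof.
have n0 : 0 < n.+1%:R :> R by rewrite ltr0n.
set A := n.+1%:R^-1 * \sum_i u i.
have := sumr_ge0 _ (fun i (_ : xpredT i) => sqr_ge0 (u i - A)) : 0 <= \sum_i (u i - A) ^+ 2.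
have -> : \sum_i (u i - A) ^+ 2 = \sum_i u i ^+ 2 - n.+1%:R * A ^+ 2.
  have e i : (u i - A) ^+ 2 = u i ^+ 2 - 2 * A * u i + A ^+ 2 by ring.
  rewrite (eq_bigr _ (fun i _ => e i)) big_split sumrB /= -mulr_sumr sumr_const card_ord.
  have -> : \sum_i u i = n.+1%:R * A by rewrite /A mulrA divff ?mul1r// gt_eqF.
  rewrite -[A ^+ 2 *+ _]mulr_natl; ring.
by rewrite subr_ge0 => h; rewrite ler_pdivlMl.
Qed.

(* Riemann sums of the derivative along the segment and Fatou: no joint
   measurability in the direction of integration is needed. *)
Lemma summable_remainder x e : X x ->
  summable1 PXi (fun z => remainder x e z ^+ 2) /\
  mean PXi (fun z => remainder x e z ^+ 2) <= L ^+ 2 * nu ^+ 2 * d%:R ^+ 2.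
Proof.
move=> Xx.
have nu0 := ro_nu ro.
pose s := sign_vec e : 'rV[R]_d; pose v := nu *: s.
pose pt (N i : nat) := x + (i%:R / N.+1%:R : R) *: v.
have Opt N (i : 'I_N.+1) : O (pt N i).
  apply: (ro_segment ro e Xx); rewrite divr_ge0//=.
  by rewrite ler_pdivrMr ?ltr0n// mul1r ler_nat ltnW.
pose D N i z := norm2 ((grad_F (pt N i) z : 'rV[R]_d) - grad_F x z) ^+ 2.
pose T_ N z := N.+1%:R^-1 * \sum_(i < N.+1)
  dotv ((grad_F (pt N i) z : 'rV[R]_d) - grad_F x z) s.
have ns : norm2 s ^+ 2 = d%:R by rewrite norm2_sqr dotv_sign_vec.
have TD N z : T_ N z ^+ 2 <= N.+1%:R^-1 * \sum_(i < N.+1) (d%:R * D N i z).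
  apply: le_trans (sqr_mean _) _; rewrite ler_wpM2l ?invr_ge0//.
  apply: ler_sum => i _; rewrite -real_normK ?num_real// -ns mulrC -exprMn.
  by rewrite ler_pXn2r ?nnegrE ?mulr_ge0 ?norm2_ge0// norm_dotv.
have nv : norm2 v ^+ 2 = nu ^+ 2 * d%:R.
  by rewrite norm2Z exprMn ns real_normK ?num_real.
have sD N (i : 'I_N.+1) : summable1 PXi (D N i) /\ mean PXi (D N i) <= L ^+ 2 * (nu ^+ 2 * d%:R).
  have [s1 s2] := summable_grad_diff (Opt N i) (ro_sub Xx); split => //.
  apply: le_trans s2 _; apply: ler_wpM2l; first exact: sqr_ge0.
  rewrite /pt addrAC subrr add0r norm2Z exprMn nv ler_piMl//.
    by rewrite mulr_ge0// sqr_ge0.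
  have t1 : i%:R / N.+1%:R <= 1 :> R by rewrite ler_pdivrMr ?ltr0n// mul1r ler_nat ltnW.
  have t0 : 0 <= i%:R / N.+1%:R :> R by rewrite divr_ge0.
  by rewrite ger0_norm// exprn_ile1.
have sT N : summable1 PXi (fun z => T_ N z ^+ 2) /\
    mean PXi (fun z => T_ N z ^+ 2) <= L ^+ 2 * nu ^+ 2 * d%:R ^+ 2.
  have sS : summable1 PXi (fun z => N.+1%:R^-1 * \sum_(i < N.+1) (d%:R * D N i z)).
    apply: summable1Z; first by rewrite invr_ge0.
    by apply: summable1_sum => i; apply: summable1Z => //; case: (sD N i).
  have sT' : summable1 PXi (fun z => T_ N z ^+ 2).
    apply: summable1_le sS; last by move=> z; rewrite sqr_ge0 TD.
    apply: measurable_funX; apply: measurable_funM => //.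
    apply: measurable_sum => i; apply: measurable_dotv => //.
    by apply: measurable_vecB; exact: measurable_grad_F.
  split => //; apply: le_trans (mean_le sT' sS (TD N)) _.
  rewrite mean_scale ?invr_ge0//; last first.
    by apply: summable1_sum => i; apply: summable1Z => //; case: (sD N i).
  rewrite mean_sum; last by move=> i; apply: summable1Z => //; case: (sD N i).
  rewrite ler_pdivrMl ?ltr0n//.
  have -> : N.+1%:R * (L ^+ 2 * nu ^+ 2 * d%:R ^+ 2) =
     \sum_(i < N.+1) (d%:R * (L ^+ 2 * (nu ^+ 2 * d%:R))).
    by rewrite sumr_const card_ord -[RHS]mulr_natl; congr (_ * _); ring.
  apply: ler_sum => i _; have [s1 s2] := sD N i.
  by rewrite mean_scale//; apply: ler_wpM2l.
apply: (@mean_fatou _ _ _ _ (fun N z => T_ N z ^+ 2)).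
- by move=> N; case: (sT N).
- by move=> N; case: (sT N).
move=> z; apply: (@cvg_comp _ _ _ (T_ ^~ z) (fun t : R => t ^+ 2) _ (nbhs (remainder x e z)));
  last exact: exprn_continuous.
have := @riemann_sum_line R d (F ^~ z) x v (ro_diff ro z) (@ro_cont ro z).
move=> c1.
have -> : T_ ^~ z = (fun N => nu^-1 * (N.+1%:R^-1 * \sum_(i < N.+1)
     dotv (grad (F ^~ z) (x + (i%:R / N.+1%:R) *: v)) v) - dotv (grad_F x z : 'rV[R]_d) s).
  apply/funext => N; rewrite /T_.
  under eq_bigr do rewrite dotvBl.
  rewrite sumrB mulrBr; congr (_ - _).
    rewrite mulrCA; congr (_ * _); rewrite mulr_sumr; apply: eq_bigr => i _.
    by rewrite /v (dotvZr nu) mulrA mulVf ?mul1r// gt_eqF.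
  by rewrite sumr_const card_ord -[X in _ * X]mulr_natl mulrA mulVf ?mul1r// pnatr_eq0.
rewrite /remainder /quotient mulrC.
apply: cvgB; last exact: cvg_cst.
by apply: cvgMl_tmp; exact: c1.
Qed.

End oracle.

Lemma norm2_sqrDZ {R : realType} {n} (x y : 'rV[R]_n) (t : R) :
  norm2 (x + t *: y) ^+ 2 = norm2 x ^+ 2 + 2 * t * dotv x y + t ^+ 2 * norm2 y ^+ 2.
Proof.
rewrite !norm2_sqr dotvDl (dotvDr x) (dotvDr (t *: y)) !dotvZl !dotvZr (dotvC y x).
ring.
Qed.

Lemma sqr_residual_le {R : realFieldType} (qx qy gx gy tau : R) :
  (qx - tau * qy) ^+ 2 <=
  6 * tau ^+ 2 * ((gx - gy) ^+ 2 + ((qx - gx) ^+ 2 + (qy - gy) ^+ 2)) +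
  4 * (1 - tau) ^+ 2 * (gx ^+ 2 + (qx - gx) ^+ 2).
Proof.
have h1 : (qx - tau * qy) ^+ 2 <=
    2 * (tau ^+ 2 * (qx - qy) ^+ 2) + 2 * ((1 - tau) ^+ 2 * qx ^+ 2).
  have := sqr_ge0 (tau * (qx - qy) - (1 - tau) * qx); lra.
have h2 : (qx - qy) ^+ 2 <= 3 * ((gx - gy) ^+ 2 + ((qx - gx) ^+ 2 + (qy - gy) ^+ 2)).
  have := sqr_ge0 ((gx - gy) - (qx - gx)); have := sqr_ge0 ((gx - gy) + (qy - gy)).
  have := sqr_ge0 ((qx - gx) + (qy - gy)); lra.
have h3 : qx ^+ 2 <= 2 * (gx ^+ 2 + (qx - gx) ^+ 2).
  have := sqr_ge0 (gx - (qx - gx)); lra.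
have := ler_wpM2l (sqr_ge0 tau) h2; have := ler_wpM2l (sqr_ge0 (1 - tau)) h3.
move: h1; lra.
Qed.

Section one_sample.
Context {R : realType} {d : nat} {dXi : measure_display} {Xi : measurableType dXi}.
Variables (PXi : probability Xi R) (F : 'rV[R]_d -> Xi -> R) (f : 'rV[R]_d -> R).
Variables (X O : set 'rV[R]_d) (L S2 nu : R).
Implicit Types (x y a c : 'rV[R]_d) (e : {ffun 'I_d -> bool}).

Lemma sign_mean_mean (phi : {ffun 'I_d -> bool} -> Xi -> R) :
  (forall e, summable1 PXi (phi e)) ->
  summable1 PXi (fun z => sign_mean (phi ^~ z)) /\
  sign_mean (fun e => mean PXi (phi e)) = mean PXi (fun z => sign_mean (phi ^~ z)).
Proof.
move=> sphi; have c0 : 0 <= (2 ^+ d)^-1 :> R by rewrite invr_ge0 exprn_ge0.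
split; first by apply: summable1Z => //; exact: summable1_sum.
by rewrite /sign_mean mean_scale ?mean_sum//; exact: summable1_sum.
Qed.

Lemma sign_mean_mean_dotv (V : Xi -> rvec R d) :
  measurable_fun setT V -> summable1 PXi (fun z => norm2 (V z : 'rV[R]_d) ^+ 2) ->
  (forall e, summable1 PXi (fun z => dotv (V z : 'rV[R]_d) (sign_vec e) ^+ 2)) /\
  sign_mean (fun e => mean PXi (fun z => dotv (V z : 'rV[R]_d) (sign_vec e) ^+ 2)) =
  mean PXi (fun z => norm2 (V z : 'rV[R]_d) ^+ 2).
Proof.
move=> mV sV.
have s e : summable1 PXi (fun z => dotv (V z : 'rV[R]_d) (sign_vec e) ^+ 2).
  have d0 : 0 <= d%:R :> R by [].
  apply: summable1_le (summable1Z d0 sV).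
    by apply: measurable_funX; apply: measurable_dotv.
  move=> z; rewrite sqr_ge0 /= -(dotv_sign_vec e) -norm2_sqr mulrC -exprMn.
  by rewrite -real_normK ?num_real// ler_pXn2r ?nnegrE ?mulr_ge0 ?norm2_ge0// norm_dotv.
split => //; rewrite (sign_mean_mean s).2; congr (mean PXi _); apply/funext => z.
by rewrite norm2_sqr -sign_mean_dotv; apply: eq_sign_mean => e; rewrite expr2.
Qed.

Lemma mean_affine (C l0 : R) (l V h : Xi -> R) :
  PXi.-integrable setT (EFin \o l) -> (\int[PXi]_z (l z)%:E = l0%:E)%E ->
  summable1 PXi V -> summable1 PXi h -> (forall z, h z = C + l z + V z) ->
  mean PXi h = C + l0 + mean PXi V.
Proof.
move=> il el sV sh hE; apply: EFin_inj; rewrite -summable1_mean//.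
have iV : PXi.-integrable setT (EFin \o V).
  have [mV V0 Voo] := sV.
  apply/integrableP; split; first exact/measurable_EFinP.
  by under eq_integral do rewrite gee0_abs ?lee_fin//.
have iC : PXi.-integrable setT (EFin \o (fun=> C)).
  exact: finite_measure_integrable_cst.
have -> : (\int[PXi]_z (h z)%:E = \int[PXi]_z ((C%:E + (l z)%:E) + (V z)%:E))%E.
  by apply: eq_integral => z _; rewrite hE !EFinD.
rewrite integralD//; last exact: integrableD.
by rewrite integralD// !EFinD el (summable1_mean sV) integral_cst_probability.
Qed.

Hypothesis ro : regular_oracle PXi F f X O L S2 nu.

Definition mean_quotient x e : R := (f (x + nu *: sign_vec e) - f x) / nu.

Definition gbar x : 'rV[R]_d :=
  \row_i sign_mean (fun e => mean_quotient x e * sign_vec e ord0 i).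

Lemma dotv_gbar c x :
  dotv c (gbar x) = sign_mean (fun e => mean_quotient x e * dotv c (sign_vec e)).
Proof.
rewrite (eq_sign_mean (G := fun e => \sum_i (c ord0 i * (mean_quotient x e * sign_vec e ord0 i)))).
  rewrite sign_mean_sum; apply: eq_bigr => i _; rewrite mxE sign_meanZ.
  by [].
by move=> e; rewrite mulr_sumr; apply: eq_bigr => i _; rewrite mulrCA.
Qed.

Definition has_mean (g : Xi -> R) (r : R) :=
  PXi.-integrable setT (EFin \o g) /\ (\int[PXi]_z (g z)%:E = r%:E)%E.

Lemma has_meanD g1 g2 r1 r2 : has_mean g1 r1 -> has_mean g2 r2 ->
  has_mean (fun z => g1 z + g2 z) (r1 + r2).
Proof.
move=> [i1 e1] [i2 e2]; split.
  rewrite (_ : EFin \o _ = ((EFin \o g1) \+ (EFin \o g2))%E); first exact: integrableD.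
  by apply/funext => z /=; rewrite EFinD.
by under eq_integral do rewrite EFinD; rewrite integralD// e1 e2.
Qed.

Lemma has_meanZ g r (t : R) : has_mean g r -> has_mean (fun z => t * g z) (t * r).
Proof.
move=> [i1 e1]; split.
  rewrite (_ : EFin \o _ = (fun z => t%:E * (EFin \o g) z)%E); first exact: integrableZl.
  by apply/funext => z /=; rewrite EFinM.
by under eq_integral do rewrite EFinM; rewrite integralZl// e1.
Qed.

Lemma has_mean_sum (I : Type) (r : seq I) (g : I -> Xi -> R) (q : I -> R) :
  (forall i, has_mean (g i) (q i)) ->
  has_mean (fun z => \sum_(i <- r) g i z) (\sum_(i <- r) q i).
Proof.
move=> h; elim: r => [|i r ih].
  under eq_fun do rewrite big_nil; rewrite big_nil; split.
    exact: finite_measure_integrable_cst.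
  exact: integral_cst_probability.
by under eq_fun do rewrite big_cons; rewrite big_cons; exact: has_meanD.
Qed.

Lemma has_mean_quotient x e : has_mean (quotient F nu x e) (mean_quotient x e).
Proof.
have H y : has_mean (F y) (f y) by split; [exact: (ro_int ro)|exact: (ro_mean ro)].
have := has_meanZ nu^-1 (has_meanD (H (x + nu *: sign_vec e)) (has_meanZ (-1) (H x))).
rewrite /quotient /mean_quotient.
have -> : (fun z => nu^-1 * (F (x + nu *: sign_vec e) z + -1 * F x z)) =
  (fun z => (F (x + nu *: sign_vec e) z - F x z) / nu).
  by apply/funext => z; rewrite mulrC mulN1r.
by rewrite mulN1r mulrC.
Qed.

Definition residual (tau : R) x y e z : R := quotient F nu x e z - tau * quotient F nu y e z.

Definition residual_bound (tau : R) x y : R :=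
  6 * tau ^+ 2 * (L ^+ 2 * norm2 (x - y) ^+ 2 + 2 * (L ^+ 2 * nu ^+ 2 * d%:R ^+ 2)) +
  4 * (1 - tau) ^+ 2 * (S2 + L ^+ 2 * nu ^+ 2 * d%:R ^+ 2).

Lemma mean_residual (tau : R) x y : X x -> X y ->
  (forall e, summable1 PXi (fun z => residual tau x y e z ^+ 2)) /\
  sign_mean (fun e => mean PXi (fun z => residual tau x y e z ^+ 2))
    <= residual_bound tau x y.
Proof.
move=> Xx Xy.
have Ox := ro_sub ro Xx; have Oy := ro_sub ro Xy.
have [sg mg] := summable_grad_sqr ro Ox.
have [sgd mgd] := summable_grad_diff ro Ox Oy.
have [s1 m1] := sign_mean_mean_dotv (measurable_grad_F ro x) sg.
have mV : measurable_fun setT (fun z => (grad_F F x z : 'rV[R]_d) - grad_F F y z : rvec R d).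
  by apply: measurable_vecB; exact: (measurable_grad_F ro).
have [s2 m2] := sign_mean_mean_dotv mV sgd.
pose a e z := dotv ((grad_F F x z : 'rV[R]_d) - grad_F F y z) (sign_vec e) ^+ 2.
pose b e z := dotv (grad_F F x z : 'rV[R]_d) (sign_vec e) ^+ 2.
pose rx e z := remainder F nu x e z ^+ 2; pose ry e z := remainder F nu y e z ^+ 2.
have srx e := (summable_remainder ro e Xx).1; have mrx e := (summable_remainder ro e Xx).2.
have sry e := (summable_remainder ro e Xy).1; have mry e := (summable_remainder ro e Xy).2.
set c1 := 6 * tau ^+ 2; set c2 := 4 * (1 - tau) ^+ 2.
have c10 : 0 <= c1 by rewrite mulr_ge0 ?sqr_ge0.
have c20 : 0 <= c2 by rewrite mulr_ge0 ?sqr_ge0.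
pose H e z := c1 * (a e z + (rx e z + ry e z)) + c2 * (b e z + rx e z).
have rH e z : residual tau x y e z ^+ 2 <= H e z.
  rewrite /residual /H /a /b /rx /ry /remainder dotvBl.
  set qx := quotient F nu x e z; set qy := quotient F nu y e z.
  set gx := dotv (grad_F F x z : 'rV[R]_d) _; set gy := dotv (grad_F F y z : 'rV[R]_d) _.
  exact: sqr_residual_le.
have sH1 e : summable1 PXi (fun z => a e z + (rx e z + ry e z)).
  by apply: summable1D; [exact: s2|apply: summable1D; [exact: srx|exact: sry]].
have sH2 e : summable1 PXi (fun z => b e z + rx e z).
  by apply: summable1D; [exact: s1|exact: srx].
have sH e : summable1 PXi (H e) by apply: summable1D; exact: summable1Z.
have sr e : summable1 PXi (fun z => residual tau x y e z ^+ 2).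
  apply: summable1_le (sH e); last by move=> z; rewrite sqr_ge0 rH.
  apply: measurable_funX; apply: measurable_funB; first exact: (measurable_quotient ro).
  by apply: measurable_funM => //; exact: (measurable_quotient ro).
split => //.
apply: (@le_trans _ _ (sign_mean (fun e => mean PXi (H e)))).
  by apply: sign_mean_le => e; apply: mean_le.
have -> : sign_mean (fun e => mean PXi (H e)) =
   c1 * (sign_mean (fun e => mean PXi (a e)) + (sign_mean (fun e => mean PXi (rx e)) + sign_mean (fun e => mean PXi (ry e))))
   + c2 * (sign_mean (fun e => mean PXi (b e)) + sign_mean (fun e => mean PXi (rx e))).
  rewrite -!sign_meanD -!sign_meanZ -!sign_meanD; apply: eq_sign_mean => e.
  rewrite /H meanD; [|exact: summable1Z|exact: summable1Z].
  rewrite !mean_scale//; congr (_ * _ + _ * _).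
    rewrite meanD; [|exact: s2|by apply: summable1D; [exact: srx|exact: sry]].
    by rewrite meanD; [|exact: srx|exact: sry].
  by rewrite meanD; [|exact: s1|exact: srx].
rewrite /residual_bound m1 m2 -/c1 -/c2.
have mr (q : {ffun 'I_d -> bool} -> Xi -> R) (C : R) : (forall e, mean PXi (q e) <= C) ->
    sign_mean (fun e => mean PXi (q e)) <= C.
  by move=> h; rewrite -[leRHS](@sign_mean_cst R d); exact: sign_mean_le.
have k1 := mr _ _ mrx; have k2 := mr _ _ mry.
apply: lerD.
  apply: (ler_wpM2l c10); apply: (lerD mgd).
  by rewrite [leRHS]mulr_natl mulr2n; exact: (lerD k1 k2).
exact: (ler_wpM2l c20 (lerD mg k1)).
Qed.

Lemma one_sample_bound (tau b : R) a x y : X x -> X y ->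
  let phi e z := norm2 (a + b *: (residual tau x y e z *: sign_vec e -
                                   (gbar x - tau *: gbar y))) ^+ 2 in
  (forall e, summable1 PXi (phi e)) /\
  sign_mean (fun e => mean PXi (phi e)) <=
    norm2 a ^+ 2 + b ^+ 2 * (d%:R * residual_bound tau x y).
Proof.
move=> Xx Xy phi.
set U := gbar x - tau *: gbar y; set c := a - b *: U.
have [sr mr] := mean_residual tau Xx Xy.
pose w e z := residual tau x y e z.
have phiE e z : phi e z = norm2 c ^+ 2 + 2 * b * (w e z * dotv c (sign_vec e)) +
     b ^+ 2 * d%:R * w e z ^+ 2.
  rewrite /phi -/U -/(w e z).
  have -> : a + b *: (w e z *: sign_vec e - U) = c + (b * w e z) *: sign_vec e.
    by apply/rowP => i; rewrite !mxE; ring.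
  by rewrite norm2_sqrDZ [norm2 (sign_vec e) ^+ 2]norm2_sqr dotv_sign_vec; ring.
have b0 : 0 <= b ^+ 2 * d%:R by rewrite mulr_ge0 ?sqr_ge0.
have sw e : summable1 PXi (fun z => b ^+ 2 * d%:R * w e z ^+ 2) by exact: summable1Z.
have sphi e : summable1 PXi (phi e).
  have n0 : 0 <= 2 * norm2 c ^+ 2 by rewrite mulr_ge0 ?sqr_ge0.
  apply: (@summable1_le _ _ _ _ _ (fun z => 2 * norm2 c ^+ 2 + 2 * (b ^+ 2 * d%:R * w e z ^+ 2))).
  - have -> : phi e = (fun z => norm2 c ^+ 2 + 2 * b * (w e z * dotv c (sign_vec e)) +
        b ^+ 2 * d%:R * w e z ^+ 2) by apply/funext => z; exact: phiE.
    have mw : measurable_fun setT (w e).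
      apply: measurable_funB; first exact: (measurable_quotient ro).
      by apply: measurable_funM => //; exact: (measurable_quotient ro).
    apply: measurable_funD; last by case: (sw e).
    apply: measurable_funD => //; apply: measurable_funM => //.
    exact: measurable_funM.
  - move=> z; rewrite sqr_ge0 /= phiE.
    have := sqr_norm2D c ((b * w e z) *: sign_vec e).
    have nse : norm2 (sign_vec e : 'rV[R]_d) ^+ 2 = d%:R by rewrite norm2_sqr dotv_sign_vec.
    have -> : norm2 ((b * w e z) *: sign_vec e : 'rV[R]_d) ^+ 2 = (b * w e z) ^+ 2 * d%:R.
      by rewrite norm2Z exprMn nse real_normK ?num_real.
    rewrite norm2_sqrDZ nse.
    by move: (dotv c _) (w e z) (norm2 c ^+ 2) => p q r; lra.
  - by apply: summable1D; [exact: summable1_cst|exact: summable1Z].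
split => //.
have [sS eS] := sign_mean_mean sphi; rewrite eS.
have [sW eW] := sign_mean_mean sw.
have hm : has_mean (fun z => sign_mean (fun e => 2 * b * (w e z * dotv c (sign_vec e))))
    (2 * b * dotv c U).
  have -> : 2 * b * dotv c U = sign_mean (fun e => 2 * b * dotv c (sign_vec e) *
      (mean_quotient x e + - tau * mean_quotient y e)).
    rewrite /U dotvBr dotvZr !dotv_gbar -(sign_meanZ tau) -mulN1r -(sign_meanZ (-1)).
    by rewrite -sign_meanD -(sign_meanZ (2 * b)); apply: eq_sign_mean => e; ring.
  have -> : (fun z => sign_mean (fun e => 2 * b * (w e z * dotv c (sign_vec e)))) =
     (fun z => sign_mean (fun e => 2 * b * dotv c (sign_vec e) *
        (quotient F nu x e z + - tau * quotient F nu y e z))).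
    by apply/funext => z; apply: eq_sign_mean => e; rewrite /w /residual; ring.
  apply: has_meanZ; apply: has_mean_sum => e; apply: has_meanZ; apply: has_meanD.
    exact: has_mean_quotient.
  by apply: has_meanZ; exact: has_mean_quotient.
rewrite (mean_affine (C := norm2 c ^+ 2) hm.1 hm.2 sW sS); last first.
  move=> z; rewrite -[X in X + _ + _](@sign_mean_cst R d) -!sign_meanD.
  by apply: eq_sign_mean => e; rewrite phiE.
rewrite -eW.
have -> : sign_mean (fun e => mean PXi (fun z => b ^+ 2 * d%:R * w e z ^+ 2)) =
   b ^+ 2 * d%:R * sign_mean (fun e => mean PXi (fun z => w e z ^+ 2)).
  by rewrite -sign_meanZ; apply: eq_sign_mean => e; rewrite mean_scale.
have -> : norm2 c ^+ 2 + 2 * b * dotv c U = norm2 a ^+ 2 - b ^+ 2 * norm2 U ^+ 2.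
  have -> : c = a + (- b) *: U by rewrite scaleNr.
  by rewrite norm2_sqrDZ (dotvDl a) dotvZl -(norm2_sqr U); ring.
have := ler_wpM2l b0 mr; rewrite -/w.
have : 0 <= b ^+ 2 * norm2 U ^+ 2 by rewrite mulr_ge0 ?sqr_ge0.
move: (sign_mean _) (residual_bound _ _ _) => q1 q2; lra.
Qed.

Lemma gbar_bias x : (forall y, differentiable f y) -> X x ->
  (forall y z, O y -> O z -> norm2 (grad f y - grad f z) <= L * norm2 (y - z)) ->
  norm2 (gbar x - grad f x) ^+ 2 <= L ^+ 2 * nu ^+ 2 * d%:R ^+ 3.
Proof.
move=> df Xx fL.
have nu0 := ro_nu ro; have L0 := ro_L ro.
pose q e := mean_quotient x e - dotv (grad f x) (sign_vec e).
have nsq e : norm2 (sign_vec e : 'rV[R]_d) ^+ 2 = d%:R.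
  by rewrite norm2_sqr dotv_sign_vec.
have qb e : `|q e| <= L * nu * d%:R.
  have := @taylor_bound R d f x (nu *: sign_vec e) L df.
  have h : forall t : R, 0 <= t <= 1 ->
      norm2 (grad f (x + t *: (nu *: sign_vec e)) - grad f x) <= L * (t * norm2 (nu *: sign_vec e : 'rV[R]_d)).
    move=> t t01; have := fL _ _ (ro_segment ro e Xx t01) (ro_sub ro Xx).
    by rewrite addrAC subrr add0r norm2Z ger0_norm//; case/andP: t01.
  move=> /(_ h); rewrite dotvZr norm2Z exprMn nsq (gtr0_norm nu0) => h1.
  have -> : q e = nu^-1 * (f (x + nu *: sign_vec e) - f x - nu * dotv (grad f x) (sign_vec e)).
    by rewrite /q /mean_quotient; field; rewrite gt_eqF.
  have inu : 0 < nu^-1 by rewrite invr_gt0.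
  rewrite normrM (gtr0_norm inu) ler_pdivrMl//.
  apply: le_trans h1 _.
  have : 0 <= L * (nu ^+ 2 * d%:R).
    by apply: mulr_ge0 => //; apply: mulr_ge0 => //; exact: sqr_ge0.
  lra.
have gE c : dotv c (gbar x - grad f x) = sign_mean (fun e => q e * dotv c (sign_vec e)).
  rewrite dotvBr dotv_gbar -(sign_mean_dotv c) -mulN1r -sign_meanZ -sign_meanD.
  by apply: eq_sign_mean => e; rewrite /q; ring.
set g := gbar x - grad f x.
have [->|g0] := eqVneq (norm2 g) 0.
  rewrite expr0n /=; apply: mulr_ge0; last exact: exprn_ge0.
  by apply: mulr_ge0; exact: sqr_ge0.
have gp : 0 < norm2 g by rewrite lt_def g0 norm2_ge0.
have ns e : norm2 (sign_vec e : 'rV[R]_d) = Num.sqrt d%:R by rewrite /norm2 dotv_sign_vec.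
have h : norm2 g <= L * nu * d%:R * Num.sqrt d%:R.
  rewrite -(ler_pM2r gp) -expr2 norm2_sqr [dotv g g]gE.
  rewrite -[leRHS](@sign_mean_cst R d); apply: sign_mean_le => e.
  apply: le_trans (ler_norm _) _; rewrite normrM -[leRHS]mulrA.
  apply: (ler_pM (normr_ge0 _) (normr_ge0 _) (qb e)).
  by apply: le_trans (norm_dotv _ _) _; rewrite ns mulrC.
have := ler_pM (ltW gp) (ltW gp) h h; rewrite -!expr2 => h2; apply: le_trans h2 _.
rewrite !exprMn sqr_sqrtr// le_eqVlt; apply/orP; left; apply/eqP; ring.
Qed.

End one_sample.

Section sample_step.
Context {R : realType} {d : nat} {dXi dOm : measure_display}
  {Xi : measurableType dXi} {Om : measurableType dOm}.
Variables (PXi : probability Xi R) (F : 'rV[R]_d -> Xi -> R) (f : 'rV[R]_d -> R).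
Variables (X O : set 'rV[R]_d) (L S2 nu : R).
Hypothesis ro : regular_oracle PXi F f X O L S2 nu.
Hypothesis fcont : continuous f.
Variables (P : probability Om R) (Pu : probability (rvec R d) R).
Hypothesis rad : rademacher Pu.

Definition estimator (x v : 'rV[R]_d) (z : Xi) : 'rV[R]_d :=
  ((F (x + nu *: v) z - F x z) / nu) *: v.

Lemma gbar_coord_continuous i : continuous (fun x => gbar f nu x ord0 i).
Proof.
have cD (g1 g2 : 'rV[R]_d -> R) : continuous g1 -> continuous g2 ->
    continuous (fun x => g1 x + g2 x).
  by move=> h1 h2 x; exact: (@continuousD _ R^o _ g1 g2 x (h1 x) (h2 x)).
have cM (g : 'rV[R]_d -> R) (a : R) : continuous g -> continuous (fun x => g x * a).
  move=> h x; apply: (@continuous_comp _ _ _ g (fun t : R => t * a)); first exact: h.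
  exact: mulrr_continuous.
have sc (e : {ffun 'I_d -> bool}) : continuous (fun x : 'rV[R]_d => mean_quotient f nu x e).
  apply: (cM _ _); rewrite (_ : (fun x => _) = (fun x => f (x + nu *: sign_vec e) + f x * -1)).
    apply: (cD _ _); last exact: (cM _ _).
    have st : continuous (fun x : 'rV[R]_d => x + nu *: sign_vec e).
      apply: (@lipschitz2_continuous _ _ _ (fun x => x + nu *: sign_vec e) 1) => y z.
      by rewrite mul1r opprD addrACA subrr addr0.
    by move=> x; exact: (@continuous_comp _ _ _ (fun y : 'rV[R]_d => y + nu *: sign_vec e)
      f x (st x) (@fcont _)).
  by apply/funext => x; rewrite mulrN1.
rewrite (_ : (fun x => _) = (fun x => (\sum_(e : {ffun 'I_d -> bool})
   mean_quotient f nu x e * (sign_vec e : 'rV[R]_d) ord0 i) * (2 ^+ d)^-1)); last first.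
  by apply/funext => x; rewrite mxE /sign_mean mulrC.
apply: (cM _ _).
have : forall r : seq {ffun 'I_d -> bool},
  continuous (fun x => \sum_(e <- r) mean_quotient f nu x e * (sign_vec e : 'rV[R]_d) ord0 i).
  elim=> [|e r ih].
    rewrite (_ : (fun x => _) = cst 0); first exact: cst_continuous.
    by apply/funext => y; rewrite big_nil.
  rewrite (_ : (fun x => _) = (fun x => mean_quotient f nu x e * (sign_vec e : 'rV[R]_d) ord0 i +
     \sum_(e <- r) mean_quotient f nu x e * (sign_vec e : 'rV[R]_d) ord0 i)).
    by apply: (cD _ _) => //; exact: (cM _ _).
  by apply/funext => y; rewrite big_cons.
exact.
Qed.

Lemma measurable_gbar {d1} {T : measurableType d1} (Y : T -> rvec R d) :
  measurable_fun setT Y -> measurable_fun setT (fun w => gbar f nu (Y w) : rvec R d).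
Proof.
move=> mY; apply: measurable_rvec => i.
exact: (@measurable_continuous _ _ _ _ (fun x => gbar f nu x ord0 i) Y
  (@gbar_coord_continuous i) mY).
Qed.

Lemma measurable_so {d1} {T : measurableType d1} (Y : T -> rvec R d) (Z : T -> Xi) :
  measurable_fun setT Y -> measurable_fun setT Z ->
  measurable_fun setT (fun w => F (Y w) (Z w)).
Proof.
move=> mY mZ; apply: (@measurable_caratheodory _ _ _ _ (fun x w => F x (Z w))) => //.
  by move=> x; apply: (measurableT_comp (ro_meas ro x)).
by move=> w x; apply: differentiable_continuous; exact: (ro_diff ro).
Qed.

Lemma measurable_estimator {d1} {T : measurableType d1} (Y V : T -> rvec R d) (Z : T -> Xi) :
  measurable_fun setT Y -> measurable_fun setT V -> measurable_fun setT Z ->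
  measurable_fun setT (fun w => estimator (Y w) (V w) (Z w) : rvec R d).
Proof.
move=> mY mV mZ; apply: measurable_vecZ => //.
apply: measurable_funM => //; apply: measurable_funB; last exact: measurable_so.
apply: (@measurable_so _ _ (fun w => (Y w : 'rV[R]_d) + nu *: (V w : 'rV[R]_d)) Z) => //.
by apply: measurable_vecD => //; apply: measurable_vecZ.
Qed.

Variables (u : {RV P >-> rvec R d}) (xi : {RV P >-> Xi}).
Hypothesis law_u : forall A, measurable A -> distribution P u A = Pu A.
Hypothesis law_xi : forall A, measurable A -> distribution P xi A = PXi A.

Lemma iterated_law {d1} {T1 : measurableType d1} {d2} {T2 : measurableType d2}
    (J : Om -> T1) (J2 : Om -> T2) (pi : T2 -> T1 * rvec R d)
    (psi : (T1 * rvec R d) * Xi -> \bar R) :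
  measurable_fun setT J -> measurable_fun setT J2 -> measurable_fun setT pi ->
  (forall w, pi (J2 w) = (J w, u w)) ->
  (forall A B, measurable A -> measurable B ->
     P (J @^-1` A `&` u @^-1` B) = P (J @^-1` A) * P (u @^-1` B))%E ->
  (forall A B, measurable A -> measurable B ->
     P (J2 @^-1` A `&` xi @^-1` B) = P (J2 @^-1` A) * P (xi @^-1` B))%E ->
  measurable_fun setT psi -> (forall t, 0 <= psi t)%E ->
  (\int[P]_w psi ((J w, u w), xi w) =
   \int[P]_w \int[Pu]_v \int[PXi]_z psi ((J w, v), z))%E.
Proof.
move=> mJ mJ2 mpi piE ind1 ind2 mpsi psi0.
have mJu : measurable_fun setT (fun w => (J w, u w)) by exact: measurable_fun_pair.
have ind2' A B : measurable A -> measurable B ->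
    P ((fun w => (J w, u w)) @^-1` A `&` xi @^-1` B) =
    (P ((fun w => (J w, u w)) @^-1` A) * P (xi @^-1` B))%E.
  move=> mA mB.
  have -> : (fun w => (J w, u w)) @^-1` A = J2 @^-1` (pi @^-1` A).
    by apply/seteqP; split => w; rewrite /preimage /= piE.
  by apply: ind2 => //; rewrite -[X in measurable X]setTI; exact: mpi.
rewrite (@freezing R _ _ _ _ _ _ P (fun w => (J w, u w)) xi psi mJu ind2' mpsi psi0).
pose theta (t : T1 * rvec R d) := (\int[PXi]_z psi (t, z))%E.
have lawxi g : (\int[distribution P xi]_z g z = \int[PXi]_z g z)%E.
  by apply: eq_measure_integral => A mA _; exact: law_xi.
have lawu g : (\int[distribution P u]_z g z = \int[Pu]_z g z)%E.
  by apply: eq_measure_integral => A mA _; exact: law_u.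
under eq_integral do rewrite lawxi.
have := @freezing R _ _ _ _ _ _ P J u theta mJ ind1 _ _.
rewrite /theta => -> //.
- by apply: eq_integral => w _; rewrite lawu.
- exact: (measurable_fun_fubini_tonelli_F psi).
- by move=> t; apply: integral_ge0.
Qed.

End sample_step.

Section sample_step_bound.
Context {R : realType} {d : nat} {dXi dOm : measure_display}
  {Xi : measurableType dXi} {Om : measurableType dOm}.
Variables (PXi : probability Xi R) (F : 'rV[R]_d -> Xi -> R) (f : 'rV[R]_d -> R).
Variables (X O : set 'rV[R]_d) (L S2 nu : R).
Hypothesis ro : regular_oracle PXi F f X O L S2 nu.
Hypothesis fcont : continuous f.
Variables (P : probability Om R) (Pu : probability (rvec R d) R).
Hypothesis rad : rademacher Pu.
Variables (u : {RV P >-> rvec R d}) (xi : {RV P >-> Xi}).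
Hypothesis law_u : forall A, measurable A -> distribution P u A = Pu A.
Hypothesis law_xi : forall A, measurable A -> distribution P xi A = PXi A.

Definition difference (tau : R) (x y v : 'rV[R]_d) (z : Xi) : 'rV[R]_d :=
  (estimator F nu x v z - tau *: estimator F nu y v z) -
  (gbar f nu x - tau *: gbar f nu y).

Lemma differenceE tau x y e z : difference tau x y (sign_vec e) z =
  residual F nu tau x y e z *: sign_vec e - (gbar f nu x - tau *: gbar f nu y).
Proof.
by rewrite /difference /estimator /residual /quotient scalerBl scalerA.
Qed.

Lemma measurable_difference {d1} {T : measurableType d1} tau (Y Y' V : T -> rvec R d)
    (Z : T -> Xi) :
  measurable_fun setT Y -> measurable_fun setT Y' -> measurable_fun setT V ->
  measurable_fun setT Z ->
  measurable_fun setT (fun w => difference tau (Y w) (Y' w) (V w) (Z w) : rvec R d).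
Proof.
move=> mY mY' mV mZ; apply: measurable_vecB; apply: measurable_vecB.
- exact: (measurable_estimator ro).
- by apply: measurable_vecZ => //; exact: (measurable_estimator ro).
- exact: measurable_gbar.
- by apply: measurable_vecZ => //; exact: measurable_gbar.
Qed.

Lemma sample_step_bound {d1} {T1 : measurableType d1} {d2} {T2 : measurableType d2}
    (J : Om -> T1) (J2 : Om -> T2) (pi : T2 -> T1 * rvec R d) (tau b : R)
    (A Y Y' : T1 -> rvec R d) :
  measurable_fun setT J -> measurable_fun setT J2 -> measurable_fun setT pi ->
  (forall w, pi (J2 w) = (J w, u w)) ->
  (forall A B, measurable A -> measurable B ->
     P (J @^-1` A `&` u @^-1` B) = P (J @^-1` A) * P (u @^-1` B))%E ->
  (forall A B, measurable A -> measurable B ->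
     P (J2 @^-1` A `&` xi @^-1` B) = P (J2 @^-1` A) * P (xi @^-1` B))%E ->
  measurable_fun setT A -> measurable_fun setT Y -> measurable_fun setT Y' ->
  (forall t, X (Y t)) -> (forall t, X (Y' t)) ->
  summable1 P (fun w => norm2 (A (J w)) ^+ 2) ->
  summable1 P (fun w => residual_bound L S2 nu tau (Y (J w)) (Y' (J w))) ->
  let phi w := norm2 ((A (J w) : 'rV[R]_d) +
     b *: difference tau (Y (J w)) (Y' (J w)) (u w) (xi w)) ^+ 2 in
  summable1 P phi /\
  mean P phi <= mean P (fun w => norm2 (A (J w)) ^+ 2) +
    b ^+ 2 * d%:R * mean P (fun w => residual_bound L S2 nu tau (Y (J w)) (Y' (J w))).
Proof.
move=> mJ mJ2 mpi piE ind1 ind2 mA mY mY' XY XY' sA sr phi.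
pose psi' (t : (T1 * rvec R d) * Xi) : R := norm2 ((A t.1.1 : 'rV[R]_d) +
     b *: difference tau (Y t.1.1) (Y' t.1.1) t.1.2 t.2) ^+ 2.
have mpsi' : measurable_fun setT psi'.
  apply: measurable_funX; apply: measurable_norm2; apply: measurable_vecD.
    by apply: (measurableT_comp mA); exact: (measurableT_comp measurable_fst measurable_fst).
  apply: measurable_vecZ => //.
  apply: (@measurable_difference _ _ tau (fun t : (T1 * rvec R d) * Xi => Y t.1.1)
    (fun t => Y' t.1.1) (fun t => t.1.2) (fun t => t.2)).
  - by apply: (measurableT_comp mY); exact: (measurableT_comp measurable_fst measurable_fst).
  - by apply: (measurableT_comp mY'); exact: (measurableT_comp measurable_fst measurable_fst).
  - exact: (measurableT_comp measurable_snd measurable_fst).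
  - exact: measurable_snd.
have mpsi : measurable_fun setT (EFin \o psi') by exact/measurable_EFinP.
have psi0 t : (0 <= (EFin \o psi') t)%E by rewrite lee_fin sqr_ge0.
have mju : measurable_fun setT (fun w => (J w, u w)) by exact: measurable_fun_pair.
have mphi : measurable_fun setT phi.
  have : measurable_fun setT (fun w => ((J w, u w), xi w)) by exact: measurable_fun_pair.
  by move=> /(measurableT_comp mpsi').
pose B w := norm2 (A (J w)) ^+ 2 +
   b ^+ 2 * d%:R * residual_bound L S2 nu tau (Y (J w)) (Y' (J w)).
have bd0 : 0 <= b ^+ 2 * d%:R by rewrite mulr_ge0 ?sqr_ge0.
have sB : summable1 P B by apply: summable1D => //; exact: summable1Z.
have intle : (\int[P]_w (phi w)%:E <= \int[P]_w (B w)%:E)%E.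
  have := @iterated_law R d _ _ _ _ PXi P Pu u xi law_u law_xi _ T1 _ T2 J J2 pi (EFin \o psi')
    mJ mJ2 mpi piE ind1 ind2 mpsi psi0.
  rewrite /psi' /= => ->.
  apply: le_integral_nomeas => w.
    by apply: integral_ge0 => v _; apply: integral_ge0 => z _; exact: (psi0 ((J w, v), z)).
  have [s1 s2] := one_sample_bound ro tau b (A (J w)) (XY (J w)) (XY' (J w)).
  rewrite (rademacher_integral rad); last 2 first.
  - apply: (@measurable_fun_fubini_tonelli_F _ _ _ _ _ PXi
      (fun t : rvec R d * Xi => (psi' ((J w, t.1), t.2))%:E)).
      apply/measurable_EFinP.
      have : measurable_fun setT (fun t : rvec R d * Xi => ((J w, t.1), t.2)).
        by apply: measurable_fun_pair => //; apply: measurable_fun_pair.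
      by move=> /(measurableT_comp mpsi').
    by move=> t; rewrite lee_fin sqr_ge0.
  - by move=> v; apply: integral_ge0 => z _; exact: (psi0 ((J w, v), z)).
  under eq_bigr => e _.
    rewrite (_ : (\int[PXi]_z _ = (mean PXi (fun z => norm2 ((A (J w) : 'rV[R]_d) + b *:
       (residual F nu tau (Y (J w)) (Y' (J w)) e z *: sign_vec e -
       (gbar f nu (Y (J w)) - tau *: gbar f nu (Y' (J w))))) ^+ 2))%:E)%E); last first.
      rewrite -(summable1_mean (s1 e)); apply: eq_integral => z _.
      by rewrite differenceE.
    rewrite -EFinM.
    over.
  rewrite sumEFin lee_fin -mulr_sumr /B -mulrA; exact: s2.
have sphi : summable1 P phi.
  split => // [w|]; first exact: sqr_ge0.
  by apply: le_lt_trans intle _; rewrite summable1_mean// ltry.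
split => //.
have <- : mean P B = mean P (fun w => norm2 (A (J w)) ^+ 2) +
    b ^+ 2 * d%:R * mean P (fun w => residual_bound L S2 nu tau (Y (J w)) (Y' (J w))).
  by rewrite meanD ?mean_scale//; exact: summable1Z.
by rewrite -lee_fin -!summable1_mean.
Qed.

End sample_step_bound.

Lemma sigma_mono {T : Type} (G G' : set (set T)) :
  G `<=` G' -> (<<s G >> : set (set T)) `<=` <<s G' >>.
Proof.
move=> GG'; apply: smallest_sub; first exact: smallest_sigma_algebra.
exact: (subset_trans GG' (@sub_sigma_algebra _ setT G')).
Qed.

Section filtration.
Context {R : realType} {d : nat} {dXi dOm : measure_display}
  {Xi : measurableType dXi} {Om : measurableType dOm}.
Variables (P : probability Om R) (Pu : probability (rvec R d) R)
  (PXi : probability Xi R).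

Definition adapted {n} (G : set (set Om)) (Y : Om -> 'rV[R]_n) :=
  measurable_fun setT (Y : g_sigma_algebraType G -> rvec R n).

Lemma adapted_sub {n} (G G' : set (set Om)) (Y : Om -> 'rV[R]_n) :
  G `<=` G' -> adapted G Y -> adapted G' Y.
Proof.
move=> GG' aY _ B mB; rewrite setTI.
have := aY measurableT B mB; rewrite setTI.
exact: sigma_mono.
Qed.

Lemma measurable_idfun_sub (G : set (set Om)) : G `<=` measurable ->
  measurable_fun setT (idfun : Om -> g_sigma_algebraType G).
Proof. by move=> Gm _ A mA; rewrite setTI; exact: sub_sigma_sub mA. Qed.

Lemma adapted_measurable {n} (G : set (set Om)) (Y : Om -> 'rV[R]_n) :
  G `<=` measurable -> adapted G Y -> measurable_fun setT (Y : Om -> rvec R n).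
Proof.
by move=> Gm aY; exact: (measurableT_comp aY (measurable_idfun_sub Gm)).
Qed.

(* [H k j] is the information available before the j-th sample of batch k, and
   [H' k j] also contains the direction of that sample. *)
Record sampling_filtration (K : nat) (batch : nat -> nat)
    (u : nat -> nat -> {RV P >-> rvec R d}) (xi : nat -> nat -> {RV P >-> Xi})
    (H H' : nat -> nat -> set (set Om)) : Prop := SamplingFiltration {
  sf_meas : forall k j, H k j `<=` measurable;
  sf_meas' : forall k j, H' k j `<=` measurable;
  sf_subu : forall k j, (k < K)%N -> (j < batch k)%N -> H k j `<=` H' k j;
  sf_subxi : forall k j, (k < K)%N -> (j < batch k)%N -> H' k j `<=` H k j.+1;
  sf_next : forall k, (k < K)%N -> H k (batch k) `<=` H k.+1 0%N;
  sf_u : forall k j, (k < K)%N -> (j < batch k)%N -> adapted (H' k j) (u k j);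
  sf_xi : forall k j, (k < K)%N -> (j < batch k)%N ->
    measurable_fun setT (xi k j : g_sigma_algebraType (H k j.+1) -> Xi);
  sf_indu : forall k j A B, (k < K)%N -> (j < batch k)%N ->
    (<<s H k j >> : set (set Om)) A -> measurable B ->
    (P (A `&` u k j @^-1` B) = P A * P (u k j @^-1` B))%E;
  sf_indxi : forall k j A B, (k < K)%N -> (j < batch k)%N ->
    (<<s H' k j >> : set (set Om)) A -> measurable B ->
    (P (A `&` xi k j @^-1` B) = P A * P (xi k j @^-1` B))%E;
  sf_lawu : forall k j, (k < K)%N -> (j < batch k)%N ->
    forall A, measurable A -> distribution P (u k j) A = Pu A;
  sf_lawxi : forall k j, (k < K)%N -> (j < batch k)%N ->
    forall A, measurable A -> distribution P (xi k j) A = PXi A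
}.

Variables (F : 'rV[R]_d -> Xi -> R) (f : 'rV[R]_d -> R).
Variables (X O : set 'rV[R]_d) (L S2 nu : R).
Hypothesis ro : regular_oracle PXi F f X O L S2 nu.
Hypothesis fcont : continuous f.
Hypothesis rad : rademacher Pu.
Variables (K : nat) (batch : nat -> nat)
  (u : nat -> nat -> {RV P >-> rvec R d}) (xi : nat -> nat -> {RV P >-> Xi})
  (H H' : nat -> nat -> set (set Om)).
Hypothesis sf : sampling_filtration K batch u xi H H'.

Lemma sf_mono k j j' : (k < K)%N -> (j <= j' <= batch k)%N -> H k j `<=` H k j'.
Proof.
move=> kK /andP[jj']; elim: j' jj' => [|j' ih].
  by rewrite leqn0 => /eqP -> _ A.
rewrite leq_eqVlt => /orP[/eqP -> _ A //|jj'] jb.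
apply: (subset_trans (ih jj' (ltnW jb))).
by apply: subset_trans (sf_subxi sf kK jb); exact: (sf_subu sf).
Qed.

Lemma sf_u_adapted k j j' : (k < K)%N -> (j < j' <= batch k)%N -> adapted (H k j') (u k j).
Proof.
move=> kK /andP[jj' jb]; have jb' := leq_trans jj' jb.
apply: adapted_sub (sf_u sf kK jb').
apply: (subset_trans (sf_subxi sf kK jb')); apply: sf_mono => //.
by rewrite jj'.
Qed.

Lemma measurable_sub_sigma {d'} {T : measurableType d'} (G G' : set (set Om)) (Z : Om -> T) :
  G `<=` G' -> measurable_fun setT (Z : g_sigma_algebraType G -> T) ->
  measurable_fun setT (Z : g_sigma_algebraType G' -> T).
Proof.
move=> GG' mZ _ B mB; rewrite setTI; have := mZ measurableT B mB; rewrite setTI.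
exact: sigma_mono.
Qed.

Lemma sf_xi_adapted k j j' : (k < K)%N -> (j < j' <= batch k)%N ->
  measurable_fun setT (xi k j : g_sigma_algebraType (H k j') -> Xi).
Proof.
move=> kK /andP[jj' jb]; have jb' := leq_trans jj' jb.
apply: measurable_sub_sigma (sf_xi sf kK jb').
by apply: sf_mono => //; rewrite jj'.
Qed.

Lemma batch_bound k (tau b : R) (A Y Y' : Om -> 'rV[R]_d) (j : nat) :
  (k < K)%N -> (j <= batch k)%N ->
  adapted (H k 0%N) A -> adapted (H k 0%N) Y -> adapted (H k 0%N) Y' ->
  (forall w, X (Y w)) -> (forall w, X (Y' w)) ->
  summable1 P (fun w => norm2 (A w) ^+ 2) ->
  summable1 P (fun w => residual_bound (d:=d) L S2 nu tau (Y w) (Y' w)) ->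
  let S w := A w + b *: \sum_(i < j) difference F f nu tau (Y w) (Y' w) (u k i w) (xi k i w) in
  [/\ adapted (H k j) S,
      summable1 P (fun w => norm2 (S w) ^+ 2) &
      mean P (fun w => norm2 (S w) ^+ 2) <= mean P (fun w => norm2 (A w) ^+ 2) +
        j%:R * (b ^+ 2 * d%:R *
                mean P (fun w => residual_bound (d:=d) L S2 nu tau (Y w) (Y' w)))].
Proof.
move=> kK + aA aY aY' XY XY' sA sr; elim: j => [|j ih] jb S.
  have -> : S = A by apply/funext => w; rewrite /S big_ord0 scaler0 addr0.
  by split => //; rewrite mul0r addr0.
have [aS sS mS] := ih (ltnW jb).
set S' := (fun w => _) in aS sS mS.
have SE : S = fun w => S' w + b *: difference F f nu tau (Y w) (Y' w) (u k j w) (xi k j w).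
  by apply/funext => w; rewrite /S /S' big_ord_recr /= scalerDr addrA.
have sub0 : H k 0%N `<=` H k j by apply: sf_mono => //; rewrite leq0n ltnW.
have sub1 : H k j `<=` H k j.+1 by apply: sf_mono => //; rewrite leqnSn.
have aYj := adapted_sub sub0 aY; have aY'j := adapted_sub sub0 aY'.
have mHk : H k j `<=` measurable by exact: (sf_meas sf).
have mH'k : H' k j `<=` measurable by exact: (sf_meas' sf).
have mid : measurable_fun setT (idfun : g_sigma_algebraType (H' k j) -> g_sigma_algebraType (H k j)).
  by move=> _ B mB; rewrite setTI; exact: (sigma_mono (sf_subu sf kK jb)) mB.
have [] := @sample_step_bound R d _ _ _ _ PXi F f X O L S2 nu ro fcont P Pu rad (u k j) (xi k j)
  (sf_lawu sf kK jb) (sf_lawxi sf kK jb) _ (g_sigma_algebraType (H k j)) _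
  (g_sigma_algebraType (H' k j)) idfun idfun (fun w => (w, u k j w)) tau b S' Y Y'
  (measurable_idfun_sub mHk) (measurable_idfun_sub mH'k) _ _ _ _
  aS aYj aY'j XY XY' sS sr.
- apply: measurable_fun_pair; last exact: (sf_u sf kK jb).
  exact: mid.
- by [].
- by move=> B C mB mC; apply: (sf_indu sf kK jb).
- by move=> B C mB mC; apply: (sf_indxi sf kK jb).
rewrite SE => s1 m1; split => //.
- apply: measurable_vecD; first exact: adapted_sub sub1 aS.
  apply: measurable_vecZ => //.
  apply: (measurable_difference ro fcont).
  + exact: adapted_sub sub1 aYj.
  + exact: adapted_sub sub1 aY'j.
  + by apply: sf_u_adapted => //; rewrite leqnn.
  + by apply: sf_xi_adapted => //; rewrite leqnn.
- apply: (le_trans m1); rewrite -natr1 mulrDl mul1r addrA lerD2r; exact: mS.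
Qed.

End filtration.

(** * Deterministic analysis of a stage *)

Definition Lmu {R : realType} (m : nat) (k : constants R) (mu : R) : R :=
  Lf k + m%:R * (mu * Mc k ^+ 2 + mu * Mbc k * Lc k + rho k * Mbc k * Lc k).

Section deterministic_stage.
Context {R : realType} {d m : nat} {dXi : measure_display} {Xi : measurableType dXi}.
Variables (k : constants R) (p : problem R d m Xi) (O : set 'rV[R]_d) (Phiinf : R).
Implicit Types (x y z v w s : 'rV[R]_d) (l : 'rV[R]_m).

Local Notation X := (feas p).
Local Notation f := (obj p).
Local Notation c := (con p).
Local Notation hr := (fine \o reg p).

Record regular_problem : Prop := RegularProblem {
  rp_pos : constants_positive k;
  rp_feas0 : X !=set0;
  rp_compact : compact X;
  rp_convex : forall x y (t : R), X x -> X y -> 0 <= t <= 1 ->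
    X (t *: x + (1 - t) *: y);
  rp_hconvex : econvex (reg p);
  rp_hfin : forall x, X x -> reg p x \is a fin_num;
  rp_hlip : forall x y, X x -> X y -> hr x - hr y <= Mh k * norm2 (x - y);
  rp_fdiff : forall x, differentiable f x;
  rp_cdiff : forall i x, differentiable (con_i p i) x;
  rp_fcont : continuous (grad f);
  rp_ccont : forall i, continuous (grad (con_i p i));
  rp_obj : A1_objective k p O;
  rp_con : A1_constraints k p;
  rp_open : open O;
  rp_sub : X `<=` O;
  rp_lower : forall x, X x -> Phiinf <= f x + hr x;
  rp_upper : forall x, X x -> f x + hr x <= Phiinf + gap k
}.

Hypothesis rp : regular_problem.

Lemma rp_prox_regular : prox_regular X (reg p).
Proof.
split; [exact: (rp_feas0 rp)|exact: (rp_compact rp)|exact: (rp_convex rp)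
  |exact: (rp_hconvex rp)|].
by split; [exact: (rp_hfin rp)|exists (Mh k); exact: (rp_hlip rp)].
Qed.

Lemma feas_segment x y (t : R) : X x -> X y -> 0 <= t <= 1 ->
  X (x + t *: (y - x)).
Proof.
move=> Xx Xy t01.
have -> : x + t *: (y - x) = t *: y + (1 - t) *: x.
  by rewrite scalerBr scalerBl scale1r addrCA.
exact: rp_convex.
Qed.

Lemma obj_descent x y : X x -> X y ->
  f y <= f x + dotv (grad f x) (y - x) + Lf k / 2 * norm2 (y - x) ^+ 2.
Proof.
move=> Xx Xy.
have := @taylor_bound R d f x (y - x) (Lf k) (rp_fdiff rp).
rewrite (addrC x (y - x)) subrK => H.
have : `|f y - f x - dotv (grad f x) (y - x)| <= Lf k / 2 * norm2 (y - x) ^+ 2.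
  apply: H => t t01.
  have [+ _] := rp_obj rp (rp_sub rp (feas_segment Xx Xy t01)) (rp_sub rp Xx).
  rewrite addrAC subrr add0r norm2Z ger0_norm//; by case/andP: t01.
rewrite ler_norml => /andP[_]; lra.
Qed.

Lemma con_lip i x y : X x -> X y -> `|con_i p i y - con_i p i x| <= Mc k * norm2 (y - x).
Proof.
move=> Xx Xy.
have := @mean_value_bound R d (con_i p i) x (y - x) (Mc k) (rp_cdiff rp i).
rewrite (addrC x (y - x)) subrK; apply => t t01.
by have [] := rp_con rp i (feas_segment Xx Xy t01) Xx.
Qed.

Lemma con_taylor i x y : X x -> X y ->
  `|con_i p i y - con_i p i x - dotv (grad (con_i p i) x) (y - x)| <=
  Lc k / 2 * norm2 (y - x) ^+ 2.
Proof.
move=> Xx Xy.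
have := @taylor_bound R d (con_i p i) x (y - x) (Lc k) (rp_cdiff rp i).
rewrite (addrC x (y - x)) subrK; apply => t t01.
have [_ _] := rp_con rp i (feas_segment Xx Xy t01) Xx.
by rewrite addrAC subrr add0r norm2Z ger0_norm//; case/andP: t01.
Qed.

Lemma con_bound i x : X x -> `|con_i p i x| <= Mbc k.
Proof. by move=> Xx; have [] := rp_con rp i Xx Xx. Qed.

Lemma con_grad_bound i x : X x -> norm2 (grad (con_i p i) x) <= Mc k.
Proof. by move=> Xx; have [] := rp_con rp i Xx Xx. Qed.

Lemma dotv_coord_bound (l l' : 'rV[R]_m) (a b : R) :
  (forall i, `|l ord0 i| <= a) -> (forall i, `|l' ord0 i| <= b) ->
  `|dotv l l'| <= m%:R * (a * b).
Proof.
move=> la lb; apply: le_trans (ler_norm_sum _ _ _) _.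
have -> : m%:R * (a * b) = \sum_(i < m) (a * b) by rewrite sumr_const card_ord mulr_natl.
by apply: ler_sum => i _; rewrite normrM ler_pM.
Qed.

Lemma con_sqr_bound x : X x -> norm2 (c x) ^+ 2 <= m%:R * Mbc k ^+ 2.
Proof.
move=> Xx; rewrite norm2_sqr expr2; apply: le_trans (ler_norm _) _.
by apply: dotv_coord_bound => i; exact: con_bound.
Qed.

Lemma dotv_con_gradT x l v :
  dotv (con_gradT p x l) v = \sum_(i < m) l ord0 i * dotv (grad (con_i p i) x) v.
Proof. by rewrite /con_gradT dotv_suml; apply: eq_bigr => i _; rewrite dotvZl. Qed.

Lemma con_gradTD x l l' : con_gradT p x (l + l') = con_gradT p x l + con_gradT p x l'.
Proof. by rewrite /con_gradT -big_split; apply: eq_bigr => i _; rewrite mxE scalerDl. Qed.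

Lemma con_gradTZ x l (a : R) : con_gradT p x (a *: l) = a *: con_gradT p x l.
Proof. by rewrite /con_gradT scaler_sumr; apply: eq_bigr => i _; rewrite mxE scalerA. Qed.

Definition auglag (mu : R) l x := f x + dotv l (c x) + mu / 2 * dotv (c x) (c x).

Lemma auglag_descent (mu : R) l x y : 0 <= mu -> X x -> X y ->
  (forall i, `|l ord0 i| <= rho k * Mbc k) ->
  auglag mu l y <= auglag mu l x +
    dotv (grad f x + con_gradT p x (l + mu *: c x)) (y - x) +
    Lmu m k mu / 2 * norm2 (y - x) ^+ 2.
Proof.
move=> mu0 Xx Xy lb.
have [[Lf0 Mf0 Mh0] [Mc0 Mbc0 Lc0] [sg0 be0 rh0]] := rp_pos rp.
have := obj_descent Xx Xy.
rewrite /auglag dotvDl dotv_con_gradT /Lmu.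
set D := norm2 (y - x) ^+ 2.
have D0 : 0 <= D by exact: sqr_ge0.
suff : dotv l (c y) + mu / 2 * dotv (c y) (c y) <=
   dotv l (c x) + mu / 2 * dotv (c x) (c x) +
   \sum_(i < m) (l + mu *: c x) ord0 i * dotv (grad (con_i p i) x) (y - x) +
   m%:R * ((mu * Mc k ^+ 2 + mu * Mbc k * Lc k + rho k * Mbc k * Lc k) / 2 * D).
  lra.
have -> : forall a : R, m%:R * a = \sum_(i < m) a by move=> a; rewrite sumr_const card_ord mulr_natl.
rewrite /dotv !mulr_sumr -!big_split; apply: ler_sum => i _ /=.
rewrite !mxE.
have := con_taylor i Xx Xy; have := con_lip i Xx Xy; have := con_bound i Xx; have := lb i.
rewrite -/D -/(con_i p i x) -/(con_i p i y) -/(dotv _ _).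
set cx := con_i p i x; set cy := con_i p i y; set G := dotv _ _.
move=> h1 h2 h3 h4.
set r := cy - cx - G in h4.
have -> : cy = cx + G + r by rewrite /r; ring.
have h3' : (cx + G + r - cx) ^+ 2 <= Mc k ^+ 2 * D.
  rewrite /D -exprMn -real_normK ?num_real// ler_pXn2r ?nnegrE//.
    by rewrite (_ : cx + G + r = cy)//; rewrite /r; ring.
  by rewrite mulr_ge0 ?norm2_ge0// ltW.
have h5 : l ord0 i * r <= rho k * Mbc k * (Lc k / 2 * D).
  apply: le_trans (ler_norm _) _; rewrite normrM; exact: ler_pM.
have h6 : cx * r <= Mbc k * (Lc k / 2 * D).
  apply: le_trans (ler_norm _) _; rewrite normrM; exact: ler_pM.
have h7 := ler_wpM2l mu0 h6; have h8 := ler_wpM2l mu0 h3'.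
move: h5 h7 h8; move: (l ord0 i) => li; move: (rho k) (Mbc k) (Lc k) (Mc k) => *.
nra.
Qed.

Lemma grad_obj_bound x : O x -> norm2 (grad f x) <= Mf k.
Proof.
move=> Ox; set g := grad f x.
have [g0|g0] := eqVneq (norm2 g) 0.
  by rewrite g0; have [[_ /ltW]] := rp_pos rp.
have gp : 0 < norm2 g by rewrite lt_def g0 norm2_ge0.
rewrite -(ler_pM2r gp) -expr2 norm2_sqr -derive_grad; last exact: rp_fdiff.
have dv : derivable f x g by apply: diff_derivable; exact: rp_fdiff.
have := dv; rewrite /derivable => cv.
apply: (limr_le cv).
have nO : nbhs x O by apply: open_nbhs_nbhs; split => //; exact: (rp_open rp).
have : \forall h \near (0 : R), O (h *: g + x).
  have cl : {for (0 : R), continuous (fun h : R => h *: g + x)}.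
    apply: (@continuousD _ _ _ (fun h : R => h *: g) (fun=> x)); last exact: cvg_cst.
    exact: scalel_continuous.
  by apply: cl; rewrite scale0r add0r.
move=> nearO.
have nearO' : \forall h \near (0 : R)^', O (h *: g + x) by exact: cvg_within.
near=> h.
have h0 : h != 0 by near: h; exact: nbhs_dnbhs_neq.
have Oh : O (h *: g + x) by near: h.
have [_ +] := rp_obj rp Oh Ox.
rewrite addrK norm2Z => H.
apply: le_trans (ler_norm _) _.
rewrite /GRing.scale /= normrM normfV ler_pdivrMl ?normr_gt0//.
by rewrite mulrCA.
Unshelve. all: by end_near.
Qed.

End deterministic_stage.

Lemma six_terms_le {R : realFieldType} (w e g c x y Mf Mh r q : R) :
  w <= Mh -> g <= Mf -> c <= r -> x <= q ->
  w + e + g + c + x + y <= Mf + Mh + r + e + (q + y).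
Proof. lra. Qed.

Lemma sqr_sum5 {R : realFieldType} (a1 a2 a3 a4 a5 : R) :
  (a1 + a2 + a3 + a4 + 3 / 2 * a5) ^+ 2 <=
  5 * (a1 ^+ 2 + a2 ^+ 2 + a3 ^+ 2 + a4 ^+ 2 + 9 / 4 * a5 ^+ 2).
Proof.
have : 0 <= (a1 - a2) ^+ 2 + (a1 - a3) ^+ 2 + (a1 - a4) ^+ 2 + (a1 - 3/2 * a5) ^+ 2
  + (a2 - a3) ^+ 2 + (a2 - a4) ^+ 2 + (a2 - 3/2*a5) ^+ 2 + (a3 - a4) ^+ 2
  + (a3 - 3/2*a5) ^+ 2 + (a4 - 3/2*a5) ^+ 2.
  by rewrite !addr_ge0 ?sqr_ge0.
lra.
Qed.

Section deterministic_stage_step.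
Context {R : realType} {d m : nat} {dXi : measure_display} {Xi : measurableType dXi}.
Variables (k : constants R) (p : problem R d m Xi) (O : set 'rV[R]_d) (Phiinf : R).
Implicit Types (x y z v w s : 'rV[R]_d) (l : 'rV[R]_m).

Local Notation X := (feas p).
Local Notation f := (obj p).
Local Notation c := (con p).
Local Notation hr := (fine \o reg p).

Hypothesis rp : regular_problem k p O Phiinf.
Variables (mu eta : R).
Hypotheses (mu0 : 0 < mu) (eta0 : 0 < eta) (etaL : eta * Lmu m k mu <= 2^-1).

Definition step l s x :=
  prox X (reg p) eta (s + con_gradT p x (l + mu *: c x)) x.

Lemma step_feas l s x : X (step l s x).
Proof. exact: (prox_feas (rp_prox_regular rp)). Qed.

Lemma step_decrease l s x (y := step l s x) : X x ->
  (forall i, `|l ord0 i| <= rho k * Mbc k) ->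
  auglag p mu l y + hr y + (2 * eta)^-1 * norm2 (y - x) ^+ 2 <=
  auglag p mu l x + hr x + eta * norm2 (s - grad f x) ^+ 2.
Proof.
move=> Xx lb.
have := auglag_descent rp (ltW mu0) Xx (step_feas l s x) lb; rewrite -/y.
have := prox_vi (rp_prox_regular rp) eta0
  (s + con_gradT p x (l + mu *: c x)) x Xx.
rewrite -/(step l s x) -/y.
set g := con_gradT p x _.
have -> : dotv (x - y) (y - x) = - norm2 (y - x) ^+ 2.
  by rewrite norm2_sqr -dotvNl opprB.
have := @dotv_young _ _ (grad f x - s) (y - x) (2 * eta) _.
have e20 : 0 < 2 * eta by rewrite mulr_gt0.
move=> /(_ e20).
rewrite -!norm2_sqr (distC2 (grad f x) s).
rewrite !dotvDl dotvNl.
set D := norm2 (y - x) ^+ 2; set E := norm2 (s - _) ^+ 2.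
have D0 : 0 <= D by exact: sqr_ge0.
have L1 : Lmu m k mu * D <= (2 * eta)^-1 * D.
  by rewrite ler_wpM2r// invfM -ler_pdivrMr// ?invr_gt0// invrK mulrC.
have e1 : (2 * (2 * eta))^-1 = (2 * eta)^-1 / 2 by rewrite invfM mulrC.
have e2 : eta^-1 = 2 * (2 * eta)^-1 by rewrite invfM mulrA divff ?mul1r.
have e3 : 2 * eta / 2 = eta by rewrite mulrAC divff ?mul1r.
rewrite e1 e2 e3.
move: L1; move: ((2 * eta)^-1) => u /=; lra.
Qed.

Lemma gradient_mapping_bound l s x (y := step l s x) : X x ->
  norm2 (gradient_mapping X (reg p) eta x
    (grad f x + con_gradT p x (l + mu *: c x))) ^+ 2 <=
  2 * (eta ^- 2 * norm2 (y - x) ^+ 2) + 2 * norm2 (s - grad f x) ^+ 2.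
Proof.
move=> Xx; rewrite /gradient_mapping.
set g := con_gradT p x _; set q := prox _ _ _ _ _.
have qy : norm2 (y - q) <= eta * norm2 (s - grad f x).
  apply: le_trans (prox_nonexpansive (rp_prox_regular rp) eta0 _ _ _ _) _.
  rewrite -/g (_ : _ - _ = eta *: (grad f x - s)); last first.
    by apply/rowP => i; rewrite !mxE; ring.
  by rewrite norm2Z gtr0_norm// distC2.
have -> : eta^-1 *: (x - q) = eta^-1 *: (x - y) + eta^-1 *: (y - q).
  by rewrite -scalerDr addrA subrK.
apply: le_trans (sqr_norm2D _ _) _.
have ie0 : 0 < eta^-1 by rewrite invr_gt0.
rewrite (norm2Z _ (x - y)) (norm2Z _ (y - q)) (gtr0_norm ie0) (distC2 x y) exprMn exprVn.
rewrite lerD2l ler_pM2l; last exact: ltr0n.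
rewrite ler_pXn2r ?nnegrE ?norm2_ge0//; first by rewrite ler_pdivrMl.
by rewrite mulr_ge0 ?norm2_ge0 ?(ltW ie0).
Qed.

Lemma dist2_le (a b : 'rV[R]_d) (B : set 'rV[R]_d) : B b -> dist2 a B <= norm2 (a - b).
Proof.
move=> Bb; apply: ge_inf; last by exists b.
by exists 0 => _ [z _ <-]; exact: norm2_ge0.
Qed.

Lemma con_gradT_con_lip x y : X x -> X y ->
  norm2 (con_gradT p x (c x) - con_gradT p y (c y)) <=
  m%:R * (Mbc k * Lc k + Mc k ^+ 2) * norm2 (y - x).
Proof.
move=> Xx Xy; rewrite /con_gradT -sumrB; apply: le_trans (norm2_sum _ _ _) _.
rewrite -mulrA mulr_natl -[m in X in _ <= X]card_ord -sumr_const.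
apply: ler_sum => i _; rewrite -/(con_i p i x) -/(con_i p i y).
have [_ _ gL] := rp_con rp i Xx Xy.
have cL := con_lip rp i Xx Xy.
have cb := con_bound rp i Xx; have gb := con_grad_bound rp i Xy.
set gx := grad _ x in gL *; set gy := grad _ y in gL gb *.
have -> : con_i p i x *: gx - con_i p i y *: gy =
   con_i p i x *: (gx - gy) + (con_i p i x - con_i p i y) *: gy.
  by rewrite scalerBr scalerBl addrA subrK.
apply: le_trans (norm2D _ _) _; rewrite !norm2Z mulrDl; apply: lerD.
  by rewrite -mulrA (distC2 y x); apply: ler_pM => //; exact: norm2_ge0.
rewrite expr2 -mulrA mulrC distrC mulrC.
rewrite (_ : Mc k * (Mc k * _) = (Mc k * norm2 (y - x)) * Mc k); last by ring.
by apply: ler_pM => //; exact: norm2_ge0.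
Qed.

Lemma con_gradT_bound x l (a : R) : X x -> (forall i, `|l ord0 i| <= a) ->
  norm2 (con_gradT p x l) <= m%:R * (a * Mc k).
Proof.
move=> Xx lb; apply: le_trans (norm2_sum _ _ _) _.
rewrite mulr_natl -[m in X in _ <= X]card_ord -sumr_const.
apply: ler_sum => i _; rewrite norm2Z; apply: ler_pM => //; first exact: norm2_ge0.
exact: (con_grad_bound rp).
Qed.

Lemma norm2_sub5 (t e1 e2 e3 e4 e5 : 'rV[R]_d) :
  norm2 (t - e1 - e2 - e3 - e4 - e5) <=
  norm2 t + norm2 e1 + norm2 e2 + norm2 e3 + norm2 e4 + norm2 e5.
Proof.
have n2B (a b : 'rV[R]_d) : norm2 (a - b) <= norm2 a + norm2 b.
  by have := norm2D a (- b); rewrite norm2N.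
by do 5 (apply: le_trans (n2B _ _) _; apply: lerD => //).
Qed.

(* The optimality condition of the proximal step puts mu * grad c^T c within the
   norm of the remaining terms of - N_X; the qualification bounds |c| by this. *)
Lemma step_infeasibility l s x (y := step l s x) : X x ->
  (forall i, `|l ord0 i| <= rho k * Mbc k) ->
  beta k * norm2 (c y) <=
    dist2 (con_gradT p y (c y)) [set - v | v in normal_cone X y] ->
  beta k ^+ 2 * mu ^+ 2 * norm2 (c y) ^+ 2 <=
  5 * (Mf k ^+ 2 + Mh k ^+ 2 + m%:R ^+ 2 * rho k ^+ 2 * Mbc k ^+ 2 * Mc k ^+ 2 +
       norm2 (s - grad f x) ^+ 2 + 9 / 4 * (eta ^- 2 * norm2 (y - x) ^+ 2)).
Proof.
move=> Xx lb qual.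
have [[Lf0 Mf0 Mh0] [Mc0 Mbc0 Lc0] [sg0 be0 rh0]] := rp_pos rp.
have Xy : X y by exact: step_feas.
set g := con_gradT p x (l + mu *: c x).
pose w := s + g + eta^-1 *: (y - x).
have [||n nN nM] := @normal_cone_near _ _ _ _ w y (Mh k) (rp_prox_regular rp) Xy.
- move=> z Xz; have := prox_vi (rp_prox_regular rp) eta0 (s + g) x Xz.
  rewrite -/(step l s x) -/y => h1.
  have := rp_hlip rp Xz Xy => /= h2; move: h1 => /=.
  rewrite /w (dotvDl (s + g)) dotvZl.
  have -> : dotv (s + g) (z - y) = - dotv (s + g) (y - z) by rewrite -dotvNr opprB.
  have -> : dotv (y - x) (z - y) = dotv (x - y) (y - z).
    by rewrite -(opprB x y) -(opprB y z) dotvNl dotvNr opprK.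
  move: h2; move: (eta^-1) => u; lra.
- exact: ltW.
have bound : mu * dist2 (con_gradT p y (c y)) [set - v | v in normal_cone X y] <=
    norm2 (mu *: con_gradT p y (c y) + n).
  have := @dist2_le (con_gradT p y (c y)) (- (mu^-1 *: n)) [set - v | v in normal_cone X y].
  have -> : norm2 (con_gradT p y (c y) - - (mu^-1 *: n)) = mu^-1 * norm2 (mu *: con_gradT p y (c y) + n).
    rewrite -[X in X * _]gtr0_norm ?invr_gt0// -norm2Z scalerDr scalerA mulVf ?gt_eqF//.
    by rewrite scale1r opprK.
  move=> H; rewrite mulrC -ler_pdivlMr// [leRHS]mulrC; apply: H.
  exists (mu^-1 *: n) => // z Xz; rewrite dotvZl pmulr_rle0 ?invr_gt0//; exact: nN.
set C := con_gradT p y (c y) in bound.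
have split4 : mu *: C + n = (w + n) - (s - grad f x) - grad f x - con_gradT p x l
    - (mu *: (con_gradT p x (c x) - C)) - eta^-1 *: (y - x).
  rewrite /w /g con_gradTD con_gradTZ scalerBr.
  apply/rowP => i; rewrite !mxE; ring.
have lip := con_gradT_con_lip Xx Xy; rewrite -/C in lip.
have lb' := con_gradT_bound Xx lb.
have gb := grad_obj_bound rp (rp_sub rp Xx).
set D := norm2 (y - x) in lip *; set E := norm2 (s - grad f x).
have D0 : 0 <= D by exact: norm2_ge0.
have E0 : 0 <= E by exact: norm2_ge0.
have muL : mu * (m%:R * (Mbc k * Lc k + Mc k ^+ 2) * D) <= 2^-1 * (eta^-1 * D).
  rewrite !mulrA ler_wpM2r// ler_pdivlMr//.
  apply: le_trans etaL; rewrite mulrC ler_pM2l// /Lmu.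
  have : 0 <= m%:R * (rho k * Mbc k * Lc k) by rewrite !mulr_ge0// ltW.
  lra.
have tot : beta k * mu * norm2 (c y) <=
   Mf k + Mh k + m%:R * rho k * Mbc k * Mc k + E + 3 / 2 * (eta^-1 * D).
  apply: (@le_trans _ _ (norm2 (mu *: C + n))).
    by apply: le_trans bound; rewrite (mulrC (beta k)) -mulrA ler_pM2l.
  rewrite split4.
  apply: le_trans (norm2_sub5 _ _ _ _ _ _) _.
  rewrite (norm2Z mu) (norm2Z eta^-1) (gtr0_norm mu0) gtr0_norm ?invr_gt0//.
  have h4 := le_trans (ler_wpM2l (ltW mu0) lip) muL.
  have -> : m%:R * rho k * Mbc k * Mc k = m%:R * (rho k * Mbc k * Mc k) by rewrite !mulrA.
  rewrite -/D -/E.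
  have -> : 3 / 2 * (eta^-1 * D) = 2^-1 * (eta^-1 * D) + eta^-1 * D by field; rewrite gt_eqF.
  exact: six_terms_le.
have l0 : 0 <= beta k * mu * norm2 (c y) by rewrite !mulr_ge0 ?norm2_ge0// ltW.
have -> : beta k ^+ 2 * mu ^+ 2 * norm2 (c y) ^+ 2 = (beta k * mu * norm2 (c y)) ^+ 2.
  by rewrite !exprMn.
have := ler_pM l0 l0 tot tot; rewrite -!expr2 => h; apply: (le_trans h).
have -> : m%:R ^+ 2 * rho k ^+ 2 * Mbc k ^+ 2 * Mc k ^+ 2 = (m%:R * rho k * Mbc k * Mc k) ^+ 2.
  by rewrite !exprMn.
have -> : eta ^- 2 * D ^+ 2 = (eta^-1 * D) ^+ 2 by rewrite exprMn exprVn.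
exact: sqr_sum5.
Qed.

Lemma stage_decrease (K : nat) (x : nat -> 'rV[R]_d) (s : nat -> 'rV[R]_d)
    (l : nat -> 'rV[R]_m) :
  (0 < K)%N -> X (x 0%N) -> l 0%N = 0 ->
  (forall j, x j.+1 = step (l j) (s j) (x j)) ->
  (forall j, l j.+1 = l j + (rho k / K%:R) *: c (x j)) ->
  [/\ forall j, X (x j),
      forall j i, (j <= K)%N -> `|l j ord0 i| <= rho k * Mbc k &
      \sum_(j < K) (2 * eta)^-1 * norm2 (x j.+1 - x j) ^+ 2 <=
        gap k + 2 * m%:R * rho k * Mbc k ^+ 2 + mu / 2 * norm2 (c (x 0%N)) ^+ 2
        + eta * \sum_(j < K) norm2 (s j - grad f (x j)) ^+ 2].
Proof.
move=> K0 X0 l0 xS lS.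
have [[Lf0 Mf0 Mh0] [Mc0 Mbc0 Lc0] [sg0 be0 rh0]] := rp_pos rp.
have Xx j : X (x j) by case: j => // j; rewrite xS; exact: step_feas.
have K0' : 0 < K%:R :> R by rewrite ltr0n.
have r0 : 0 <= rho k / K%:R by rewrite divr_ge0 ?ltW.
have lb j i : `|l j ord0 i| <= j%:R * (rho k / K%:R * Mbc k).
  elim: j => [|j ih]; first by rewrite l0 mxE normr0 mul0r.
  rewrite lS mxE; apply: le_trans (ler_normD _ _) _.
  rewrite -natr1 mulrDl mul1r; apply: lerD => //.
  rewrite mxE normrM ger0_norm//; apply: ler_wpM2l => //.
  exact: (con_bound rp _ (Xx j)).
have lK j i : (j <= K)%N -> `|l j ord0 i| <= rho k * Mbc k.
  move=> jK; apply: le_trans (lb j i) _.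
  rewrite !mulrA ler_pM2r// ler_pdivrMr// mulrC ler_pM2l// ler_nat//.
split => //.
pose W j := auglag p mu (l j) (x j) + hr (x j).
have WS j : (j < K)%N -> W j.+1 + (2 * eta)^-1 * norm2 (x j.+1 - x j) ^+ 2 <=
    W j + eta * norm2 (s j - grad f (x j)) ^+ 2 + rho k / K%:R * (m%:R * (Mbc k * Mbc k)).
  move=> jK.
  have := step_decrease (s j) (Xx j) (fun i => lK j i (ltnW jK)).
  rewrite -xS /= /W => h.
  have : auglag p mu (l j.+1) (x j.+1) <= auglag p mu (l j) (x j.+1) + rho k / K%:R * (m%:R * (Mbc k * Mbc k)).
    rewrite /auglag lS dotvDl dotvZl.
    have : dotv (c (x j)) (c (x j.+1)) <= m%:R * (Mbc k * Mbc k).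
      apply: le_trans (ler_norm _) _.
      by apply: dotv_coord_bound => i; apply: (con_bound rp).
    move=> /(ler_wpM2l r0); move: (rho k / K%:R) => a; lra.
  by move: (rho k / K%:R) => a; move: h => /=; lra.
have sumW n : (n <= K)%N ->
    W n + \sum_(j < n) (2 * eta)^-1 * norm2 (x j.+1 - x j) ^+ 2 <=
    W 0%N + eta * \sum_(j < n) norm2 (s j - grad f (x j)) ^+ 2 +
    n%:R * (rho k / K%:R * (m%:R * (Mbc k * Mbc k))).
  elim: n => [|n ih] nK; first by rewrite !big_ord0 mulr0 mul0r !addr0.
  rewrite !big_ord_recr /= -[n.+1%:R]natr1.
  have := ih (ltnW nK); have := WS n nK; move: (rho k / K%:R) => a; lra.
have := sumW K (leqnn K).
have -> : K%:R * (rho k / K%:R * (m%:R * (Mbc k * Mbc k))) = m%:R * rho k * Mbc k ^+ 2.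
  by field; rewrite gt_eqF.
have : W 0%N <= Phiinf + gap k + mu / 2 * norm2 (c (x 0%N)) ^+ 2.
  rewrite /W /auglag l0 dotv0l norm2_sqr; have := rp_upper rp X0 => /=; lra.
have : Phiinf - m%:R * rho k * Mbc k ^+ 2 <= W K.
  rewrite /W /auglag.
  have := rp_lower rp (Xx K).
  have := @dotv_coord_bound _ _ (l K) (c (x K)) _ _ (fun i => lK K i (leqnn K)) (fun i => con_bound rp i (Xx K)).
  rewrite ler_norml => /andP[+ _].
  have : 0 <= mu / 2 * dotv (c (x K)) (c (x K)).
    by rewrite mulr_ge0 ?dotvv_ge0// divr_ge0// ltW.
  have -> : m%:R * (rho k * Mbc k * Mbc k) = m%:R * rho k * Mbc k ^+ 2 by ring.
  move=> /=; lra.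
lra.
Qed.

End deterministic_stage_step.

(** * Mean bounds over a stage *)

Section stage_process.
Context {R : realType} {d m : nat} {dXi dOm : measure_display}
  {Xi : measurableType dXi} {Om : measurableType dOm}.
Variables (k : constants R) (p : problem R d m Xi) (PXi : probability Xi R)
  (O : set 'rV[R]_d) (Phiinf DX S2 : R) (th : stage_parameters R).
Variables (P : probability Om R) (Pu : probability (rvec R d) R).
Local Notation X := (feas p).
Local Notation f := (obj p).
Local Notation nu := (st_nu th).
Local Notation K := (st_K th).
Local Notation alpha := (st_alpha th).

Hypothesis rp : regular_problem k p O Phiinf.
Hypothesis XD : forall x, X x -> norm2 x <= DX.
Hypothesis ro : regular_oracle PXi (so p) f X O (Lf k) S2 nu.
Hypothesis rad : rademacher Pu.
Hypothesis d0 : (0 < d)%N.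
Hypothesis thn : st_n th = d.
Hypothesis thn0 : (0 < st_n0 th)%N.
Hypothesis theta0 : 0 < st_eta th.
Hypothesis alpha01 : 0 <= alpha <= 1.
Hypothesis S20 : 0 <= S2.

Definition batch_size (j : nat) := if j == 0%N then st_n0 th else st_n th.

Variables (u : nat -> nat -> {RV P >-> rvec R d}) (xi : nat -> nat -> {RV P >-> Xi})
  (H H' : nat -> nat -> set (set Om)).
Hypothesis sf : sampling_filtration Pu PXi K batch_size u xi H H'.
Variable x0 : Om -> 'rV[R]_d.
Hypothesis x0_adapted : adapted (H 0 0) x0.
Hypothesis x0_feas : forall w, X (x0 w).

Definition stage_state (w : Om) (j : nat) : @state R d m :=
  single_stage p th (x0 w) (fun i l => u i l w) (fun i l => xi i l w) j.

Local Notation xs j w := (st_x (stage_state w j)).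
Local Notation ss j w := (st_s (stage_state w j)).
Local Notation ls j w := (st_lambda (stage_state w j)).

Lemma stage_xS w j : xs j.+1 w = step p (st_mu th) (st_eta th) (ls j w) (ss j w) (xs j w).
Proof. by rewrite /stage_state /=; case: single_stage. Qed.

Lemma stage_lS w j : ls j.+1 w = ls j w + st_rho th j *: con p (xs j w).
Proof. by rewrite /stage_state /=; case: single_stage. Qed.

Lemma stage_sS w j : ss j.+1 w = (st_n th)%:R^-1 *: \sum_(i < st_n th)
  (estimator (so p) nu (xs j.+1 w) (u j.+1 i w) (xi j.+1 i w) +
   (1 - alpha) *: (ss j w - estimator (so p) nu (xs j w) (u j.+1 i w) (xi j.+1 i w))).
Proof. by rewrite /stage_state /=; case: single_stage. Qed.

Definition err (j : nat) (w : Om) : 'rV[R]_d := ss j w - gbar f nu (xs j w).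

Let fcont : continuous f.
Proof. by move=> x; apply: differentiable_continuous; exact: (rp_fdiff rp). Qed.

Let sum_shift (n : nat) (G : 'I_n -> 'rV[R]_d) (c : 'rV[R]_d) : (0 < n)%N ->
  n%:R^-1 *: \sum_i (G i + c) = n%:R^-1 *: (\sum_i G i) + c.
Proof.
move=> n0; rewrite big_split scalerDr sumr_const card_ord -[c *+ n]scaler_nat.
by rewrite scalerA mulVf ?scale1r// pnatr_eq0 -lt0n.
Qed.

Lemma errS j w : err j.+1 w = (1 - alpha) *: err j w + d%:R^-1 *: \sum_(i < d)
  difference (so p) f nu (1 - alpha) (xs j.+1 w) (xs j w) (u j.+1 i w) (xi j.+1 i w).
Proof.
rewrite /err stage_sS thn; set x1 := xs j.+1 w; set x := xs j w; set s := ss j w.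
set tau := 1 - alpha.
pose G i := estimator (so p) nu x1 (u j.+1 i w) (xi j.+1 i w) -
  tau *: estimator (so p) nu x (u j.+1 i w) (xi j.+1 i w).
have -> : \sum_(i < d) (estimator (so p) nu x1 (u j.+1 i w) (xi j.+1 i w) +
     tau *: (s - estimator (so p) nu x (u j.+1 i w) (xi j.+1 i w))) =
   \sum_(i < d) (G i + tau *: s).
  by apply: eq_bigr => i _; rewrite /G scalerBr [tau *: s - _]addrC addrA.
have -> : \sum_(i < d) difference (so p) f nu tau x1 x (u j.+1 i w) (xi j.+1 i w) =
   \sum_(i < d) (G i + - (gbar f nu x1 - tau *: gbar f nu x)) by [].
rewrite !sum_shift// scalerBr; set Q := _ *: _.
by rewrite opprB; apply/rowP => i; rewrite !mxE; ring.
Qed.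

Lemma err0 w : err 0 w = 0 + (st_n0 th)%:R^-1 *: \sum_(i < st_n0 th)
  difference (so p) f nu 0 (x0 w) (x0 w) (u 0 i w) (xi 0 i w).
Proof.
rewrite /err /stage_state /= add0r.
have -> : \sum_(i < st_n0 th) difference (so p) f nu 0 (x0 w) (x0 w) (u 0 i w) (xi 0 i w) =
   \sum_(i < st_n0 th) (zo_estimator p nu (x0 w) (u 0 i w) (xi 0 i w) + - gbar f nu (x0 w)).
  by apply: eq_bigr => i _; rewrite /difference !scale0r !subr0.
by rewrite sum_shift.
Qed.

Lemma stage_feas j w : X (xs j w).
Proof.
case: j => [|j]; first exact: x0_feas.
by rewrite stage_xS; exact: (step_feas rp).
Qed.

Lemma measurable_con {d1} {T : measurableType d1} (Y : T -> rvec R d) :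
  measurable_fun setT Y -> measurable_fun setT (fun w => con p (Y w) : rvec R m).
Proof.
move=> mY; apply: measurable_rvec => i.
apply: (@measurable_continuous _ _ _ _ (con_i p i) Y) => // x.
by apply: differentiable_continuous; exact: (rp_cdiff rp).
Qed.

Lemma measurable_con_gradT {d1} {T : measurableType d1} (Y : T -> rvec R d)
    (l : T -> rvec R m) :
  measurable_fun setT Y -> measurable_fun setT l ->
  measurable_fun setT (fun w => con_gradT p (Y w) (l w) : rvec R d).
Proof.
move=> mY ml; rewrite /con_gradT.
apply: measurable_vec_sum => i; apply: measurable_vecZ; first exact: measurable_coord_comp.
by apply: measurable_vec_continuous => //; exact: (rp_ccont rp).
Qed.

Lemma measurable_prox {d1} {T : measurableType d1} (eta : R) (g Y : T -> rvec R d) :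
  0 < eta -> measurable_fun setT g -> measurable_fun setT Y ->
  measurable_fun setT (fun w => prox X (reg p) eta (g w) (Y w) : rvec R d).
Proof.
move=> e0 mg mY.
under eq_fun do rewrite (prox_shift (rp_prox_regular rp) e0).
apply: (@measurable_vec_continuous _ _ _ _ _ (prox X (reg p) eta 0)
  (fun w => (Y w : 'rV[R]_d) - eta *: (g w : 'rV[R]_d))).
  apply: (@lipschitz2_continuous _ _ _ (prox X (reg p) eta 0) 1) => x y.
  rewrite mul1r; have := prox_nonexpansive (rp_prox_regular rp) e0 0 x 0 y.
  by rewrite scaler0 !subr0.
by apply: measurable_vecB => //; apply: measurable_vecZ.
Qed.

Lemma measurable_step {d1} {T : measurableType d1} (mu eta : R) (l : T -> rvec R m)
    (s Y : T -> rvec R d) : 0 < eta ->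
  measurable_fun setT l -> measurable_fun setT s -> measurable_fun setT Y ->
  measurable_fun setT (fun w => step p mu eta (l w) (s w) (Y w) : rvec R d).
Proof.
move=> e0 ml ms mY; apply: measurable_prox => //; apply: measurable_vecD => //.
apply: measurable_con_gradT => //; apply: measurable_vecD => //.
by apply: measurable_vecZ => //; exact: measurable_con.
Qed.

Lemma sqr_dist_bound x y : X x -> X y -> norm2 (x - y) ^+ 2 <= 4 * DX ^+ 2.
Proof.
move=> Xx Xy; apply: le_trans (sqr_norm2D _ _) _; rewrite norm2N.
have h z : X z -> norm2 z ^+ 2 <= DX ^+ 2.
  move=> Xz; rewrite ler_pXn2r ?nnegrE ?norm2_ge0 ?XD//.
  exact: le_trans (norm2_ge0 z) (XD Xz).
have := h _ Xx; have := h _ Xy; lra.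
Qed.

Lemma summable_dist (Y Y' : Om -> rvec R d) :
  measurable_fun setT Y -> measurable_fun setT Y' ->
  (forall w, X (Y w)) -> (forall w, X (Y' w)) ->
  summable1 P (fun w => norm2 ((Y w : 'rV[R]_d) - Y' w) ^+ 2).
Proof.
move=> mY mY' XY XY'.
apply: (@summable1_le _ _ _ _ _ (fun=> 4 * DX ^+ 2)).
- by apply: measurable_funX; apply: measurable_norm2; exact: measurable_vecB.
- by move=> w; rewrite sqr_ge0 sqr_dist_bound.
- by apply: summable1_cst; rewrite mulr_ge0 ?sqr_ge0.
Qed.

Local Notation noise := (Lf k ^+ 2 * nu ^+ 2 * d%:R ^+ 2).

Let noise0 : 0 <= noise.
Proof. by apply: mulr_ge0; last exact: exprn_ge0; apply: mulr_ge0; exact: sqr_ge0. Qed.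

Lemma mean_residual_bound (tau : R) (Y Y' : Om -> rvec R d) :
  measurable_fun setT Y -> measurable_fun setT Y' ->
  (forall w, X (Y w)) -> (forall w, X (Y' w)) ->
  summable1 P (fun w => residual_bound (d := d) (Lf k) S2 nu tau (Y w) (Y' w)) /\
  mean P (fun w => residual_bound (d := d) (Lf k) S2 nu tau (Y w) (Y' w)) =
    6 * tau ^+ 2 * Lf k ^+ 2 * mean P (fun w => norm2 ((Y w : 'rV[R]_d) - Y' w) ^+ 2) +
    (12 * tau ^+ 2 * noise + 4 * (1 - tau) ^+ 2 * (S2 + noise)).
Proof.
move=> mY mY' XY XY'.
have sd := summable_dist mY mY' XY XY'.
have c0 : 0 <= 6 * tau ^+ 2 * Lf k ^+ 2.
  by apply: mulr_ge0; last exact: sqr_ge0; apply: mulr_ge0 => //; exact: sqr_ge0.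
have c1 : 0 <= 12 * tau ^+ 2 * noise + 4 * (1 - tau) ^+ 2 * (S2 + noise).
  apply: addr_ge0; apply: mulr_ge0 => //; try (by apply: mulr_ge0 => //; exact: sqr_ge0).
  exact: addr_ge0.
have e : (fun w => residual_bound (d := d) (Lf k) S2 nu tau (Y w) (Y' w)) =
  (fun w => 6 * tau ^+ 2 * Lf k ^+ 2 * norm2 ((Y w : 'rV[R]_d) - Y' w) ^+ 2 +
    (12 * tau ^+ 2 * noise + 4 * (1 - tau) ^+ 2 * (S2 + noise))).
  by apply/funext => w; rewrite /residual_bound; ring.
rewrite e; split; first by apply: summable1D; [exact: summable1Z|exact: summable1_cst].
rewrite meanD ?mean_cst ?mean_scale//; [exact: summable1Z|exact: summable1_cst].
Qed.

Lemma sf_H_next j : (j < K)%N -> H j 0%N `<=` H j.+1 0%N.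
Proof.
move=> jK; apply: (subset_trans _ (sf_next sf jK)).
by apply: (sf_mono sf jK); rewrite leq0n leqnn.
Qed.

Definition stage_dist j : R := mean P (fun w => norm2 (xs j.+1 w - xs j w) ^+ 2).
Definition stage_err j : R := mean P (fun w => norm2 (err j w) ^+ 2).

Lemma stage_induction j : (j < K)%N ->
  [/\ adapted (H j 0%N) (fun w => xs j w),
      adapted (H j 0%N) (fun w => ls j w),
      adapted (H j (batch_size j)) (err j),
      summable1 P (fun w => norm2 (err j w) ^+ 2) &
      stage_err j <= if j is i.+1 then
          (1 - alpha) ^+ 2 * stage_err i + 6 * Lf k ^+ 2 * stage_dist i +
            (12 * noise + 4 * alpha ^+ 2 * (S2 + noise))
        else (st_n0 th)%:R^-1 * (4 * d%:R * (S2 + noise))].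
Proof.
have Hm i l : H i l `<=` measurable by exact: (sf_meas sf).
elim: j => [|j ih] jK.
  have ax : adapted (H 0%N 0%N) (fun w => xs 0%N w) by exact: x0_adapted.
  have mx := adapted_measurable (@Hm 0%N 0%N) ax.
  have [sr mr] := mean_residual_bound 0 mx mx (stage_feas 0) (stage_feas 0).
  have s0 : summable1 P (fun w => norm2 ((fun=> 0 : 'rV[R]_d) w) ^+ 2).
    by rewrite norm2_0 expr0n; exact: summable1_cst.
  have a0 : adapted (H 0%N 0%N) (fun=> 0 : 'rV[R]_d) by exact: measurable_cst.
  have [aE sE mE] := @batch_bound _ _ _ _ _ _ P Pu PXi (so p) f X O _ _ nu ro fcont rad _ _ u xi
    H H' sf 0%N 0 (st_n0 th)%:R^-1 (fun=> 0) x0 x0 (st_n0 th) jK (leqnn _) a0 x0_adapted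
    x0_adapted x0_feas x0_feas s0 sr.
  have eE : err 0 = fun w => (fun=> 0) w + (st_n0 th)%:R^-1 *: \sum_(i < st_n0 th)
     difference (so p) f nu 0 (x0 w) (x0 w) (u 0%N i w) (xi 0%N i w).
    by apply/funext => w; exact: err0.
  rewrite /stage_err eE; split => //; first exact: measurable_cst.
  apply: (le_trans mE); rewrite norm2_0 expr0n mean_cst add0r.
  rewrite [mean P _]mr.
  have n0 : (st_n0 th)%:R != 0 :> R by rewrite pnatr_eq0 -lt0n.
  by rewrite le_eqVlt; apply/orP; left; apply/eqP; field.
have [ax al ae se me] := ih (ltnW jK).
have axn := adapted_sub (sf_H_next (ltnW jK)) ax.
have aln := adapted_sub (sf_H_next (ltnW jK)) al.
have aen := adapted_sub (sf_next sf (ltnW jK)) ae.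
have asn : adapted (H j.+1 0%N) (fun w => ss j w).
  have -> : (fun w => ss j w) = (fun w => err j w + gbar f nu (xs j w)).
    by apply/funext => w; rewrite /err subrK.
  by apply: measurable_vecD => //; exact: measurable_gbar.
have ax1 : adapted (H j.+1 0%N) (fun w => xs j.+1 w).
  rewrite (_ : (fun w => xs j.+1 w) = (fun w => step p (st_mu th) (st_eta th) (ls j w) (ss j w) (xs j w))).
    exact: measurable_step.
  by apply/funext => w; exact: stage_xS.
have al1 : adapted (H j.+1 0%N) (fun w => ls j.+1 w).
  rewrite (_ : (fun w => ls j.+1 w) = (fun w => ls j w + st_rho th j *: con p (xs j w))).
    by apply: measurable_vecD => //; apply: measurable_vecZ => //; exact: measurable_con.
  by apply/funext => w; exact: stage_lS.
have mx := adapted_measurable (@Hm _ _) ax; have mx1 := adapted_measurable (@Hm _ _) ax1.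
set tau := 1 - alpha.
have [sr mr] := mean_residual_bound tau mx1 mx (stage_feas j.+1) (stage_feas j).
have nZ w : norm2 (tau *: err j w) ^+ 2 = tau ^+ 2 * norm2 (err j w) ^+ 2.
  by rewrite norm2Z exprMn real_normK ?num_real.
have sA : summable1 P (fun w => norm2 (tau *: err j w) ^+ 2).
  rewrite (_ : (fun w => _) = (fun w => tau ^+ 2 * norm2 (err j w) ^+ 2)).
    by apply: summable1Z; [exact: sqr_ge0|exact: se].
  by apply/funext => w; exact: nZ.
have aA : adapted (H j.+1 0%N) (fun w => tau *: err j w) by apply: measurable_vecZ.
have jb : (d <= batch_size j.+1)%N by rewrite /batch_size /= thn.
have [aE sE mE] := @batch_bound _ _ _ _ _ _ P Pu PXi (so p) f X O _ _ nu ro fcont rad _ _ u xi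
    H H' sf j.+1 tau d%:R^-1 (fun w => tau *: err j w) (fun w => xs j.+1 w) (fun w => xs j w) d jK jb aA
    ax1 axn (stage_feas j.+1) (stage_feas j) sA sr.
have eE : err j.+1 = fun w => tau *: err j w + d%:R^-1 *: \sum_(i < d)
     difference (so p) f nu tau (xs j.+1 w) (xs j w) (u j.+1 i w) (xi j.+1 i w).
  by apply/funext => w; exact: errS.
rewrite /stage_err eE; split; [exact: ax1|exact: al1|rewrite (_ : batch_size j.+1 = d); [exact aE|by rewrite /batch_size /= thn]|exact: sE|].
apply: (le_trans mE).
have -> : mean P (fun w => norm2 (tau *: err j w) ^+ 2) = tau ^+ 2 * stage_err j.
  rewrite (_ : (fun w => _) = (fun w => tau ^+ 2 * norm2 (err j w) ^+ 2)).
    by rewrite mean_scale ?sqr_ge0.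
  by apply/funext => w; exact: nZ.
rewrite -addrA lerD2l.
have dn : d%:R != 0 :> R by rewrite pnatr_eq0 -lt0n.
have -> : forall y : R, d%:R * (d%:R^-1 ^+ 2 * d%:R * y) = y by move=> y; field.
rewrite [mean P _]mr -/(stage_dist j).
have [a0 a1] : 0 <= alpha /\ alpha <= 1 by apply/andP.
have t0 : 0 <= tau by rewrite subr_ge0.
have t1 : tau ^+ 2 <= 1 by apply: exprn_ile1 => //; rewrite gerBl.
have t1a : 1 - tau = alpha by rewrite /tau opprB addrC subrK.
have D0 : 0 <= stage_dist j by apply: mean_ge0 => w; exact: sqr_ge0.
rewrite t1a; apply: lerD.
  have D6 : 0 <= 6 * Lf k ^+ 2 * stage_dist j.
    by apply: mulr_ge0 => //; apply: mulr_ge0 => //; exact: sqr_ge0.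
  have := ler_piMl D6 t1; congr (_ <= _); rewrite /stage_dist; ring.
rewrite lerD2r -mulrA ler_pM2l//; apply: ler_piMl => //; exact: noise0.
Qed.

End stage_process.

Section stage_arithmetic.
Context {R : realFieldType}.
Variables (K : nat) (M D E : nat -> R).
Variables (L eps eta alpha sb n0 dd nu2 S2 Delta : R).
Hypotheses (K0 : (0 < K)%N) (L0 : 0 < L) (eta0 : 0 < eta)
  (n00 : 0 < n0) (dd3 : 3 <= dd) (nu20 : 0 <= nu2).
Hypothesis alphaE : alpha = 96 * L ^+ 2 * eta ^+ 2.
Hypothesis alpha1 : alpha <= 1.
Hypothesis hnu : 12 * (nu2 * dd ^+ 3) <= eps ^+ 2 * eta ^+ 2.
Hypothesis hsb : 4 * dd * S2 + eps ^+ 2 / 8 <= 2 * sb.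
Hypothesis heta : 23040 * L ^+ 2 * sb * eta ^+ 2 <= dd * eps ^+ 2.
Hypothesis hn0 : 5 * sb <= 4 * eps ^+ 2 * n0.
Hypothesis hK1 : 108 * Delta <= K%:R * (eta * eps ^+ 2).
Hypothesis hK3 : 1 <= K%:R * (L ^+ 2 * eta ^+ 2).
Let noise := L ^+ 2 * nu2 * dd ^+ 2.
Hypothesis M0 : M 0%N <= n0^-1 * (4 * dd * (S2 + noise)).
Hypothesis MS : forall j, (j.+1 < K)%N -> M j.+1 <=
  (1 - alpha) ^+ 2 * M j + 6 * L ^+ 2 * D j + (12 * noise + 4 * alpha ^+ 2 * (S2 + noise)).
Hypothesis Mge0 : forall j, 0 <= M j.
Hypothesis Dge0 : forall j, 0 <= D j.
Hypothesis EM : forall j, (j < K)%N -> E j <= 2 * M j + 2 * (L ^+ 2 * nu2 * dd ^+ 3).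
Hypothesis DE : (2 * eta)^-1 * \sum_(j < K) D j <= Delta + eta * \sum_(j < K) E j.

Let a0 : 0 < alpha.
Proof. by rewrite alphaE !mulr_gt0 ?exprn_gt0. Qed.

Let bias_le : L ^+ 2 * nu2 * dd ^+ 3 <= eps ^+ 2 / 1152.
Proof.
have h1 : L ^+ 2 * eta ^+ 2 <= 96^-1.
  by rewrite -(ler_pM2l (ltr0n R 96 : 0 < 96)) mulfV// mulrA -alphaE.
have h2 : L ^+ 2 * (12 * (nu2 * dd ^+ 3)) <= L ^+ 2 * (eps ^+ 2 * eta ^+ 2).
  by apply: ler_wpM2l => //; exact: sqr_ge0.
have h3 : eps ^+ 2 * (L ^+ 2 * eta ^+ 2) <= eps ^+ 2 * 96^-1.
  by apply: ler_wpM2l => //; exact: sqr_ge0.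
lra.
Qed.

Let sb_le : 4 * dd * (S2 + noise) <= 2 * sb.
Proof.
have -> : 4 * dd * (S2 + noise) = 4 * dd * S2 + 4 * (L ^+ 2 * nu2 * dd ^+ 3).
  by rewrite /noise; ring.
have e0 : 0 <= eps ^+ 2 by exact: sqr_ge0.
have h := bias_le; have h2 := hsb; lra.
Qed.

Let M0_le : M 0%N <= alpha * (K%:R * eps ^+ 2 / 60).
Proof.
apply: (le_trans M0); rewrite ler_pdivrMl//.
have h : eps ^+ 2 * n0 <= eps ^+ 2 * n0 * (K%:R * (L ^+ 2 * eta ^+ 2)).
  by rewrite ler_peMr// mulr_ge0 ?sqr_ge0// ltW.
have -> : n0 * (alpha * (K%:R * eps ^+ 2 / 60)) =
   8 / 5 * (eps ^+ 2 * n0 * (K%:R * (L ^+ 2 * eta ^+ 2))).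
  by rewrite alphaE; field.
have := sb_le; have := hn0; lra.
Qed.

Let noise_le : 12 * noise <= alpha * (eps ^+ 2 / 288).
Proof.
have dd0 : 0 < dd by apply: lt_le_trans dd3.
have h : nu2 * dd ^+ 2 * 36 <= eps ^+ 2 * eta ^+ 2.
  apply: le_trans hnu.
  have : nu2 * dd ^+ 2 * 3 <= nu2 * dd ^+ 2 * dd.
    by apply: ler_wpM2l => //; rewrite mulr_ge0 ?sqr_ge0.
  lra.
have := ler_wpM2l (sqr_ge0 L) h; rewrite /noise alphaE; lra.
Qed.

Let drift_le : 4 * alpha ^+ 2 * (S2 + noise) <= alpha * (eps ^+ 2 / 120).
Proof.
have dd0 : 0 < dd by apply: lt_le_trans dd3.
rewrite -(ler_pM2l dd0).
have h1 : alpha ^+ 2 * (4 * dd * (S2 + noise)) <= alpha ^+ 2 * (2 * sb).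
  by apply: ler_wpM2l sb_le; exact: sqr_ge0.
have h2 : alpha * (alpha * sb) <= alpha * (dd * eps ^+ 2 / 240).
  by rewrite ler_pM2l// alphaE; move: heta; lra.
lra.
Qed.

Let sum_M_le : alpha * \sum_(j < K) M j <=
  M 0%N + 6 * L ^+ 2 * \sum_(j < K) D j + K%:R * (alpha * (eps ^+ 2 / 288 + eps ^+ 2 / 120)).
Proof.
pose c0 := alpha * (eps ^+ 2 / 288 + eps ^+ 2 / 120); rewrite -/c0.
have c00 : 0 <= c0.
  apply: mulr_ge0; first exact: ltW.
  by apply: addr_ge0; exact: (divr_ge0 (sqr_ge0 _) (ler0n _ _)).
have L60 : 0 <= 6 * L ^+ 2 by rewrite mulr_ge0// sqr_ge0.
have a2 : (1 - alpha) ^+ 2 <= 1 - alpha.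
  have : 0 <= alpha * (1 - alpha) by rewrite mulr_ge0 ?(ltW a0)// subr_ge0.
  lra.
have step j : (j.+1 < K)%N -> M j.+1 <= (1 - alpha) * M j + 6 * L ^+ 2 * D j + c0.
  move=> jK; apply: le_trans (MS jK) _.
  apply: lerD; last by rewrite /c0 [leRHS]mulrDr; exact: lerD noise_le drift_le.
  by rewrite lerD2r; apply: ler_wpM2r.
have gen n : (0 < n <= K)%N -> M n.-1 + alpha * \sum_(j < n.-1) M j <=
    M 0%N + 6 * L ^+ 2 * \sum_(j < n.-1) D j + n%:R * c0.
  case: n => // n; elim: n => [|n ih] /= nK.
    by rewrite !big_ord0 !mulr0 !addr0 mul1r lerDl.
  have {}ih := ih (ltnW nK); rewrite /= in ih.
  rewrite !big_ord_recr /= -[n.+2%:R]natr1.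
  have := step n nK; move: ih; lra.
have := gen K; rewrite K0 leqnn => /(_ isT).
have -> : \sum_(j < K) M j = \sum_(j < K.-1) M j + M K.-1.
  by rewrite -[in LHS](prednK K0) big_ord_recr.
have -> : \sum_(j < K) D j = \sum_(j < K.-1) D j + D K.-1.
  by rewrite -[in LHS](prednK K0) big_ord_recr.
have h1 : alpha * M K.-1 <= M K.-1 by apply: ler_piMl.
have h2 : 0 <= 6 * L ^+ 2 * D K.-1 by rewrite mulr_ge0.
move: h1 h2; rewrite !mulrDr; lra.
Qed.

Lemma stage_sums :
  \sum_(j < K) E j <= K%:R * (9 / 100 * eps ^+ 2) /\
  eta ^- 2 * \sum_(j < K) D j <= K%:R * (2 / 10 * eps ^+ 2).
Proof.
have K0' : 0 < K%:R :> R by rewrite ltr0n.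
set SD := \sum_(j < K) D j; set SE := \sum_(j < K) E j.
pose SM := \sum_(j < K) M j.
pose Q := eta ^- 2 * SD.
have e2 : eta ^+ 2 != 0 by rewrite expf_neq0// gt_eqF.
have SDQ : SD = eta ^+ 2 * Q by rewrite /Q mulrA mulfV ?mul1r.
have hM : SM <= K%:R * eps ^+ 2 / 60 + Q / 16 + K%:R * (eps ^+ 2 / 288 + eps ^+ 2 / 120).
  rewrite -(ler_pM2l a0); have := sum_M_le; have := M0_le; rewrite -/SM -/SD SDQ.
  have -> : 6 * L ^+ 2 * (eta ^+ 2 * Q) = alpha * (Q / 16) by rewrite alphaE; field.
  lra.
have hE : SE <= 2 * SM + K%:R * (2 * (eps ^+ 2 / 1152)).
  have -> : K%:R * (2 * (eps ^+ 2 / 1152)) = \sum_(j < K) (2 * (eps ^+ 2 / 1152)) :> R.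
    by rewrite sumr_const card_ord -[RHS]mulr_natl.
  rewrite /SM mulr_sumr -big_split; apply: ler_sum => j _.
  apply: le_trans (EM (ltn_ord j)) _; rewrite lerD2l ler_pM2l//; exact: bias_le.
have hD : Q / 2 <= K%:R * eps ^+ 2 / 108 + SE.
  rewrite -(ler_pM2l eta0); have := DE; rewrite -/SD -/SE SDQ.
  have -> : (2 * eta)^-1 * (eta ^+ 2 * Q) = eta * (Q / 2) by field; rewrite gt_eqF.
  move: hK1; lra.
have e0 : 0 <= K%:R * eps ^+ 2 by rewrite mulr_ge0 ?sqr_ge0 ?ltW.
split; [|rewrite -/Q]; lra.
Qed.

End stage_arithmetic.

Section stage_conclusion.
Context {R : realType} {d m : nat} {dXi dOm : measure_display}
  {Xi : measurableType dXi} {Om : measurableType dOm}.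
Variables (k : constants R) (p : problem R d m Xi) (PXi : probability Xi R)
  (O : set 'rV[R]_d) (Phiinf DX S2 : R) (th : stage_parameters R).
Variables (P : probability Om R) (Pu : probability (rvec R d) R).
Local Notation X := (feas p).
Local Notation f := (obj p).
Local Notation nu := (st_nu th).
Local Notation K := (st_K th).
Local Notation mu := (st_mu th).
Local Notation eta := (st_eta th).

Hypothesis rp : regular_problem k p O Phiinf.
Hypothesis XD : forall x, X x -> norm2 x <= DX.
Hypothesis ro : regular_oracle PXi (so p) f X O (Lf k) S2 nu.
Hypothesis rad : rademacher Pu.
Hypothesis d3 : (3 <= d)%N.

Variables (eps sb Delta Cbar : R).

Record stage_conditions : Prop := StageConditions {
  sc_n : st_n th = d;
  sc_n0 : (0 < st_n0 th)%N;
  sc_K : (0 < K)%N;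
  sc_rho : forall j, st_rho th j = rho k / K%:R;
  sc_mu : 0 < mu;
  sc_eta : 0 < eta;
  sc_etaL : eta * Lmu m k mu <= 2^-1;
  sc_alpha : st_alpha th = 96 * Lf k ^+ 2 * eta ^+ 2;
  sc_alpha1 : st_alpha th <= 1;
  sc_nu : 12 * (nu ^+ 2 * d%:R ^+ 3) <= eps ^+ 2 * eta ^+ 2;
  sc_S2 : 0 <= S2;
  sc_sb : 4 * d%:R * S2 + eps ^+ 2 / 8 <= 2 * sb;
  sc_etas : 23040 * Lf k ^+ 2 * sb * eta ^+ 2 <= d%:R * eps ^+ 2;
  sc_n0s : 5 * sb <= 4 * eps ^+ 2 * (st_n0 th)%:R;
  sc_KD : 108 * Delta <= K%:R * (eta * eps ^+ 2);
  sc_KC : 5 * Cbar <= K%:R * eps ^+ 2;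
  sc_KL : 1 <= K%:R * (Lf k ^+ 2 * eta ^+ 2);
  sc_gamma : 40 * (Mf k ^+ 2 + Mh k ^+ 2 +
      m%:R ^+ 2 * rho k ^+ 2 * Mbc k ^+ 2 * Mc k ^+ 2) <= beta k ^+ 2 * mu ^+ 2 * eps ^+ 2;
  sc_beta : 8 <= beta k ^+ 2 * mu ^+ 2
}.
Hypothesis sc : stage_conditions.

Variables (u : nat -> nat -> {RV P >-> rvec R d}) (xi : nat -> nat -> {RV P >-> Xi})
  (H H' : nat -> nat -> set (set Om)).
Hypothesis sf : sampling_filtration Pu PXi K (batch_size th) u xi H H'.
Variable x0 : Om -> 'rV[R]_d.
Hypothesis x0_adapted : adapted (H 0 0) x0.
Hypothesis x0_feas : forall w, X (x0 w).
Hypothesis x0_Cbar : mean P (fun w => norm2 (con p (x0 w)) ^+ 2) <= Cbar.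
Hypothesis x0_Delta : gap k + 2 * m%:R * rho k * Mbc k ^+ 2 +
  mu / 2 * mean P (fun w => norm2 (con p (x0 w)) ^+ 2) <= Delta.

Local Notation state := (stage_state p th u xi x0).
Local Notation xs j w := (st_x (state w j)).
Local Notation ss j w := (st_s (state w j)).
Local Notation ls j w := (st_lambda (state w j)).

Hypothesis qual : {ae P, forall w j, (j < K)%N ->
  beta k * norm2 (con p (xs j.+1 w)) <=
  dist2 (con_gradT p (xs j.+1 w) (con p (xs j.+1 w)))
    [set - v | v in normal_cone X (xs j.+1 w)]}.

Definition stage_multiplier j w : 'rV[R]_m := ls j w + mu *: con p (xs j w).

Definition stage_gradmap (eta' : R) j w : 'rV[R]_d :=
  gradient_mapping X (reg p) eta' (xs j w)
    (grad f (xs j w) + con_gradT p (xs j w) (stage_multiplier j w)).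

Let d0 : (0 < d)%N. Proof. exact: leq_trans d3. Qed.

Let alpha01 : 0 <= st_alpha th <= 1.
Proof.
rewrite (sc_alpha1 sc) andbT (sc_alpha sc) mulr_ge0 ?sqr_ge0//.
by rewrite mulr_ge0 ?sqr_ge0.
Qed.

Let ind j (jK : (j < K)%N) := stage_induction rp XD ro rad d0 (sc_n sc) (sc_n0 sc)
  (sc_eta sc) alpha01 (sc_S2 sc) sf x0_adapted x0_feas jK.

Let xfeas j w : X (xs j w).
Proof. exact: (stage_feas th rp). Qed.

Let Hm i l : H i l `<=` measurable.
Proof. exact: (sf_meas sf). Qed.

Let mxs j : (j < K)%N -> measurable_fun setT (fun w => xs j w : rvec R d).
Proof. by move=> /ind[ax _ _ _ _]; exact: adapted_measurable ax. Qed.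

Let mls j : (j < K)%N -> measurable_fun setT (fun w => ls j w : rvec R m).
Proof. by move=> /ind[_ al _ _ _]; exact: adapted_measurable al. Qed.

Let fcont : continuous f.
Proof. by move=> x; apply: differentiable_continuous; exact: (rp_fdiff rp). Qed.

Let mss j : (j < K)%N -> measurable_fun setT (fun w => ss j w : rvec R d).
Proof.
move=> jK; have [_ _ ae _ _] := ind jK.
have -> : (fun w => ss j w) = (fun w => err p th u xi x0 j w + gbar f nu (xs j w)).
  by apply/funext => w; rewrite /err subrK.
apply: measurable_vecD; first exact: adapted_measurable ae.
by apply: measurable_gbar => //; exact: mxs.
Qed.

Let mxs1 j : (j < K)%N -> measurable_fun setT (fun w => xs j.+1 w : rvec R d).
Proof.
move=> jK.
have -> : (fun w => xs j.+1 w) = (fun w => step p mu eta (ls j w) (ss j w) (xs j w)).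
  by apply/funext => w; exact: stage_xS.
by apply: (measurable_step rp _ (sc_eta sc)); [exact: mls|exact: mss|exact: mxs].
Qed.

Lemma summable_con (Y : Om -> 'rV[R]_d) : measurable_fun setT (Y : Om -> rvec R d) ->
  (forall w, X (Y w)) -> summable1 P (fun w => norm2 (con p (Y w)) ^+ 2).
Proof.
move=> mY XY; apply: (@summable1_le _ _ _ _ _ (fun=> m%:R * Mbc k ^+ 2)).
- by apply: measurable_funX; apply: measurable_norm2; exact: (measurable_con rp).
- by move=> w; rewrite sqr_ge0 (con_sqr_bound rp).
- by apply: summable1_cst; rewrite mulr_ge0// sqr_ge0.
Qed.

Definition stage_grad_err j w : 'rV[R]_d := ss j w - grad f (xs j w).

Let bias := Lf k ^+ 2 * nu ^+ 2 * d%:R ^+ 3.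

Let bias0 : 0 <= bias.
Proof. by apply: mulr_ge0; last exact: exprn_ge0; apply: mulr_ge0; exact: sqr_ge0. Qed.

Let grad_err_le j w : norm2 (stage_grad_err j w) ^+ 2 <=
  2 * norm2 (err p th u xi x0 j w) ^+ 2 + 2 * bias.
Proof.
have -> : stage_grad_err j w = err p th u xi x0 j w + (gbar f nu (xs j w) - grad f (xs j w)).
  by rewrite /err addrA subrK.
apply: le_trans (sqr_norm2D _ _) _; rewrite lerD2l ler_pM2l//.
apply: (gbar_bias ro (rp_fdiff rp) (xfeas j w)) => y z Oy Oz.
by have [] := rp_obj rp Oy Oz.
Qed.

Let summable_grad_err j : (j < K)%N ->
  summable1 P (fun w => norm2 (stage_grad_err j w) ^+ 2).
Proof.
move=> jK; have [_ _ _ se _] := ind jK.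
apply: (@summable1_le _ _ _ _ _ (fun w => 2 * norm2 (err p th u xi x0 j w) ^+ 2 + 2 * bias)).
- apply: measurable_funX; apply: measurable_norm2; apply: measurable_vecB; first exact: mss.
  by apply: measurable_vec_continuous; [exact: (rp_fcont rp)|exact: mxs].
- by move=> w; rewrite sqr_ge0 grad_err_le.
- by apply: summable1D; [exact: summable1Z|apply: summable1_cst; rewrite mulr_ge0].
Qed.

Let summable_step j : (j < K)%N -> summable1 P (fun w => norm2 (xs j.+1 w - xs j w) ^+ 2).
Proof.
by move=> jK; apply: (summable_dist P XD); [exact: mxs1|exact: mxs|exact: xfeas|exact: xfeas].
Qed.

Let E j := mean P (fun w => norm2 (stage_grad_err j w) ^+ 2).
Let D j := stage_dist p th u xi x0 j.

Let lam_bound j i w : (j <= K)%N -> `|ls j w ord0 i| <= rho k * Mbc k.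
Proof.
move=> jK.
have [_ + _] := stage_decrease rp (sc_mu sc) (sc_eta sc) (sc_etaL sc) (sc_K sc)
  (x := fun j => xs j w) (s := fun j => ss j w) (l := fun j => ls j w) (x0_feas w) erefl
  (fun j => stage_xS p th u xi x0 w j)
  (fun j => etrans (stage_lS p th u xi x0 w j) (congr1 (fun t => ls j w + t *: con p (xs j w)) (sc_rho sc j))).
exact.
Qed.

Let sum_dist : (2 * eta)^-1 * \sum_(j < K) D j <= Delta + eta * \sum_(j < K) E j.
Proof.
have e0 := sc_eta sc.
have ie0 : 0 <= (2 * eta)^-1 by rewrite invr_ge0 mulr_ge0 ?ltW.
have mx0 : measurable_fun setT (x0 : Om -> rvec R d) by exact: adapted_measurable x0_adapted.
have sc0 := summable_con mx0 x0_feas.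
have sD (j : 'I_K) : summable1 P (fun w => (2 * eta)^-1 * norm2 (xs j.+1 w - xs j w) ^+ 2).
  by apply: summable1Z => //; exact: summable_step.
have sE (j : 'I_K) := summable_grad_err (ltn_ord j).
pose B0 := gap k + 2 * m%:R * rho k * Mbc k ^+ 2.
have B00 : 0 <= B0.
  have [[Lf0 Mf0 Mh0] [Mc0 Mbc0 Lc0] [sg0 be0 rh0]] := rp_pos rp.
  have [x Xx] := rp_feas0 rp.
  have gp : 0 <= gap k by have := rp_lower rp Xx; have := rp_upper rp Xx; lra.
  apply: addr_ge0 => //; apply: mulr_ge0; last exact: sqr_ge0.
  by apply: mulr_ge0; [apply: mulr_ge0|exact: ltW].
have m20 : 0 <= mu / 2 by apply: divr_ge0 => //; exact: ltW (sc_mu sc).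
have sR1 : summable1 P (fun w => B0 + mu / 2 * norm2 (con p (x0 w)) ^+ 2).
  by apply: summable1D; [exact: summable1_cst|exact: summable1Z].
have sR2 : summable1 P (fun w => eta * \sum_(j < K) norm2 (stage_grad_err j w) ^+ 2).
  by apply: summable1Z; [exact: ltW|exact: summable1_sum].
have := @mean_le _ _ _ P (fun w => \sum_(j < K) (2 * eta)^-1 * norm2 (xs j.+1 w - xs j w) ^+ 2)
  (fun w => (B0 + mu / 2 * norm2 (con p (x0 w)) ^+ 2) +
     eta * \sum_(j < K) norm2 (stage_grad_err j w) ^+ 2)
  (summable1_sum _ sD) (summable1D sR1 sR2).
have pw w : \sum_(j < K) (2 * eta)^-1 * norm2 (xs j.+1 w - xs j w) ^+ 2 <=
   (B0 + mu / 2 * norm2 (con p (x0 w)) ^+ 2) + eta * \sum_(j < K) norm2 (stage_grad_err j w) ^+ 2.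
  have [_ _ +] := stage_decrease rp (sc_mu sc) (sc_eta sc) (sc_etaL sc) (sc_K sc)
    (x := fun j => xs j w) (s := fun j => ss j w) (l := fun j => ls j w) (x0_feas w) erefl
    (fun j => stage_xS p th u xi x0 w j)
    (fun j => etrans (stage_lS p th u xi x0 w j) (congr1 (fun t => ls j w + t *: con p (xs j w)) (sc_rho sc j))).
  exact.
move=> /(_ pw).
rewrite (mean_sum _ sD) (meanD sR1 sR2) meanD; [|exact: summable1_cst|exact: summable1Z].
rewrite mean_cst mean_scale// mean_scale; [|exact: ltW|exact: summable1_sum].
rewrite (mean_sum _ sE) => h.
apply: le_trans (le_trans h _); last by rewrite lerD2r; exact: x0_Delta.
rewrite mulr_sumr le_eqVlt; apply/orP; left; apply/eqP; apply: eq_bigr => j _.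
by rewrite mean_scale//; exact: summable_step.
Qed.

Lemma stage_error_sums :
  \sum_(j < K) E j <= K%:R * (9 / 100 * eps ^+ 2) /\
  eta ^- 2 * \sum_(j < K) D j <= K%:R * (2 / 10 * eps ^+ 2).
Proof.
have [[Lf0 Mf0 Mh0] _ _] := rp_pos rp.
apply: (@stage_sums R K (stage_err p th u xi x0) D E (Lf k) eps eta (st_alpha th) sb
  (st_n0 th)%:R d%:R (nu ^+ 2) S2 Delta (sc_K sc) Lf0 (sc_eta sc)).
- by rewrite ltr0n; exact: (sc_n0 sc).
- by rewrite (ler_nat R 3 d).
- exact: sqr_ge0.
- exact: (sc_alpha sc).
- exact: (sc_alpha1 sc).
- exact: (sc_nu sc).
- exact: (sc_sb sc).
- exact: (sc_etas sc).
- exact: (sc_n0s sc).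
- exact: (sc_KD sc).
- exact: (sc_KL sc).
- by have [_ _ _ _ +] := ind (sc_K sc).
- by move=> j jK; have [_ _ _ _ +] := ind jK.
- by move=> j; apply: mean_ge0 => w; exact: sqr_ge0.
- by move=> j; apply: mean_ge0 => w; exact: sqr_ge0.
- move=> j jK; have [_ _ _ se _] := ind jK.
  have s1 : summable1 P (fun w => 2 * norm2 (err p th u xi x0 j w) ^+ 2) by exact: summable1Z.
  have s2 : summable1 P (fun=> 2 * bias) by apply: summable1_cst; rewrite mulr_ge0.
  apply: le_trans (mean_le (summable_grad_err jK) (summable1D s1 s2) _) _.
    by move=> w; exact: grad_err_le.
  by rewrite meanD// mean_cst mean_scale.
- exact: sum_dist.
Qed.

Lemma stage_feasibility :
  \sum_(j < K) mean P (fun w => norm2 (con p (xs j w)) ^+ 2) <= K%:R * eps ^+ 2.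
Proof.
have [hE hD] := stage_error_sums.
pose b := beta k ^+ 2 * mu ^+ 2.
have b8 : 8 <= b := sc_beta sc.
have b0 : 0 < b by apply: lt_le_trans b8.
pose C j := mean P (fun w => norm2 (con p (xs j w)) ^+ 2).
pose G0 := Mf k ^+ 2 + Mh k ^+ 2 + m%:R ^+ 2 * rho k ^+ 2 * Mbc k ^+ 2 * Mc k ^+ 2.
have G00 : 0 <= G0.
  apply: addr_ge0; first by apply: addr_ge0; exact: sqr_ge0.
  by do 3 (apply: mulr_ge0; last exact: sqr_ge0); exact: sqr_ge0.
have ie0 : 0 <= 9 / 4 * eta ^- 2.
  by apply: mulr_ge0; [exact: divr_ge0|rewrite invr_ge0; exact: sqr_ge0].
have CS j : (j < K)%N -> b * C j.+1 <= 5 * (G0 + E j + 9 / 4 * (eta ^- 2 * D j)).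
  move=> jK.
  have sC : summable1 P (fun w => norm2 (con p (xs j.+1 w)) ^+ 2).
    by apply: summable_con; [exact: mxs1|exact: xfeas].
  have s1 : summable1 P (fun w => norm2 (stage_grad_err j w) ^+ 2) := summable_grad_err jK.
  have s2 : summable1 P (fun w => 9 / 4 * eta ^- 2 * norm2 (xs j.+1 w - xs j w) ^+ 2).
    exact: (summable1Z ie0 (summable_step jK)).
  have s0 : summable1 P (fun=> G0) by exact: summable1_cst.
  have s01 := summable1D s0 s1.
  have s012 := summable1D s01 s2.
  have s5 : summable1 P (fun w => 5 * (G0 + norm2 (stage_grad_err j w) ^+ 2 +
      9 / 4 * eta ^- 2 * norm2 (xs j.+1 w - xs j w) ^+ 2)) by exact: summable1Z.
  have := mean_ae_le (summable1Z (ltW b0) sC) s5.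
  rewrite (mean_scale (ltW b0) sC) (mean_scale _ s012)// (meanD s01 s2) (meanD s0 s1) mean_cst.
  rewrite (mean_scale ie0 (summable_step jK)).
  rewrite -/(E j) -/(D j) mulrA; apply.
  apply: filterS qual => w qw.
  have lb i : `|ls j w ord0 i| <= rho k * Mbc k by exact: lam_bound (ltnW jK).
  have := step_infeasibility rp (sc_mu sc) (sc_eta sc) (sc_etaL sc) (s := ss j w) (xfeas j w) lb.
  rewrite -(stage_xS p th u xi x0) => /(_ (qw j jK)) h.
  by rewrite -mulrA; exact: h.
have SC : b * \sum_(j < K) C j.+1 <= K%:R * (b * eps ^+ 2 / 8) + 27 / 10 * (K%:R * eps ^+ 2).
  rewrite mulr_sumr; apply: (@le_trans _ _ (\sum_(j < K) 5 * (G0 + E j + 9 / 4 * (eta ^- 2 * D j)))).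
    by apply: ler_sum => j _; exact: CS.
  have -> : \sum_(j < K) 5 * (G0 + E j + 9 / 4 * (eta ^- 2 * D j)) =
     5 * (K%:R * G0 + \sum_(j < K) E j + 9 / 4 * (eta ^- 2 * \sum_(j < K) D j)).
    rewrite -mulr_sumr; congr (_ * _).
    have aux (g : R) (a q : nat -> R) : \sum_(j < K) (g + a j + 9 / 4 * (eta ^- 2 * q j)) =
        K%:R * g + \sum_(j < K) a j + 9 / 4 * (eta ^- 2 * \sum_(j < K) q j).
      by rewrite big_split /= big_split /= sumr_const card_ord -!mulr_sumr -[g *+ _]mulr_natl.
    exact: aux.
  have hG : K%:R * (40 * G0) <= K%:R * (b * eps ^+ 2).
    by apply: ler_wpM2l => //; exact: (sc_gamma sc).
  move: hE hD hG; move: (eta ^- 2 * _) => q.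
  move: (\sum_(j < K) E j) => sE; move: (eps ^+ 2) (b) (G0) (K%:R) => e2 b' G' K' h1 h2 h3.
  lra.
have C0 j : 0 <= C j by apply: mean_ge0 => w; exact: sqr_ge0.
have Ke0 : 0 <= K%:R * eps ^+ 2 by apply: mulr_ge0 => //; exact: sqr_ge0.
have SC' : \sum_(j < K) C j.+1 <= 1 / 2 * (K%:R * eps ^+ 2).
  rewrite -(ler_pM2l b0); apply: (le_trans SC).
  have : 8 * (K%:R * eps ^+ 2) <= b * (K%:R * eps ^+ 2) by apply: ler_wpM2r.
  have -> : K%:R * (b * eps ^+ 2 / 8) = 8^-1 * (b * (K%:R * eps ^+ 2)) by ring.
  have -> : b * (1 / 2 * (K%:R * eps ^+ 2)) = 1 / 2 * (b * (K%:R * eps ^+ 2)) by ring.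
  have aux (y z : R) : 0 <= z -> 8 * z <= y -> 8^-1 * y + 27 / 10 * z <= 1 / 2 * y by lra.
  exact: aux.
have SK : \sum_(j < K) C j <= C 0%N + \sum_(j < K) C j.+1.
  case: (K) (sc_K sc) => // n _.
  rewrite big_ord_recl [X in _ <= _ + X]big_ord_recr /= lerD2l lerDl; exact: C0.
apply: (le_trans SK).
have h0 : C 0%N <= Cbar by exact: x0_Cbar.
have := sc_KC sc; move: h0 SC' Ke0; move: (\sum_(j < K) _) => y; lra.
Qed.

Lemma measurable_gradmap {d1} {T : measurableType d1} (Y : T -> rvec R d)
    (l : T -> rvec R m) : measurable_fun setT Y -> measurable_fun setT l ->
  measurable_fun setT (fun w => gradient_mapping X (reg p) eta (Y w)
    (grad f (Y w) + con_gradT p (Y w) (l w)) : rvec R d).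
Proof.
move=> mY ml; apply: measurable_vecZ => //; apply: measurable_vecB => //.
apply: (measurable_prox rp (sc_eta sc)) => //; apply: measurable_vecD.
  by apply: measurable_vec_continuous => //; exact: (rp_fcont rp).
exact: (measurable_con_gradT rp).
Qed.

Lemma stage_adapted j : (j < K)%N ->
  adapted (H j 0%N) (fun w => xs j w) /\ adapted (H j 0%N) (stage_multiplier j).
Proof.
move=> /ind[ax al _ _ _]; split => //; apply: measurable_vecD => //.
by apply: measurable_vecZ => //; exact: (measurable_con rp).
Qed.

Lemma stage_gradmap_summable j : (j < K)%N ->
  summable1 P (fun w => norm2 (stage_gradmap eta j w) ^+ 2) /\
  mean P (fun w => norm2 (stage_gradmap eta j w) ^+ 2) <= 2 * (eta ^- 2 * D j) + 2 * E j.
Proof.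
move=> jK.
have [ax al] := stage_adapted jK.
have ie0 : 0 <= 2 * eta ^- 2 by apply: mulr_ge0 => //; rewrite invr_ge0; exact: sqr_ge0.
have s1 := summable1Z ie0 (summable_step jK).
have s2 := summable1Z (ler0n R 2) (summable_grad_err jK).
have le w : norm2 (stage_gradmap eta j w) ^+ 2 <=
   2 * eta ^- 2 * norm2 (xs j.+1 w - xs j w) ^+ 2 + 2 * norm2 (stage_grad_err j w) ^+ 2.
  have := gradient_mapping_bound rp mu (sc_eta sc) (ls j w) (ss j w) (xfeas j w).
  by rewrite -(stage_xS p th u xi x0) mulrA.
have sg : summable1 P (fun w => norm2 (stage_gradmap eta j w) ^+ 2).
  apply: summable1_le (summable1D s1 s2); last by move=> w; rewrite sqr_ge0 le.
  apply: measurable_funX; apply: measurable_norm2.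
  by apply: measurable_gradmap; [exact: mxs|exact: (adapted_measurable _ al)].
split => //; apply: le_trans (mean_le sg (summable1D s1 s2) le) _.
rewrite meanD// (mean_scale ie0); last exact: summable_step.
rewrite (mean_scale (ler0n R 2)); last exact: summable_grad_err.
by rewrite mulrA.
Qed.

Lemma stage_stationarity :
  \sum_(j < K) mean P (fun w => norm2 (stage_gradmap eta j w) ^+ 2) <= K%:R * eps ^+ 2.
Proof.
have [hE hD] := stage_error_sums.
apply: (@le_trans _ _ (\sum_(j < K) (2 * (eta ^- 2 * D j) + 2 * E j))).
  by apply: ler_sum => j _; have [] := stage_gradmap_summable (ltn_ord j).
rewrite big_split /= -!mulr_sumr.
have Ke0 : 0 <= K%:R * eps ^+ 2 by apply: mulr_ge0 => //; exact: sqr_ge0.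
move: hE hD; move: (eta ^- 2 * _) => q; move: (\sum_(j < K) _) => y; lra.
Qed.

End stage_conclusion.

(** * Composition of the stages *)

Section random_index.
Context {R : realType} {dOm : measure_display} {Om : measurableType dOm}.
Variables (P : probability Om R) (G : set (set Om)) (r : {RV P >-> nat}) (K : nat).
Hypothesis Gm : G `<=` measurable.
Hypothesis K0 : (0 < K)%N.
Hypothesis indr : forall A B, (<<s G >> : set (set Om)) A -> measurable B ->
  (P (A `&` r @^-1` B) = P A * P (r @^-1` B))%E.
Hypothesis lawr : forall k, (k < K)%N -> distribution P r [set k] = (K%:R^-1)%:E.

(* The scheme leaves [r] unconstrained on a null set; this version of it is
   always a legal index. *)
Definition clip (w : Om) : nat := if (r w < K)%N then r w else 0%N.

Lemma clip_lt w : (clip w < K)%N.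
Proof. by rewrite /clip; case: ifP. Qed.

Lemma clip_ae : {ae P, forall w, clip w = r w}.
Proof.
have mge : measurable (r @^-1` [set i | (K <= i)%N]).
  by rewrite -[X in measurable X]setTI; apply: measurable_funP.
have mlt : measurable (r @^-1` `I_K).
  by rewrite -[X in measurable X]setTI; apply: measurable_funP.
have Plt : P (r @^-1` `I_K) = 1%E.
  have -> : r @^-1` `I_K = \big[setU/set0]_(i < K) (r @^-1` [set (i : nat)]).
    rewrite -(bigcup_mkord K (fun i => r @^-1` [set i])).
    apply/seteqP; split => w /=; first by move=> h; exists (r w).
    by move=> [i /= iK ->].
  have mU (i : nat) : measurable (r @^-1` [set i]).
    by rewrite -[X in measurable X]setTI; apply: measurable_funP.
  have tU : trivIset setT (fun i : nat => r @^-1` [set i]).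
    by apply/trivIsetP => i j _ _ ij; apply/seteqP; split => w //= [-> ]; move/eqP: ij.
  apply: (etrans (measure_bigsetU P mU tU K)).
  rewrite (eq_bigr (fun=> (K%:R^-1)%:E)); last by move=> i _; exact: (lawr (ltn_ord i)).
  rewrite sumEFin sumr_const card_ord -[_ *+ _]mulr_natr mulVf//.
  by rewrite pnatr_eq0 -lt0n.
exists (r @^-1` [set i | (K <= i)%N]); split => //; last first.
  by move=> w /=; rewrite /clip; case: ltnP.
have -> : r @^-1` [set i | (K <= i)%N] = ~` (r @^-1` `I_K).
  by apply/seteqP; split => w /=; [rewrite leqNgt => /negP|move/negP; rewrite -leqNgt].
by have := probability_setC P mlt; rewrite Plt subee.
Qed.

Let measurable_slice {d'} {T : measurableType d'} (Z : T -> nat) k :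
  measurable_fun setT Z -> measurable_fun setT (fun w => (Z w == k)%:R : R).
Proof.
move=> mZ; have mg : measurable_fun setT (fun i : nat => (i == k)%:R : R) by [].
exact: measurableT_comp mg mZ.
Qed.

Let measurable_clip {d'} {T : measurableType d'} (Z : T -> nat) :
  measurable_fun setT Z -> measurable_fun setT (fun w => if (Z w < K)%N then Z w else 0%N).
Proof.
move=> mZ.
have mg : measurable_fun setT (fun i => if (i < K)%N then i else 0%N) by [].
exact: measurableT_comp mg mZ.
Qed.

Lemma mean_slice (Y : Om -> R) k : (k < K)%N ->
  measurable_fun setT (Y : g_sigma_algebraType G -> R) -> summable1 P Y ->
  summable1 P (fun w => Y w * (r w == k)%:R) /\
  mean P (fun w => Y w * (r w == k)%:R) = K%:R^-1 * mean P Y.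
Proof.
move=> kK aY sY; have [mY Y0 _] := sY.
have mr : measurable_fun setT (fun w => (r w == k)%:R : R).
  exact: measurable_slice.
have sS : summable1 P (fun w => Y w * (r w == k)%:R).
  apply: summable1_le sY; first exact: measurable_funM.
  by move=> w; case: (r w == k); rewrite ?mulr1 ?mulr0 ?lexx ?Y0.
split => //; apply: EFin_inj; rewrite -summable1_mean//.
pose phi (z : g_sigma_algebraType G * nat) : \bar R := (Y z.1 * (z.2 == k)%:R)%:E.
have mphi : measurable_fun setT phi.
  apply/measurable_EFinP; apply: measurable_funM.
    exact: measurableT_comp aY measurable_fst.
  exact: measurable_slice measurable_snd.
have phi0 z : (0 <= phi z)%E by rewrite lee_fin mulr_ge0.
have := @freezing _ _ _ _ _ _ _ P (idfun : Om -> g_sigma_algebraType G) r phi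
  (measurable_idfun_sub Gm) (fun A B mA mB => indr mA mB) mphi phi0.
move=> /= ->.
have inner w : (\int[distribution P r]_z phi (w, z) = (K%:R^-1 * Y w)%:E)%E.
  rewrite (_ : (\int[distribution P r]_z phi (w, z) =
    \int[distribution P r]_z ((Y w)%:E * (\1_[set k] z)%:E))%E); last first.
    by apply: eq_integral => z _; rewrite /phi /= indicE in_set1 EFinM.
  rewrite ge0_integralZl_EFin//.
  rewrite integral_indic// setIT.
  apply: (etrans (congr1 (fun t => ((Y w)%:E * t)%E) (lawr kK))).
  by rewrite -EFinM mulrC.
under eq_integral do rewrite inner.
have Ki0 : 0 <= K%:R^-1 :> R by rewrite invr_ge0.
by rewrite summable1_mean ?mean_scale//; exact: summable1Z.
Qed.

Lemma random_index (Y : nat -> Om -> R) :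
  (forall k, (k < K)%N -> measurable_fun setT (Y k : g_sigma_algebraType G -> R)) ->
  (forall k, (k < K)%N -> summable1 P (Y k)) ->
  summable1 P (fun w => Y (clip w) w) /\
  mean P (fun w => Y (clip w) w) <= K%:R^-1 * \sum_(k < K) mean P (Y k).
Proof.
move=> aY sY.
have sl (k : 'I_K) := mean_slice (ltn_ord k) (aY k (ltn_ord k)) (sY k (ltn_ord k)).
have sS := summable1_sum (index_enum _) (fun k => (sl k).1).
have mc : measurable_fun setT clip.
  exact: measurable_clip.
have sumE w : Y (clip w) w = \sum_(k < K) Y k w * (clip w == k)%:R.
  rewrite (bigD1 (Ordinal (clip_lt w)))//= eqxx mulr1 big1 ?addr0// => i ic.
  by rewrite eq_sym (negbTE (_ : val i != _)) ?mulr0.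
have mS : measurable_fun setT (fun w => Y (clip w) w).
  under eq_fun do rewrite sumE.
  apply: measurable_sum => k; apply: measurable_funM; first by have [] := sY k (ltn_ord k).
  exact: measurable_slice.
have sY' : summable1 P (fun w => Y (clip w) w).
  apply: (@summable1_le _ _ _ _ _ (fun w => \sum_(k < K) Y k w)) => //; last first.
    by apply: summable1_sum => k; exact: sY.
  move=> w; apply/andP; split; first by have [_ + _] := sY _ (clip_lt w); apply.
  rewrite (bigD1 (Ordinal (clip_lt w)))//= lerDl sumr_ge0// => k _.
  by have [_ + _] := sY _ (ltn_ord k); apply.
split => //.
apply: (@le_trans _ _ (mean P (fun w => \sum_(k < K) Y k w * (r w == k)%:R))).
  apply: mean_ae_le => //; apply: filterS clip_ae => w cw.
  by rewrite sumE cw.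
rewrite mean_sum; last by move=> k; exact: (sl k).1.
by rewrite mulr_sumr; apply: ler_sum => k _; rewrite (sl k).2.
Qed.

Lemma measurable_random_index {n} (Y : nat -> Om -> 'rV[R]_n) (G' : set (set Om)) :
  G `<=` G' -> generated_by r `<=` G' ->
  (forall k, (k < K)%N -> adapted G (Y k)) -> adapted G' (fun w => Y (clip w) w).
Proof.
move=> GG' rG' aY.
have mr : measurable_fun setT (r : g_sigma_algebraType G' -> nat).
  move=> _ B mB; rewrite setTI; apply: sub_sigma_algebra; apply: rG'.
  by exists B => //; rewrite setTI.
have mc : measurable_fun setT (clip : g_sigma_algebraType G' -> nat).
  exact: measurable_clip mr.
have sumE w : Y (clip w) w = \sum_(k < K) (clip w == k)%:R *: Y k w.
  rewrite (bigD1 (Ordinal (clip_lt w)))//= eqxx scale1r big1 ?addr0// => i ic.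
  by rewrite eq_sym (negbTE (_ : val i != _)) ?scale0r.
rewrite /adapted; under eq_fun do rewrite sumE.
apply: measurable_vec_sum => k; apply: measurable_vecZ.
  exact: measurable_slice.
exact: adapted_sub GG' (aY k (ltn_ord k)).
Qed.

End random_index.

Section histories.
Context {R : realType} {d : nat} {dXi dOm : measure_display}
  {Xi : measurableType dXi} {Om : measurableType dOm}.
Variables (P : probability Om R) (Pu : probability (rvec R d) R)
  (PXi : probability Xi R) (run : nat -> Prop) (th : nat -> stage_parameters R)
  (u : nat -> nat -> nat -> {RV P >-> rvec R d})
  (xi : nat -> nat -> nat -> {RV P >-> Xi}) (r : nat -> {RV P >-> nat}).
Hypothesis scheme : sampling_scheme Pu PXi run th u xi r.

Lemma generated_byT {d1 d2} {T : measurableType d1} {T' : measurableType d2}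
  (Z : T -> T') : generated_by Z setT.
Proof. by exists setT => //; rewrite preimage_setT setIT. Qed.

Lemma generated_byI {d1 d2} {T : measurableType d1} {T' : measurableType d2}
  (Z : T -> T') : setI_closed (generated_by Z).
Proof.
move=> _ _ [A mA <-] [B mB <-]; exists (A `&` B); first exact: measurableI.
by rewrite preimage_setI !setTI.
Qed.

Let events := source_events u xi r.

Lemma source_eventsT i : events i setT.
Proof. by case: i => [[[[s j] l]|[[s j] l]]|s]; exact: generated_byT. Qed.

Lemma source_eventsI i : setI_closed (events i).
Proof. by case: i => [[[[s j] l]|[[s j] l]]|s]; exact: generated_byI. Qed.

Lemma source_events_measurable i : events i `<=` measurable.
Proof.
by case: i => [[[[s j] l]|[[s j] l]]|s] _ [B mB <-];
  apply: measurable_funP.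
Qed.

Definition lex3 (a b : nat * nat * nat) : Prop :=
  let: (s, j, l) := a in let: (s', j', l') := b in
  (s < s')%N \/ (s = s' /\ ((j < j')%N \/ (j = j' /\ (l < l')%N))).

(* Sources are ordered by stage, iteration and position in the batch; the output
   index of a stage comes after all its samples. *)
Definition before (s j l : nat) : set source := fun i =>
  source_used run th i /\
  match i with
  | inl (inl a) | inl (inr a) => lex3 a (s, j, l)
  | inr s' => (s' < s)%N
  end.

Definition past (s j l : nat) := history events (before s j l).

Definition past_u (s j l : nat) :=
  history events (before s j l `|` [set inl (inl (s, j, l))]).

Lemma history_sub (D D' : set source) :
  D `<=` D' -> history events D `<=` history events D'.
Proof. by move=> DD' A [i Di iA]; exists i => //; exact: DD'. Qed.

Lemma history_sampling (s : nat) : run s ->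
  sampling_filtration Pu PXi (st_K (th s)) (batch_size (th s)) (u s) (xi s)
    (past s) (past_u s).
Proof.
have [lawu lawxi _ ind] := scheme.
move=> rs.
have drawn j l : (j < st_K (th s))%N -> (l < batch_size (th s) j)%N ->
  sample_drawn run th s j l by [].
split.
- by move=> j l; exact: (history_measurable source_events_measurable).
- by move=> j l; exact: (history_measurable source_events_measurable).
- by move=> j l _ _; apply: history_sub; exact: subsetUl.
- move=> j l jK lb; apply: history_sub => i [[ui bi]|->]; split => //.
  + case: i {ui} bi => [[[[s' j'] l']|[[s' j'] l']]|s'] //=; lia.
  + by right; split => //; right.
- move=> j jK; apply: history_sub => i [ui bi]; split => //.
  case: i ui bi => [[[[s' j'] l']|[[s' j'] l']]|s'] //= _; lia.
- move=> j l jK lb _ B mB; apply: sub_sigma_algebra.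
  by exists (inl (inl (s, j, l))); [right|exists B].
- move=> j l jK lb _ B mB; apply: sub_sigma_algebra.
  exists (inl (inr (s, j, l))); last by exists B.
  by split; [exact: drawn|right; split => //; right].
- move=> j l A B jK lb sA mB.
  apply: (independent_history source_eventsT source_eventsI source_events_measurable
    (i := inl (inl (s, j, l))) ind _ _ _ sA).
  + by move=> i [].
  + exact: drawn.
  + by move=> [_ /=]; lia.
  + by exists B => //; rewrite setTI.
- move=> j l A B jK lb sA mB.
  apply: (independent_history source_eventsT source_eventsI source_events_measurable
    (i := inl (inr (s, j, l))) ind _ _ _ sA).
  + move=> i [[] //|->]; exact: drawn.
  + exact: drawn.
  + by move=> [[_ /=]|//]; lia.
  + by exists B => //; rewrite setTI.
- by move=> j l jK lb A mA; apply: lawu => //; exact: drawn.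
- by move=> j l jK lb A mA; apply: lawxi => //; exact: drawn.
Qed.

Lemma past_measurable s j l : past s j l `<=` measurable.
Proof. exact: (history_measurable source_events_measurable). Qed.

Lemma past_batch s j i' : (j <= i')%N -> past s j 0 `<=` past s i' 0.
Proof.
move=> ji'; apply: history_sub => i [ui bi]; split => //.
by case: i ui bi => [[[[s' j'] l']|[[s' j'] l']]|s'] //= _; lia.
Qed.

Lemma past_next s j : past s j 0 `<=` past s.+1 0 0.
Proof.
apply: history_sub => i [ui bi]; split => //.
by case: i ui bi => [[[[s' j'] l']|[[s' j'] l']]|s'] //= _; lia.
Qed.

Lemma past_index s : run s -> generated_by (r s) `<=` past s.+1 0 0.
Proof. by move=> rs A gA; exists (inr s) => //; split => /=. Qed.

Lemma index_independent s j A B : run s ->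
  (<<s past s j 0 >> : set (set Om)) A -> measurable B ->
  (P (A `&` r s @^-1` B) = P A * P (r s @^-1` B))%E.
Proof.
have [_ _ _ ind] := scheme.
move=> rs sA mB.
apply: (independent_history source_eventsT source_eventsI source_events_measurable
    (i := inr s) ind _ _ _ sA).
- by move=> i [].
- exact: rs.
- by move=> [_ /=]; rewrite ltnn.
- by exists B => //; rewrite setTI.
Qed.

End histories.

Section standing_problem.
Context {R : realType} {d m : nat} {dXi : measure_display} {Xi : measurableType dXi}.
Variables (k : constants R) (p : problem R d m Xi) (PXi : probability Xi R)
  (Pu : probability (rvec R d) R) (DX Phiinf nu : R) (O : set 'rV[R]_d).
Local Notation X := (feas p).
Local Notation hr := (fine \o reg p).

Hypothesis kpos : constants_positive k.
Hypothesis sa : standing_assumptions p PXi.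
Hypothesis rad : rademacher Pu.
Hypothesis fs : A1_feasible_set p DX.
Hypothesis rg : A1_regularizer k p.
Hypothesis cs : A1_constraints k p.
Hypothesis lb : A1_lower_bound p Phiinf.
Hypothesis ub : ereal_sup [set (composite p x - Phiinf%:E)%E | x in X] = (gap k)%:E.
Hypothesis nu0 : 0 < nu.
Hypothesis Oopen : open O.
Hypothesis Osub : enlarged_set p Pu nu `<=` O.
Hypothesis fO : A1_objective k p O.
Hypothesis a2 : A2 k p PXi O.
Hypothesis a3 : A3 k p PXi O.

Lemma reg_fin x : X x -> reg p x \is a fin_num.
Proof.
move=> Xx; have [[x0 _ hx0] _ sd] := rg.
have [_ _ _ _ [hN _]] := sa.
have [[g gx] _] := sd _ Xx.
rewrite fin_numE hN /=; apply/eqP => hx.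
by have := gx x0; rewrite hx addye// leye_eq => /eqP hy; rewrite hy in hx0.
Qed.

Lemma reg_lipschitz x y : X x -> X y -> hr x - hr y <= Mh k * norm2 (x - y).
Proof.
move=> Xx Xy; have [_ _ sd] := rg.
have [[g gx] gb] := sd _ Xx.
have := gx y; rewrite -(fineK (reg_fin Xx)) -(fineK (reg_fin Xy)) -EFinD lee_fin.
have gM := gb _ gx.
have : `|dotv g (y - x)| <= Mh k * norm2 (x - y).
  apply: le_trans (norm_dotv _ _) _.
  by rewrite -[norm2 (x - y)]norm2N opprB ler_wpM2r// norm2_ge0.
rewrite ler_norml => /andP[h1 _] /= h2.
by rewrite lerBlDr; move: h1 h2; rewrite lerNl; lra.
Qed.

Lemma segment_sub x e (t : R) : X x -> 0 <= t <= 1 -> O (x + t *: (nu *: sign_vec e)).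
Proof.
move=> Xx t01; apply: Osub; exists x, t, (sign_vec e : 'rV[R]_d); split => //.
  exact: rademacher_range.
by rewrite scalerA.
Qed.

Lemma standing_regular_problem : regular_problem k p O Phiinf.
Proof.
have [f0 fcl fcv fD] := fs.
have [_ _ [fC1 cC1] _ [_ hcv]] := sa.
split => //.
- exact: compact_norm2_bounded fD.
- move=> x y t Xx Xy /andP[t0 t1].
  have := fcv x y (Itv01 t0 t1); rewrite !inE => /(_ Xx Xy).
  by [].
- exact: reg_fin.
- exact: reg_lipschitz.
- by case: fC1.
- by move=> i; case: (cC1 i).
- by case: fC1.
- by move=> i; case: (cC1 i).
- move=> x Xx; have := @segment_sub x [ffun=> true] 0 Xx.
  by rewrite lexx ler01 scale0r addr0; apply.
- move=> x Xx; have := lb Xx; rewrite /composite -(fineK (reg_fin Xx)) -EFinD lee_fin.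
  by [].
- move=> x Xx; rewrite -lerBlDl -lee_fin -ub.
  apply: ereal_sup_ubound; exists x => //.
  by rewrite /composite -(fineK (reg_fin Xx)).
Qed.

(* Smooth for every sample once the null set [N] contains the exceptional ones. *)
Definition regularized_so (N : set Xi) (x : 'rV[R]_d) (z : Xi) : R :=
  so p x z * \1_(~` N) z.

Lemma regularized_in N z : N z -> regularized_so N ^~ z = cst 0.
Proof.
by move=> Nz; apply/funext => x; rewrite /regularized_so indicE memNset ?mulr0//; apply.
Qed.

Lemma regularized_notin N z : ~ N z -> regularized_so N ^~ z = so p ^~ z.
Proof.
by move=> Nz; apply/funext => x; rewrite /regularized_so indicE mem_set ?mulr1.
Qed.

Variable N : set Xi.
Hypothesis mN : measurable N.
Hypothesis N0 : PXi N = 0%E.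
Hypothesis NC1 : forall z, ~ N z -> continuously_differentiable (so p ^~ z).
Local Notation F' := (regularized_so N).

Let grad_cst (x : 'rV[R]_d) : grad (cst 0) x = 0 :> 'rV[R]_d.
Proof. by apply/rowP => i; rewrite !mxE derive_cst. Qed.

Let grad_in z x : N z -> grad (F' ^~ z) x = 0.
Proof. by move=> Nz; rewrite (regularized_in Nz) grad_cst. Qed.

Let grad_notin z x : ~ N z -> grad (F' ^~ z) x = grad (so p ^~ z) x.
Proof. by move=> Nz; rewrite (regularized_notin Nz). Qed.

Let mF' x : measurable_fun setT (F' x).
Proof.
have [_ /(_ x)[si _] _ _ _] := sa.
apply: measurable_funM; first by apply/measurable_EFinP; exact: (measurable_int PXi).
by apply: measurable_indic; exact: measurableC.
Qed.

Let dF' z x : differentiable (F' ^~ z) x.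
Proof.
have [Nz|Nz] := pselect (N z); first by rewrite (regularized_in Nz); exact: differentiable_cst.
by rewrite (regularized_notin Nz); have [+ _] := NC1 Nz; apply.
Qed.

Let aeF' x : {ae PXi, forall z, so p x z = F' x z}.
Proof.
exists N; split => // z /=; apply: contra_notP => Nz.
exact/esym/(congr1 (fun g => g x) (regularized_notin Nz)).
Qed.

Lemma standing_regular_oracle :
  regular_oracle PXi F' (obj p) X O (Lf k) (2 * sigma k ^+ 2 + 2 * Mf k ^+ 2) nu.
Proof.
have [[Lf0 Mf0 Mh0] _ [sg0 _ _]] := kpos.
split => //.
- exact: ltW.
- move=> z; have [Nz|Nz] := pselect (N z).
    rewrite (regularized_in Nz) (_ : grad _ = cst 0); first exact: cst_continuous.
    by apply/funext => x; exact: grad_cst.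
  by rewrite (regularized_notin Nz); have [_] := NC1 Nz.
- move=> x; have [_ /(_ x)[si _] _ _ _] := sa.
  apply: le_integrable si => //; first exact/measurable_EFinP.
  move=> z _; rewrite /= lee_fin /regularized_so normrM ler_piMr//.
  by rewrite indicE; case: (_ \in _); rewrite ?normr1 ?normr0.
- move=> x; have [_ /(_ x)[si sE] _ _ _] := sa.
  rewrite -sE unlock; apply: ae_eq_integral => //.
  + exact/measurable_EFinP.
  + exact: (measurable_int PXi).
  + by apply: filterS (aeF' x) => z /= <-.
- move=> x Ox.
  have [_ +] := a2 Ox; rewrite unlock => h.
  pose g z := norm2 (grad (F' ^~ z) x - grad (obj p) x) ^+ 2 * \1_(~` N) z.
  have mg : measurable_fun setT g.
    apply: measurable_funM; last by apply: measurable_indic; exact: measurableC.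
    apply: measurable_funX; apply: measurable_norm2; apply: measurable_vecB => //.
    by apply: measurable_grad => // z; exact: dF'.
  have g0 z : 0 <= g z by rewrite mulr_ge0 ?sqr_ge0// indicE.
  have hg : (\int[PXi]_z (g z)%:E <= (sigma k ^+ 2)%:E)%E.
    apply: le_trans h; apply: le_integral_nomeas => z; first by rewrite lee_fin.
    rewrite lee_fin /g indicE; have [Nz|Nz] := pselect (N z).
      by rewrite memNset ?mulr0 ?sqr_ge0//; apply.
    by rewrite mem_set// mulr1 grad_notin.
  have sg : summable1 PXi g by split => //; apply: le_lt_trans hg _; rewrite ltry.
  have s2g := summable1Z (ler0n R 2) sg.
  have Mf20 : 0 <= 2 * Mf k ^+ 2 by rewrite mulr_ge0// sqr_ge0.
  have sr := summable1D s2g (summable1_cst PXi Mf20).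
  apply: (@le_trans _ _ (\int[PXi]_z (2 * g z + 2 * Mf k ^+ 2)%:E)%E).
    apply: le_integral_nomeas => z; first by rewrite lee_fin sqr_ge0.
    rewrite lee_fin /g /grad_F; have [Nz|Nz] := pselect (N z).
      by rewrite grad_in// norm2_0 expr0n /= addr_ge0// mulr_ge0// mulr_ge0 ?sqr_ge0.
    rewrite indicE mem_set// mulr1.
    rewrite -{1}[grad (F' ^~ z) x](subrK (grad (obj p) x)).
    apply: le_trans (sqr_norm2D _ _) _; rewrite lerD2l ler_pM2l//.
    rewrite ler_pXn2r ?nnegrE ?norm2_ge0 ?(ltW Mf0)//.
    exact: (grad_obj_bound standing_regular_problem Ox).
  rewrite (summable1_mean sr) meanD//; last exact: summable1_cst.
  rewrite mean_cst mean_scale// lee_fin lerD2r ler_pM2l//.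
  by rewrite -lee_fin -summable1_mean.
- move=> x y Ox Oy; have := a3 Ox Oy; rewrite unlock => h.
  pose I := (\int[PXi]_z (norm2 (grad (so p ^~ z) x - grad (so p ^~ z) y) ^+ 2)%:E)%E.
  have {}h : (poweR I 2^-1 <= (Lf k * norm2 (x - y))%:E)%E by exact: h.
  have I0 : (0 <= I)%E by apply: integral_ge0 => z _; rewrite lee_fin sqr_ge0.
  apply: (@le_trans _ _ I).
    apply: le_integral_nomeas => z; rewrite lee_fin; first exact: sqr_ge0.
    rewrite /grad_F; have [Nz|Nz] := pselect (N z).
      by rewrite !grad_in// subrr norm2_0 expr0n sqr_ge0.
    by rewrite !grad_notin.
  case: I I0 h => [a| |] //; last first.
    by rewrite poweRyr ?leye_eq// invr_eq0 pnatr_eq0.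
  rewrite lee_fin => a0; rewrite poweR_EFin lee_fin powR12_sqrt// => h.
  rewrite lee_fin -exprMn -(sqr_sqrtr a0) lerXn2r ?nnegrE ?sqrtr_ge0//.
  exact: le_trans (sqrtr_ge0 _) h.
- exact: segment_sub.
Qed.

End standing_problem.

(** * Parameters and complexity *)

Section ceiling.
Context {R : realType}.
Implicit Type x : R.

Lemma nceil_ge x : x <= (nceil x)%:R.
Proof.
rewrite /nceil natr_absz; apply: le_trans (ceil_ge x) _.
by rewrite ler_int ler_norm.
Qed.

Lemma nceil_lt x : 0 <= x -> (nceil x)%:R <= x + 1.
Proof.
move=> x0; rewrite /nceil natr_absz ger0_norm ?ceil_ge0 ?(lt_le_trans _ x0)//.
rewrite -lerBlDr; apply: ltW; have := ceilB1_lt x.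
by rewrite rmorphB.
Qed.

Lemma nceil_gt0 x : 0 < x -> (0 < nceil x)%N.
Proof. by move=> x0; rewrite -(ltr0n R); exact: lt_le_trans (nceil_ge x). Qed.

End ceiling.

Section stagewise_facts.
Context {R : realType}.
Variables (k : constants R) (m d : nat) (Eu6 eps : R).
Hypothesis kpos : constants_positive k.
Hypothesis d3 : (3 <= d)%N.
Hypothesis eps01 : 0 < eps < 1.
Hypothesis Eu6E : Eu6 = d%:R ^+ 3.

Local Notation gamma := (gamma k m).
Local Notation mu := (mu k m eps).
Local Notation mu_base := (mu_base k m).
Local Notation mu_star := (mu_star k m eps).
Local Notation eps_ := (eps_ k m eps).
Local Notation eta := (Defs.eta k m d eps).
Local Notation run := (stage_run k m eps).
Local Notation sb := (sigma2_bar k m d eps).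

Let G0 := Mf k ^+ 2 + Mh k ^+ 2 + m%:R ^+ 2 * rho k ^+ 2 * Mbc k ^+ 2 * Mc k ^+ 2.

Let G0_gt0 : 0 < G0.
Proof.
have [[_ Mf0 _] _ _] := kpos.
have Mf2 : 0 < Mf k ^+ 2 by rewrite exprn_gt0.
have Mh2 := sqr_ge0 (Mh k).
have : 0 <= m%:R ^+ 2 * rho k ^+ 2 * Mbc k ^+ 2 * Mc k ^+ 2.
  by do 3 (apply: mulr_ge0; last exact: sqr_ge0); exact: sqr_ge0.
rewrite /G0; lra.
Qed.

Lemma gamma_gt0 : 0 < gamma.
Proof.
have [_ _ [_ b0 _]] := kpos.
by rewrite divr_gt0// sqrtr_gt0 mulr_gt0.
Qed.

Lemma sqr_gamma : beta k ^+ 2 * gamma ^+ 2 = 40 * G0.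
Proof.
have [_ _ [_ b0 _]] := kpos.
rewrite expr_div_n sqr_sqrtr ?mulr_ge0 ?(ltW G0_gt0)//.
by rewrite mulrC divfK// expf_neq0// gt_eqF.
Qed.

Lemma mu_base_ge1 : 1 <= mu_base.
Proof. by rewrite /Defs.mu_base !le_max lexx. Qed.

Lemma mu_base_ge_gamma : gamma <= mu_base.
Proof. by rewrite /Defs.mu_base !le_max lexx orbT. Qed.

Lemma mu_base_beta : 8 <= beta k ^+ 2 * mu_base ^+ 2.
Proof.
have [_ _ [_ b0 _]] := kpos.
have b2 : 0 < beta k ^+ 2 by rewrite exprn_gt0.
have h : Num.sqrt (8 / beta k ^+ 2) <= mu_base by rewrite /Defs.mu_base !le_max lexx !orbT.
have q0 : 0 <= 8 / beta k ^+ 2 by rewrite divr_ge0// ltW.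
have : Num.sqrt (8 / beta k ^+ 2) ^+ 2 <= mu_base ^+ 2.
  by rewrite ler_pXn2r// nnegrE ?sqrtr_ge0// (le_trans (sqrtr_ge0 _) h).
by rewrite sqr_sqrtr// ler_pdivrMr// mulrC.
Qed.

Lemma mu_star_ge : mu_base <= mu_star.
Proof. by rewrite /Defs.mu_star le_max lexx. Qed.

Lemma mu_first : mu 1 = mu_base. Proof. by []. Qed.

Lemma muS s : (0 < s)%N -> mu s.+1 = Num.min (2 * mu s ^+ 2) mu_star.
Proof. by case: s. Qed.

Lemma mu_ge s : mu_base <= mu s.
Proof.
have b1 := mu_base_ge1.
case: s => [|s]; first exact: lexx.
elim: s => [|s ih]; first exact: lexx.
rewrite muS// le_min mu_star_ge andbT; apply: (le_trans ih).
have m1 := le_trans b1 ih.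
rewrite expr2 mulrA ler_peMl//; first exact: le_trans ler01 m1.
by move: m1; lra.
Qed.

Lemma mu_le s : mu s <= mu_star.
Proof.
case: s => [|s]; first exact: mu_star_ge.
by case: s => [|s]; [exact: mu_star_ge|rewrite muS// ge_min lexx orbT].
Qed.

Lemma mu_ge1 s : 1 <= mu s.
Proof. exact: le_trans mu_base_ge1 (mu_ge s). Qed.

Lemma mu_gt0 s : 0 < mu s.
Proof. exact: lt_le_trans (mu_ge1 s). Qed.

Lemma eps_gt0 s : 0 < eps_ s.
Proof. by rewrite divr_gt0 ?gamma_gt0 ?mu_gt0. Qed.

Lemma eps_le1 s : eps_ s <= 1.
Proof.
rewrite /Defs.eps_ ler_pdivrMr ?mu_gt0// mul1r.
exact: le_trans mu_base_ge_gamma (mu_ge s).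
Qed.

Lemma mu_eps s : mu s * eps_ s = gamma.
Proof. by rewrite /Defs.eps_ mulrC divfK// gt_eqF// mu_gt0. Qed.

Let d0 : 0 < d%:R :> R. Proof. by rewrite ltr0n; exact: leq_trans d3. Qed.

Lemma sigma2_bar_gt0 s : 0 < sb s.
Proof.
have [[_ Mf0 _] _ _] := kpos.
rewrite /sigma2_bar.
have h1 : 0 < eps_ s ^+ 2 / 16 by rewrite divr_gt0// exprn_gt0// eps_gt0.
have h2 : 0 <= 4 * d%:R * (sigma k ^+ 2 + Mf k ^+ 2).
  by rewrite mulr_ge0 ?addr_ge0 ?sqr_ge0// mulr_ge0// ltW.
have h3 : 0 <= 2 * Mf k ^+ 2 by rewrite mulr_ge0 ?sqr_ge0.
by move: h1 h2 h3; lra.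
Qed.

Lemma L_mu_gt0 s : 0 < L_mu k m eps s.
Proof.
have [[Lf0 _ _] [Mc0 Mbc0 Lc0] [_ _ rh0]] := kpos.
have mu0 := mu_gt0 s.
apply: ltr_pwDl => //; apply: mulr_ge0 => //; apply: addr_ge0; first apply: addr_ge0.
- by rewrite mulr_ge0 ?sqr_ge0// ltW.
- by rewrite !mulr_ge0// ltW.
- by rewrite !mulr_ge0// ltW.
Qed.

Definition etas s : R := Num.min (1 / (4 * L_mu k m eps s ^+ 2))
  (Num.min (1 / (96 * Lf k ^+ 2)) (d%:R * eps_ s ^+ 2 / (23040 * Lf k ^+ 2 * sb s))).

Lemma etas_den_gt0 s : 0 < 23040 * Lf k ^+ 2 * sb s.
Proof.
have [[Lf0 _ _] _ _] := kpos.
have c0 : 0 < 23040 :> R by rewrite ltr0n.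
move: c0 => /mulr_gt0/(_ (exprn_gt0 2 Lf0))/mulr_gt0; apply.
exact: sigma2_bar_gt0.
Qed.

Lemma etas_gt0 s : 0 < etas s.
Proof.
have [[Lf0 _ _] _ _] := kpos.
have Lf2 : 0 < Lf k ^+ 2 by rewrite exprn_gt0.
have L2 : 0 < L_mu k m eps s ^+ 2 by rewrite exprn_gt0// L_mu_gt0.
have e2 : 0 < eps_ s ^+ 2 by rewrite exprn_gt0// eps_gt0.
have c1 : 0 < 4 * L_mu k m eps s ^+ 2 := mulr_gt0 (ltr0Sn R 3) L2.
have c2 : 0 < 96 * Lf k ^+ 2 := mulr_gt0 (ltr0Sn R 95) Lf2.
have n1 : 0 < d%:R * eps_ s ^+ 2 := mulr_gt0 d0 e2.
rewrite /etas !lt_min (divr_gt0 ltr01 c1) (divr_gt0 ltr01 c2).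
exact: (divr_gt0 n1 (etas_den_gt0 s)).
Qed.

Lemma sqr_eta s : eta s ^+ 2 = etas s.
Proof. exact: (sqr_sqrtr (ltW (etas_gt0 s))). Qed.

Lemma eta_gt0 s : 0 < eta s.
Proof. by rewrite sqrtr_gt0; exact: etas_gt0. Qed.

Lemma sqr_eta_le s : [/\ eta s ^+ 2 <= 1 / (4 * L_mu k m eps s ^+ 2),
  eta s ^+ 2 <= 1 / (96 * Lf k ^+ 2) &
  eta s ^+ 2 <= d%:R * eps_ s ^+ 2 / (23040 * Lf k ^+ 2 * sb s)].
Proof.
rewrite sqr_eta; have := lexx (etas s); rewrite {2}/etas !le_min.
by move=> /and3P.
Qed.

Lemma L_muE s : L_mu k m eps s = Lf k + m%:R * (mu s * Mc k ^+ 2 +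
  mu s * Mbc k * Lc k + rho k * Mbc k * Lc k).
Proof. by []. Qed.

Lemma eps_E s : eps_ s = gamma / mu s. Proof. by []. Qed.

Lemma sigma2_barE s : sb s = eps_ s ^+ 2 / 16 +
  4 * d%:R * (sigma k ^+ 2 + Mf k ^+ 2) + 2 * Mf k ^+ 2.
Proof. by []. Qed.

(* Unification would otherwise unfold the parameters down to their literals. *)
Opaque Defs.eta Defs.L_mu Defs.sigma2_bar Defs.eps_ Defs.gamma Defs.mu Defs.mu_base.


Lemma nu_facts s : 0 < nu k m d Eu6 eps s /\
  12 * (nu k m d Eu6 eps s ^+ 2 * d%:R ^+ 3) <= eps_ s ^+ 2 * eta s ^+ 2.
Proof.
have [[Lf0 _ _] _ [_ b0 _]] := kpos.
have e0 := eps_gt0 s; have h0 := eta_gt0 s; have mu0 := mu_gt0 s.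
have E0 : 0 < Eu6 by rewrite Eu6E exprn_gt0.
have i2 : 0 < eta s ^- 2 by rewrite invr_gt0 exprn_gt0.
have Lf2 : 0 < Lf k ^+ 2 by rewrite exprn_gt0.
have q0 : 0 < 4 * Lf k ^+ 2 + 3 * eta s ^- 2.
  by apply: addr_gt0; exact: mulr_gt0.
rewrite /Defs.nu; set a := eps_ s ^+ 2 / _; set b := _ / (60 * _).
have a0 : 0 < a by rewrite divr_gt0 ?exprn_gt0// mulr_gt0// mulr_gt0.
have b0' : 0 < b.
  apply: divr_gt0; last exact: mulr_gt0.
  by apply: mulr_gt0; [apply: mulr_gt0; [apply: mulr_gt0|]|]; exact: exprn_gt0.
have m0 : 0 < Num.min a b by rewrite lt_min a0.
split; first by rewrite sqrtr_gt0.
rewrite (sqr_sqrtr (ltW m0)) -Eu6E.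
have h1 : 12 * (Num.min a b * Eu6) <= 12 * (a * Eu6).
  by rewrite ler_pM2l// ler_pM2r// ge_min lexx.
apply: (le_trans h1).
have -> : a * Eu6 = eps_ s ^+ 2 / (4 * (4 * Lf k ^+ 2 + 3 * eta s ^- 2)).
  rewrite /a; field; rewrite !gt_eqF//=.
  by rewrite ltr_pwDr// mulr_ge0 ?mulr_ge0 ?ltW.
rewrite mulrCA ler_pM2l ?exprn_gt0//.
rewrite ler_pdivrMr; last by rewrite mulr_gt0.
have -> : eta s ^+ 2 * (4 * (4 * Lf k ^+ 2 + 3 * eta s ^- 2)) =
   16 * (eta s ^+ 2 * Lf k ^+ 2) + 12 by field; rewrite gt_eqF.
by rewrite lerDr mulr_ge0// mulr_ge0// ltW// exprn_gt0.
Qed.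

Let variance_arith (D e a b : R) : 0 <= b ->
  4 * D * (2 * a + 2 * b) + e / 8 <= 2 * (e / 16 + 4 * D * (a + b) + 2 * b).
Proof. by lra. Qed.

Lemma stagewise_conditions s :
  @stage_conditions R d m k (2 * sigma k ^+ 2 + 2 * Mf k ^+ 2)
    (stagewise k m d Eu6 eps s) (eps_ s) (sb s) (Delta_bar k m eps s) (C_bar k m eps s).
Proof.
have [[Lf0 _ _] _ [sg0 b0 _]] := kpos.
have e0 := eps_gt0 s; have h0 := eta_gt0 s; have mu0 := mu_gt0 s.
have sb0 := sigma2_bar_gt0 s; have L0 := L_mu_gt0 s.
have e20 : 0 < eps_ s ^+ 2 by rewrite exprn_gt0.
have h20 : 0 < eta s ^+ 2 by rewrite exprn_gt0.
have Lf2 : 0 < Lf k ^+ 2 by rewrite exprn_gt0.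
have [eta1 eta2 eta3] := sqr_eta_le s.
have KE := nceil_ge (Num.max (108 * Delta_bar k m eps s / (eta s * eps_ s ^+ 2))
  (Num.max (5 * C_bar k m eps s / eps_ s ^+ 2) (1 / (Lf k ^+ 2 * eta s ^+ 2)))).
have K1 : 108 * Delta_bar k m eps s / (eta s * eps_ s ^+ 2) <= (K_ k m d eps s)%:R.
  by apply: le_trans KE; rewrite le_max lexx.
have K2 : 5 * C_bar k m eps s / eps_ s ^+ 2 <= (K_ k m d eps s)%:R.
  by apply: le_trans KE; rewrite !le_max lexx !orbT.
have K3 : 1 / (Lf k ^+ 2 * eta s ^+ 2) <= (K_ k m d eps s)%:R.
  by apply: le_trans KE; rewrite !le_max lexx !orbT.
split => //=.
- by apply: nceil_gt0; rewrite divr_gt0// mulr_gt0.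
- rewrite -(ltr0n R); apply: lt_le_trans K3.
  by rewrite divr_gt0// mulr_gt0.
- rewrite -(@ler_pXn2r _ 2)// ?nnegrE ?invr_ge0//; last by rewrite mulr_ge0// ltW.
  rewrite exprMn; move: eta1; rewrite ler_pdivlMr; last by rewrite mulr_gt0// exprn_gt0.
  rewrite -/(L_mu k m eps s); set y := _ ^+ 2; set z := L_mu _ _ _ _ ^+ 2 => h.
  have -> : (2^-1 : R) ^+ 2 = 4^-1 by field.
  by rewrite -[_^-1]mul1r ler_pdivlMr// -mulrA [z * 4]mulrC.
- by move: eta2; rewrite ler_pdivlMr ?mulr_gt0// mulrC.
- exact: (nu_facts s).2.
- by rewrite addr_ge0// mulr_ge0// sqr_ge0.
- by rewrite sigma2_barE; exact: variance_arith (sqr_ge0 _).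
- by rewrite mulrC -(ler_pdivlMr _ _ (etas_den_gt0 s)).
- have q : 0 < 4 * eps_ s ^+ 2 := mulr_gt0 (ltr0Sn R 3) e20.
  by rewrite [leRHS]mulrC -(ler_pdivrMr _ _ q); exact: nceil_ge.
- by rewrite -(ler_pdivrMr _ _ (mulr_gt0 h0 e20)).
- by rewrite -(ler_pdivrMr _ _ e20).
- by rewrite -(ler_pdivrMr _ _ (mulr_gt0 Lf2 h20)).
- have -> : beta k ^+ 2 * mu s ^+ 2 * eps_ s ^+ 2 = beta k ^+ 2 * (mu s * eps_ s) ^+ 2.
    ring.
  by rewrite mu_eps sqr_gamma.
- apply: le_trans mu_base_beta _; rewrite ler_pM2l ?exprn_gt0//.
  rewrite ler_pXn2r ?nnegrE ?mu_ge// ltW//.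
  exact: lt_le_trans mu_base_ge1.
Qed.

Transparent Defs.eta Defs.L_mu Defs.sigma2_bar Defs.eps_ Defs.gamma Defs.mu Defs.mu_base.

Lemma run_pred s : (0 < s)%N -> run s.+1 -> run s.
Proof.
move=> s0 [_ h]; split => // s' /andP[s1 s2]; apply: h.
by rewrite s1 ltnW.
Qed.

Lemma run_lt s : (0 < s)%N -> run s.+1 -> mu s < mu_star.
Proof. by move=> s0 [_]; apply; rewrite s0 ltnSn. Qed.

(* The minimum defining [mu s.+1] is then not attained at [mu_star]. *)
Lemma mu_double s : (0 < s)%N -> mu s.+1 < mu_star -> 2 * mu s <= mu s.+1.
Proof.
move=> s0; rewrite muS// gt_min ltxx orbF => h.
rewrite min_l ?(ltW h)// ler_pM2l// expr2 ler_peMl ?mu_ge1// ltW//.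
exact: mu_gt0.
Qed.

Lemma last_stage_exists : exists T, last_stage k m eps T.
Proof.
have step n : (exists2 s, (0 < s <= n.+1)%N & mu_star <= mu s) \/ 2 ^+ n <= mu n.+1.
  elim: n => [|n [[s sn h]|ih]]; first by right; exact: mu_ge1.
    by left; exists s => //; move: sn => /andP[-> /leqW].
  have [h|h] := leP mu_star (mu n.+2); first by left; exists n.+2; rewrite /= ?leqnn.
  right; apply: (@le_trans _ _ (2 * mu n.+1)); last exact: mu_double.
  by rewrite exprS ler_pM2l.
have [n hn] : exists n, mu_star < 2 ^+ n.
  exists (Num.truncn mu_star).+1; apply: lt_le_trans (truncnS_gt _) _.
  by rewrite -natrX ler_nat; apply: ltnW; exact: ltn_expl.
have ex : exists s, (0 < s)%N && (mu_star <= mu s).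
  case: (step n) => [[s /andP[s0 _] h]|h]; first by exists s; rewrite s0.
  by have := lt_le_trans hn h; rewrite ltNge mu_le.
exists (ex_minn ex); case: ex_minnP => T /andP[T0 hT] minT.
split => //; split => // s' /andP[s0 sT]; rewrite ltNge; apply/negP => h.
by have := minT s'; rewrite s0 h leqNgt sT => /(_ isT).
Qed.

Lemma last_eps T : last_stage k m eps T -> eps_ T <= eps.
Proof.
have /andP[e0 _] := eps01.
move=> [_ h]; rewrite /Defs.eps_ ler_pdivrMr ?mu_gt0//.
rewrite mulrC -ler_pdivrMr//; apply: le_trans h.
by rewrite /Defs.mu_star le_max lexx orbT.
Qed.

Lemma mu_star_eps : mu_star <= (mu_base + gamma) / eps.
Proof.
have /andP[e0 /ltW e1] := eps01.
have b0 : 0 < mu_base := lt_le_trans ltr01 mu_base_ge1.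
rewrite ge_max !ler_pdivlMr// divfK ?gt_eqF// lerDr (ltW b0) andbT.
apply: (@le_trans _ _ mu_base); first by rewrite ler_piMr// ltW.
by rewrite lerDl ltW// gamma_gt0.
Qed.

Lemma sum_mu_cube T : last_stage k m eps T ->
  \sum_(1 <= s < T.+1) mu s ^+ 3 <= 3 * mu_star ^+ 3.
Proof.
have acc n : run n.+1 -> mu n.+1 < mu_star -> \sum_(1 <= s < n.+1) mu s ^+ 3 <= mu n.+1 ^+ 3.
  elim: n => [|n ih] rn h.
    by rewrite big_geq// exprn_ge0// ltW// mu_gt0.
  have rn' := run_pred (ltn0Sn _) rn.
  have hn := run_lt (ltn0Sn _) rn.
  rewrite big_nat_recr//=.
  have h1 := ih rn' hn; have h2 := mu_double (ltn0Sn _) h.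
  have h3 : (2 * mu n.+1) ^+ 3 <= mu n.+2 ^+ 3.
    by rewrite ler_pXn2r// nnegrE ?mulr_ge0// ltW// mu_gt0.
  apply: (le_trans _ h3); rewrite exprMn.
  have := exprn_ge0 3 (ltW (mu_gt0 n.+1)).
  by move: h1; set a := mu n.+1 ^+ 3; set b := \sum_(1 <= s < n.+1) _; lra.
have cube s : mu s ^+ 3 <= mu_star ^+ 3.
  rewrite ler_pXn2r ?mu_le// nnegrE ?ltW ?mu_gt0//.
  exact: lt_le_trans (mu_gt0 1) (mu_le 1).
case: T => [[[]]//|[|T]] [rT hT].
  rewrite big_nat1; apply: le_trans (cube 1%N) _.
  have := le_trans (exprn_ge0 3 (ltW (mu_gt0 1))) (cube 1%N); lra.
rewrite big_nat_recr//= big_nat_recr//=.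
have rT' := run_pred (ltn0Sn _) rT.
have := acc T rT' (run_lt (ltn0Sn _) rT); have := cube T.+1; have := cube T.+2.
by set b := \sum_(1 <= s < T.+1) _; lra.
Qed.

End stagewise_facts.

Section complexity.
Context {R : realType}.
Variables (k : constants R) (m : nat).
Hypothesis kpos : constants_positive k.

Local Notation gamma := (gamma k m).

(* Constants with L_mu <= cL mu, sigma2_bar <= cS d, 1/eta <= cE mu, K <= cK mu^3
   and n0 <= cN d mu^3, using mu >= 1 and eps_s = gamma / mu_s <= 1. *)
Definition cL : R := Lf k + m%:R * (Mc k ^+ 2 + Mbc k * Lc k + rho k * Mbc k * Lc k).
Definition cS : R := 1 + 4 * (sigma k ^+ 2 + Mf k ^+ 2) + 2 * Mf k ^+ 2.
(* The large literal is abstracted, since unification would expand it in unary. *)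
Definition cE3 (c : R) : R := c * Lf k ^+ 2 * cS / gamma ^+ 2.
Definition cE2 : R := 4 * cL ^+ 2 + 96 * Lf k ^+ 2 + cE3 23040.
Definition cE : R := Num.sqrt cE2.
Definition cD : R := `|B_X k m| + mu_base k m * m%:R * Mbc k ^+ 2 / 2 + gamma ^+ 2.
Definition cC : R := m%:R * Mbc k ^+ 2 + 2 * gamma ^+ 2.
Definition cK : R := 108 * cD * cE / gamma ^+ 2 + 5 * cC / gamma ^+ 2 + cE2 / Lf k ^+ 2 + 1.
Definition cN : R := 5 * cS / (4 * gamma ^+ 2) + 1.
Definition complexity_constant : R :=
  (2 * cN + 4 * cK) * (3 * (mu_base k m + gamma) ^+ 3).

Lemma cS_gt0 : 0 < cS.
Proof.
have h1 : 0 <= sigma k ^+ 2 := sqr_ge0 _; have h2 : 0 <= Mf k ^+ 2 := sqr_ge0 _.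
by rewrite /cS; lra.
Qed.

Lemma cL_gt0 : 0 < cL.
Proof.
have [[Lf0 _ _] [Mc0 Mbc0 Lc0] [_ _ rh0]] := kpos.
apply: ltr_pwDl => //; apply: mulr_ge0 => //; apply: addr_ge0; first apply: addr_ge0.
- exact: sqr_ge0.
- by rewrite mulr_ge0// ltW.
- by rewrite !mulr_ge0// ltW.
Qed.

Lemma cE3_gt0 c : 0 < c -> 0 < cE3 c.
Proof.
have [[Lf0 _ _] _ _] := kpos.
move=> c0; apply: divr_gt0; last by rewrite exprn_gt0// gamma_gt0.
by apply: mulr_gt0 cS_gt0; apply: mulr_gt0 => //; exact: exprn_gt0.
Qed.

Let c0 : 0 < 23040 :> R. Proof. by rewrite ltr0n. Qed.

Lemma cE2_gt0 : 0 < cE2.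
Proof.
have [[Lf0 _ _] _ _] := kpos.
have g0 := gamma_gt0 m kpos.
apply: addr_gt0; first apply: addr_gt0.
- by rewrite mulr_gt0// exprn_gt0// cL_gt0.
- by rewrite mulr_gt0// exprn_gt0.
- exact: cE3_gt0 c0.
Qed.

Lemma cN_gt0 : 0 < cN.
Proof.
have gg : 0 < gamma ^+ 2 by rewrite exprn_gt0// gamma_gt0.
exact: (addr_gt0 (divr_gt0 (mulr_gt0 (ltr0Sn R 4) cS_gt0) (mulr_gt0 (ltr0Sn R 3) gg)) ltr01).
Qed.

Lemma cD_ge0 : 0 <= cD.
Proof.
rewrite /cD !addr_ge0 ?sqr_ge0// divr_ge0// mulr_ge0 ?sqr_ge0// mulr_ge0//.
exact: le_trans ler01 (mu_base_ge1 k m).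
Qed.

Lemma cC_ge0 : 0 <= cC.
Proof. by rewrite addr_ge0// mulr_ge0// sqr_ge0. Qed.

Lemma cK_gt0 : 0 < cK.
Proof.
have [[Lf0 _ _] _ _] := kpos.
have gg : 0 < gamma ^+ 2 by rewrite exprn_gt0// gamma_gt0.
apply: ltr_wpDl ltr01; apply: addr_ge0; first apply: addr_ge0.
- exact: (divr_ge0 (mulr_ge0 (mulr_ge0 (ler0n R 108) cD_ge0) (sqrtr_ge0 _)) (ltW gg)).
- exact: (divr_ge0 (mulr_ge0 (ler0n R 5) cC_ge0) (ltW gg)).
- exact: (divr_ge0 (ltW cE2_gt0) (sqr_ge0 _)).
Qed.

Variables (d : nat) (Eu6 eps : R).
Hypothesis d3 : (3 <= d)%N.
Hypothesis eps01 : 0 < eps < 1.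

Local Notation mu := (mu k m eps).
Local Notation eps_ := (eps_ k m eps).
Local Notation eta := (Defs.eta k m d eps).
Local Notation sb := (sigma2_bar k m d eps).
Local Notation K_ := (K_ k m d eps).
Local Notation th := (stagewise k m d Eu6 eps).

Let d0 : 0 < d%:R :> R. Proof. by rewrite ltr0n; exact: leq_trans d3. Qed.
Let d1 : 1 <= d%:R :> R. Proof. by rewrite (ler_nat R 1); exact: leq_trans d3. Qed.

Let g0 : 0 < gamma := gamma_gt0 m kpos.
Let mu0 s : 0 < mu s := mu_gt0 k m eps s.
Let mu1 s : 1 <= mu s := mu_ge1 k m eps s.

Opaque Defs.eta Defs.L_mu Defs.sigma2_bar Defs.eps_ Defs.gamma Defs.mu Defs.mu_base.

Lemma L_mu_le s : L_mu k m eps s <= cL * mu s.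
Proof.
have [[Lf0 _ _] [Mc0 Mbc0 Lc0] [_ _ rh0]] := kpos.
rewrite L_muE /cL mulrDl; apply: lerD; first by rewrite ler_peMr// ltW.
rewrite -[leRHS]mulrA ler_wpM2l//.
have -> : (Mc k ^+ 2 + Mbc k * Lc k + rho k * Mbc k * Lc k) * mu s =
  mu s * Mc k ^+ 2 + mu s * Mbc k * Lc k + rho k * Mbc k * Lc k * mu s by ring.
by rewrite lerD2l ler_peMr// !mulr_ge0// ltW.
Qed.

Lemma sigma2_bar_le s : sb s <= d%:R * cS.
Proof.
have h : eps_ s ^+ 2 <= 1 by rewrite exprn_ile1// ?eps_le1// ltW// eps_gt0.
have Mf2 : 2 * Mf k ^+ 2 <= d%:R * (2 * Mf k ^+ 2) by rewrite ler_peMl// mulr_ge0// sqr_ge0.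
have e : eps_ s ^+ 2 / 16 <= d%:R by apply: le_trans d1; lra.
rewrite sigma2_barE /cS; move: e Mf2; set a := eps_ s ^+ 2 / 16.
move: (sigma k ^+ 2) (Mf k ^+ 2) (d%:R) => x y D; lra.
Qed.

Lemma inv_eps s : (eps_ s ^+ 2)^-1 = mu s ^+ 2 / gamma ^+ 2.
Proof. by rewrite eps_E expr_div_n invf_div. Qed.

Let inv_min3 (x y z : R) : 0 < x -> 0 < y -> 0 < z ->
  (Num.min x (Num.min y z))^-1 <= x^-1 + y^-1 + z^-1.
Proof.
move=> x0 y0 z0; have ix : 0 < x^-1 by rewrite invr_gt0.
have iy : 0 < y^-1 by rewrite invr_gt0.
have iz : 0 < z^-1 by rewrite invr_gt0.
by case: (leP y z) => _; [case: (leP x y)|case: (leP x z)] => _; lra.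
Qed.

Let inv_eta3 c s : 0 < c ->
  (d%:R * eps_ s ^+ 2 / (c * Lf k ^+ 2 * sb s))^-1 <= cE3 c * mu s ^+ 2.
Proof.
have [[Lf0 _ _] _ _] := kpos.
move=> c_gt0; rewrite invf_div invfM inv_eps.
have Lf2 : 0 < Lf k ^+ 2 by rewrite exprn_gt0.
have m2 : 0 < mu s ^+ 2 by rewrite exprn_gt0.
have g2 : 0 < gamma ^+ 2 by rewrite exprn_gt0.
have -> : c * Lf k ^+ 2 * sb s * (d%:R^-1 * (mu s ^+ 2 / gamma ^+ 2)) =
  (c * Lf k ^+ 2 * mu s ^+ 2 / gamma ^+ 2) * (sb s / d%:R) by field; rewrite !gt_eqF.
have -> : cE3 c * mu s ^+ 2 = (c * Lf k ^+ 2 * mu s ^+ 2 / gamma ^+ 2) * cS.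
  by rewrite /cE3; field; rewrite gt_eqF.
rewrite ler_pM2l; last by apply: divr_gt0 => //; apply: mulr_gt0 => //; exact: mulr_gt0.
by rewrite ler_pdivrMr// mulrC sigma2_bar_le.
Qed.

Lemma inv_eta2 s : (eta s ^+ 2)^-1 <= cE2 * mu s ^+ 2.
Proof.
have [[Lf0 _ _] _ _] := kpos.
have Lf2 : 0 < Lf k ^+ 2 by rewrite exprn_gt0.
have L0 : 0 < L_mu k m eps s by exact: L_mu_gt0.
have m21 : 1 <= mu s ^+ 2 by rewrite exprn_ege1.
have e2 : 0 < eps_ s ^+ 2 by rewrite exprn_gt0// eps_gt0.
have t1 : 0 < 4 * L_mu k m eps s ^+ 2 by rewrite mulr_gt0// exprn_gt0.
have t2 : 0 < 96 * Lf k ^+ 2 by rewrite mulr_gt0.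
have q1 : (1 / (4 * L_mu k m eps s ^+ 2))^-1 <= 4 * cL ^+ 2 * mu s ^+ 2.
  rewrite div1r invrK -mulrA ler_pM2l// -exprMn.
  rewrite ler_pXn2r ?nnegrE ?mulr_ge0 ?(ltW L0) ?(ltW cL_gt0) ?(ltW (mu0 s))//.
  exact: L_mu_le.
have q2 : (1 / (96 * Lf k ^+ 2))^-1 <= 96 * Lf k ^+ 2 * mu s ^+ 2.
  by rewrite div1r invrK ler_peMr// ltW.
rewrite (sqr_eta m eps kpos d3 s).
have h := inv_min3 (divr_gt0 ltr01 t1) (divr_gt0 ltr01 t2)
  (divr_gt0 (mulr_gt0 d0 e2) (etas_den_gt0 m d eps kpos s)).
apply: (le_trans h); rewrite /cE2 [leRHS]mulrDl [X in _ <= X + _]mulrDl.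
exact: (lerD (lerD q1 q2) (inv_eta3 s c0)).
Qed.

Opaque cE2 cE3.

Lemma inv_eta s : (eta s)^-1 <= cE * mu s.
Proof.
have e0 : 0 < eta s by exact: eta_gt0.
rewrite -(@ler_pXn2r _ 2)// ?nnegrE ?invr_ge0 ?(ltW e0)//.
  by rewrite exprVn exprMn (sqr_sqrtr (ltW cE2_gt0)); exact: inv_eta2.
by rewrite mulr_ge0 ?sqrtr_ge0// ltW.
Qed.

Lemma Delta_bar_le s : Delta_bar k m eps s <= cD.
Proof.
rewrite /Delta_bar /cD; have [_ [_ Mbc0 _] _] := kpos.
have b := ler_norm (B_X k m); have g2 : 0 <= gamma ^+ 2 := sqr_ge0 _.
have q : 0 <= mu_base k m * m%:R * Mbc k ^+ 2 / 2.
  rewrite divr_ge0// mulr_ge0 ?sqr_ge0// mulr_ge0//.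
  exact: le_trans ler01 (mu_base_ge1 k m).
have aux (x y z t : R) : x <= y -> 0 <= z -> 0 <= t -> x + t <= y + t + z /\ x + z <= y + t + z.
  by move=> *; split; lra.
have [h1 h2] := aux _ _ _ _ b g2 q.
by case: eqP => [->|_]; rewrite ?mu_first.
Qed.

Lemma C_bar_le s : C_bar k m eps s <= cC.
Proof.
rewrite /C_bar /cC; have g2 : 0 <= 2 * gamma ^+ 2 by rewrite mulr_ge0// sqr_ge0.
have q : 0 <= m%:R * Mbc k ^+ 2 by rewrite mulr_ge0// sqr_ge0.
case: eqP => _; first by rewrite lerDl.
apply: (@le_trans _ _ (2 * gamma ^+ 2)); last by rewrite lerDr.
by rewrite ler_pdivrMr// ler_peMr.
Qed.

Lemma K_le s : (K_ s)%:R <= cK * mu s ^+ 3.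
Proof.
have [[Lf0 _ _] [_ Mbc0 _] _] := kpos.
have Lf2 : 0 < Lf k ^+ 2 by rewrite exprn_gt0.
have e0 : 0 < eta s by exact: eta_gt0.
have e20 : 0 < eps_ s ^+ 2 by rewrite exprn_gt0// eps_gt0.
have m2 : 0 < mu s ^+ 2 by rewrite exprn_gt0.
have m3 : 0 < mu s ^+ 3 by rewrite exprn_gt0.
have m31 : 1 <= mu s ^+ 3 by rewrite exprn_ege1.
have m23 : mu s ^+ 2 <= mu s ^+ 3 by rewrite ler_weXn2l.
have gg : 0 < gamma ^+ 2 by rewrite exprn_gt0.
have cD0 := cD_ge0; have cC0 := cC_ge0.
have cE0 : 0 <= cE by exact: sqrtr_ge0.
pose a := 108 * cD * cE / gamma ^+ 2; pose b := 5 * cC / gamma ^+ 2; pose c := cE2 / Lf k ^+ 2.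
have a0 : 0 <= a :=
  divr_ge0 (mulr_ge0 (mulr_ge0 (ler0n R 108) cD0) cE0) (ltW gg).
have b0 : 0 <= b := divr_ge0 (mulr_ge0 (ler0n R 5) cC0) (ltW gg).
have cpos : 0 < c := divr_gt0 cE2_gt0 Lf2.
have h1 : 108 * Delta_bar k m eps s / (eta s * eps_ s ^+ 2) <= a * mu s ^+ 3.
  apply: (@le_trans _ _ (108 * cD / (eta s * eps_ s ^+ 2))).
    have ie : 0 < (eta s * eps_ s ^+ 2)^-1 by rewrite invr_gt0; exact: mulr_gt0.
    by rewrite (ler_pM2r ie) ler_pM2l ?Delta_bar_le.
  rewrite invfM inv_eps.
  have -> : a * mu s ^+ 3 = 108 * cD * (cE * mu s * (mu s ^+ 2 / gamma ^+ 2)).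
    by rewrite /a; field; rewrite gt_eqF.
  rewrite ler_wpM2l ?mulr_ge0// ler_wpM2r ?inv_eta//.
  by rewrite ltW// divr_gt0.
have h2 : 5 * C_bar k m eps s / eps_ s ^+ 2 <= b * mu s ^+ 3.
  rewrite inv_eps; apply: (@le_trans _ _ (b * mu s ^+ 2)); last by rewrite ler_wpM2l.
  have -> : b * mu s ^+ 2 = 5 * cC * (mu s ^+ 2 / gamma ^+ 2) by rewrite /b; field; rewrite gt_eqF.
  by rewrite ler_pM2r ?divr_gt0// ler_pM2l// C_bar_le.
have h3 : 1 / (Lf k ^+ 2 * eta s ^+ 2) <= c * mu s ^+ 3.
  apply: (@le_trans _ _ (c * mu s ^+ 2)); last by rewrite ler_pM2l.
  rewrite div1r invfM /c mulrAC [leRHS]mulrC ler_pM2l ?invr_gt0//.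
  exact: inv_eta2.
have a3 : 0 <= a * mu s ^+ 3 by rewrite mulr_ge0// ltW.
have b3 : 0 <= b * mu s ^+ 3 by rewrite mulr_ge0// ltW.
have c3 : 0 < c * mu s ^+ 3 by rewrite mulr_gt0.
rewrite /Defs.K_; set y := Num.max _ _.
have yle : y <= a * mu s ^+ 3 + b * mu s ^+ 3 + c * mu s ^+ 3.
  rewrite !ge_max; move: h1 h2 h3 a3 b3 c3; set q1 := 108 * _ / _; set q2 := _ / eps_ s ^+ 2.
  set q3 := 1 / _; set A := a * _; set B := b * _; set C := c * _ => *.
  by apply/and3P; split; lra.
have y0 : 0 <= y.
  by rewrite !le_max [X in _ || (_ || X)]ltW ?orbT// divr_gt0// mulr_gt0// exprn_gt0.
apply: (le_trans (nceil_lt y0)).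
rewrite -/(a) /cK -/a -/b -/c 3!mulrDl mul1r; exact: lerD.
Qed.

Lemma n0_le s : (st_n0 (th s))%:R <= cN * d%:R * mu s ^+ 3.
Proof.
have e20 : 0 < eps_ s ^+ 2 by rewrite exprn_gt0// eps_gt0.
have sb0 : 0 < sb s by exact: sigma2_bar_gt0.
have m31 : 1 <= mu s ^+ 3 by rewrite exprn_ege1.
have m23 : mu s ^+ 2 <= mu s ^+ 3 by rewrite ler_weXn2l.
have gg : 0 < gamma ^+ 2 by rewrite exprn_gt0.
have cN0 : 0 < 5 * cS / (4 * gamma ^+ 2) :=
  divr_gt0 (mulr_gt0 (ltr0Sn R 4) cS_gt0) (mulr_gt0 (ltr0Sn R 3) gg).
rewrite /=; apply: le_trans (nceil_lt _) _.
  exact: (divr_ge0 (mulr_ge0 (ler0n R 5) (ltW sb0)) (mulr_ge0 (ler0n R 4) (ltW e20))).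
have -> : cN * d%:R * mu s ^+ 3 = 5 * cS / (4 * gamma ^+ 2) * d%:R * mu s ^+ 3 + d%:R * mu s ^+ 3.
  by rewrite /cN; set q := 5 * cS / _; ring.
apply: lerD; last first.
  by apply: le_trans d1 _; rewrite ler_peMr// ltW.
apply: (@le_trans _ _ (5 * cS / (4 * gamma ^+ 2) * d%:R * mu s ^+ 2)); last first.
  by rewrite ler_wpM2l// mulr_ge0// ltW.
rewrite invfM inv_eps.
have -> : 5 * sb s * (4^-1 * (mu s ^+ 2 / gamma ^+ 2)) = 5 / 4 * (mu s ^+ 2 / gamma ^+ 2) * sb s.
  by field; rewrite gt_eqF.
have -> : 5 * cS / (4 * gamma ^+ 2) * d%:R * mu s ^+ 2 =
  5 / 4 * (mu s ^+ 2 / gamma ^+ 2) * (d%:R * cS) by field; rewrite gt_eqF.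
rewrite ler_wpM2l ?sigma2_bar_le//; apply: mulr_ge0; first exact: divr_ge0.
exact: (divr_ge0 (sqr_ge0 _) (ltW gg)).
Qed.

Lemma oracle_calls_le s :
  (oracle_calls (th s))%:R <= (2 * cN + 4 * cK) * d%:R * mu s ^+ 3.
Proof.
apply: (@le_trans _ _ (2 * (st_n0 (th s))%:R + (K_ s)%:R * (4 * d%:R))).
  rewrite /oracle_calls natrD !natrM lerD2l.
  have -> : 4 * d%:R = 2 * (2 * d%:R) :> R by ring.
  by apply: ler_wpM2r; [rewrite !mulr_ge0|rewrite ler_nat leq_pred].
have -> : (2 * cN + 4 * cK) * d%:R * mu s ^+ 3 =
  2 * (cN * d%:R * mu s ^+ 3) + cK * mu s ^+ 3 * (4 * d%:R) by ring.
apply: lerD; first by rewrite ler_pM2l// n0_le.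
by rewrite ler_pM2r ?mulr_gt0// K_le.
Qed.

Lemma total_oracle_calls T : last_stage k m eps T ->
  (\sum_(1 <= s < T.+1) oracle_calls (th s))%:R <= complexity_constant * (d%:R * eps ^- 3).
Proof.
move=> lT; have /andP[e0 e1] := eps01.
have cc : 0 <= 2 * cN + 4 * cK :=
  ltW (addr_gt0 (mulr_gt0 (ltr0Sn R 1) cN_gt0) (mulr_gt0 (ltr0Sn R 3) cK_gt0)).
rewrite natr_sum; apply: (@le_trans _ _ ((2 * cN + 4 * cK) * d%:R * \sum_(1 <= s < T.+1) mu s ^+ 3)).
  by rewrite mulr_sumr; apply: ler_sum => s _; exact: oracle_calls_le.
have h := sum_mu_cube lT.
have ms0 : 0 < mu_star k m eps by apply: lt_le_trans (mu0 0) (mu_le _ _ _ _).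
have h2 : mu_star k m eps ^+ 3 <= (mu_base k m + gamma) ^+ 3 * eps ^- 3.
  have hs := mu_star_eps m kpos eps01; have rs := le_trans (ltW ms0) hs.
  rewrite -exprVn -exprMn (ler_pXn2r (ltn0Sn 2)) ?nnegrE ?(ltW ms0)//; exact: hs.
have -> : complexity_constant * (d%:R * eps ^- 3) =
  (2 * cN + 4 * cK) * d%:R * (3 * ((mu_base k m + gamma) ^+ 3 * eps ^- 3)).
  by rewrite /complexity_constant; ring.
apply: ler_wpM2l; first exact: (mulr_ge0 cc (ltW d0)).
by apply: (le_trans h); rewrite ler_pM2l.
Qed.

End complexity.

(** * The multi-stage algorithm *)

Section regularized_process.
Context {R : realType} {d m : nat} {dXi : measure_display} {Xi : measurableType dXi}.
Variables (p : problem R d m Xi) (N : set Xi).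

Definition regularized : problem R d m Xi :=
  Problem (feas p) (regularized_so p N) (obj p) (reg p) (con p).

Lemma zo_estimator_regularized nu x v z : ~ N z ->
  zo_estimator regularized nu x v z = zo_estimator p nu x v z.
Proof.
move=> Nz; have h y := congr1 (fun g => g y) (regularized_notin p Nz).
by rewrite /zo_estimator /= !h.
Qed.

Section one_stage.
Variables (th : stage_parameters R) (x0 : 'rV[R]_d)
  (u : nat -> nat -> 'rV[R]_d) (xi : nat -> nat -> Xi).

Lemma single_stage_regularized j :
  (forall i l, (i <= j)%N -> (l < batch_size th i)%N -> ~ N (xi i l)) ->
  single_stage regularized th x0 u xi j = single_stage p th x0 u xi j.
Proof.
elim: j => [|j ih] Nxi /=.
  congr State; congr (_ *: _); apply: eq_bigr => l _.
  by apply: zo_estimator_regularized; exact: (Nxi 0%N l isT (ltn_ord l)).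
rewrite ih; last by move=> i l ij; apply: Nxi; exact: leqW.
case: single_stage => x s l; congr State; congr (_ *: _); apply: eq_bigr => i _.
by rewrite !zo_estimator_regularized//; exact: (Nxi j.+1 i (leqnn _) (ltn_ord i)).
Qed.

Lemma iterate_regularized j :
  (forall i l, (i < j)%N -> (l < batch_size th i)%N -> ~ N (xi i l)) ->
  st_x (single_stage regularized th x0 u xi j) = st_x (single_stage p th x0 u xi j).
Proof.
case: j => [//|j] Nxi; rewrite /= single_stage_regularized//.
by case: single_stage.
Qed.

End one_stage.

Section all_stages.
Variables (th : nat -> stage_parameters R) (x0 : 'rV[R]_d)
  (u : nat -> nat -> nat -> 'rV[R]_d) (xi : nat -> nat -> nat -> Xi) (r r' : nat -> nat).

Definition regular_draws (s : nat) : Prop :=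
  forall i l, (i < st_K (th s))%N -> (l < batch_size (th s) i)%N -> ~ N (xi s i l).

Lemma stage_output_regularized s :
  (forall s', (0 < s' <= s)%N ->
    [/\ regular_draws s', r' s' = r s' & (r s' < st_K (th s'))%N]) ->
  stage_output regularized th x0 u xi r' s = stage_output p th x0 u xi r s.
Proof.
elim: s => [//|s ih] good; rewrite /= ih; last first.
  by move=> s' /andP[s0 ss]; apply: good; rewrite s0 leqW.
have [dr -> rK] := good s.+1 (ltnSn s).
apply: iterate_regularized => i l ir; apply: dr; exact: ltn_trans rK.
Qed.

End all_stages.
End regularized_process.

Lemma stage_output_feas {R : realType} {d m : nat} {dXi : measure_display}
    {Xi : measurableType dXi} (k : constants R) (p : problem R d m Xi)
    (O : set 'rV[R]_d) (Phiinf : R) (th : nat -> stage_parameters R) (x0 : 'rV[R]_d)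
    (u : nat -> nat -> nat -> 'rV[R]_d) (xi : nat -> nat -> nat -> Xi) (r : nat -> nat) s :
  regular_problem k p O Phiinf -> feas p x0 -> feas p (stage_output p th x0 u xi r s).
Proof.
move=> rp Xx0; elim: s => [//|s ih] /=.
case: (r s.+1) => [//|j] /=; case: single_stage => x v l /=.
exact: (prox_feas (rp_prox_regular rp)).
Qed.

Lemma integral_le_mean {R : realType} {d} {T : measurableType d} (P : probability T R)
    (f g : T -> R) : (forall x, 0 <= f x) -> summable1 P g ->
  {ae P, forall x, f x = g x} -> (\int[P]_x (f x)%:E <= (mean P g)%:E)%E.
Proof.
move=> f0 sg [M [mM M0 fgM]]; have [mg g0 _] := sg.
have mI : measurable_fun setT (fun x => (\1_M x : R)%:E).
  by apply/measurable_EFinP; exact: measurable_indic.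
have I0 : (\int[P]_x (+oo * (\1_M x : R)%:E) = 0)%E.
  have z : (\int[P]_x (\1_M x : R)%:E = 0)%E.
    by rewrite integral_indic// setIT; exact: M0.
  by rewrite ge0_integralZl ?z ?mule0//= => x _; rewrite lee_fin.
apply: (@le_trans _ _ (\int[P]_x ((g x)%:E + +oo * (\1_M x : R)%:E))%E).
  apply: le_integral_nomeas => x; first by rewrite lee_fin.
  rewrite indicE; have [Mx|Mx] := pselect (M x).
    by rewrite mem_set// mule1 addey ?leey.
  rewrite memNset// mule0 adde0 lee_fin.
  suff -> : f x = g x by [].
  by apply: contrapT => h; apply: Mx; apply: fgM.
rewrite ge0_integralD//.
- by rewrite I0 adde0 summable1_mean.
- by move=> x _; rewrite lee_fin.
- exact/measurable_EFinP.
- exact: emeasurable_funM.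
Qed.

Section multi_stage_analysis.
Context {R : realType} {d m : nat} {dXi dOm : measure_display}
  {Xi : measurableType dXi} {Om : measurableType dOm}.
Variables (k : constants R) (eps : R) (PXi : probability Xi R) (p : problem R d m Xi)
  (DX Phiinf : R) (Pu : probability (rvec R d) R) (O : nat -> set 'rV[R]_d).
Local Notation th := (stagewise k m d (sixth_moment Pu) eps).
Local Notation run := (stage_run k m eps).
Local Notation X := (feas p).

Hypothesis kpos : constants_positive k.
Hypothesis d3 : (3 <= d)%N.
Hypothesis eps01 : 0 < eps < 1.
Hypothesis sa : standing_assumptions p PXi.
Hypothesis rad : rademacher Pu.
Hypothesis fs : A1_feasible_set p DX.
Hypothesis rg : A1_regularizer k p.
Hypothesis cs : A1_constraints k p.
Hypothesis lb : A1_lower_bound p Phiinf.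
Hypothesis ub : ereal_sup [set (composite p x - Phiinf%:E)%E | x in X] = (gap k)%:E.
Hypothesis hO : forall s, run s ->
  [/\ open (O s), enlarged_set p Pu (st_nu (th s)) `<=` O s,
      A1_objective k p (O s), A2 k p PXi (O s) & A3 k p PXi (O s)].

Variables (P : probability Om R) (u : nat -> nat -> nat -> {RV P >-> rvec R d})
  (xi : nat -> nat -> nat -> {RV P >-> Xi}) (r : nat -> {RV P >-> nat}) (x0 : 'rV[R]_d).
Hypothesis x0_feas : X x0.
Hypothesis scheme : sampling_scheme Pu PXi run th u xi r.
Hypothesis qual : {ae P, forall w s i, run s -> (i <= st_K (th s))%N ->
  let x := stage_iterate p th x0 (fun s i j => u s i j w) (fun s i j => xi s i j w)
    (fun s => r s w) s i in
  beta k * norm2 (con p x) <=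
    dist2 (con_gradT p x (con p x)) [set - v | v in normal_cone X x]}.

Variable N : set Xi.
Hypothesis mN : measurable N.
Hypothesis N0 : PXi N = 0%E.
Hypothesis NC1 : forall z, ~ N z -> continuously_differentiable (so p ^~ z).
Local Notation p' := (regularized p N).

Local Notation K s := (st_K (th s)).

Definition clipped w s := clip (r s) (K s) w.

Definition regular_output s w : 'rV[R]_d := stage_output p' th x0
  (fun s i j => u s i j w) (fun s i j => xi s i j w) (clipped w) s.

Local Notation state s w j := (stage_state p' (th s) (u s) (xi s) (regular_output s.-1) w j).

Let E6 : sixth_moment Pu = d%:R ^+ 3.
Proof. exact: rademacher_sixth_moment. Qed.

Let nu0 s : 0 < st_nu (th s).
Proof. exact: (nu_facts m eps kpos d3 E6 s).1. Qed.

Let sc s := stagewise_conditions m eps kpos d3 E6 s.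

Let run1 : run 1.
Proof. by split => // s' /andP[]; case: s'. Qed.

Let rp s : run s -> regular_problem k p' (O s) Phiinf.
Proof.
move=> rs; have [Oo Os fO a2 a3] := hO rs.
by case: (standing_regular_problem kpos sa rad fs rg cs lb ub Oo Os fO) => *; split.
Qed.

Let ro s : run s -> regular_oracle PXi (so p') (obj p') X (O s) (Lf k)
  (2 * sigma k ^+ 2 + 2 * Mf k ^+ 2) (st_nu (th s)).
Proof.
move=> rs; have [Oo Os fO a2 a3] := hO rs.
exact: (standing_regular_oracle kpos sa rad fs rg cs lb ub (nu0 s) Oo Os fO a2 a3 mN N0 NC1).
Qed.

Let XD x : X x -> norm2 x <= DX.
Proof. by case: fs => _ _ _; apply. Qed.

Lemma output_feas s w : X (regular_output s w).
Proof.
elim: s => [//|s ih].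
exact: (stage_feas (th s.+1) (rp run1) (u s.+1) (xi s.+1) (x0 := fun=> regular_output s w) (fun=> ih)).
Qed.

Let sf s (rs : run s) := history_sampling scheme rs.

Let K0 s : (0 < K s)%N := sc_K (sc s).

Let lawr s (rs : run s) j (jK : (j < K s)%N) : distribution P (r s) [set j] = ((K s)%:R^-1)%:E.
Proof. by have [_ _ + _] := scheme; exact. Qed.

Lemma regular_ae : {ae P, forall w, forall s, run s ->
  regular_draws N th (fun s i j => xi s i j w) s /\ clipped w s = r s w}.
Proof.
have h1 : {ae P, forall w, forall s i l, sample_drawn run th s i l -> ~ N (xi s i l w)}.
  apply: ae_foralln => s; apply: ae_foralln => i; apply: ae_foralln => l.
  have [dr|ndr] := pselect (sample_drawn run th s i l); last by apply: aeW => w /ndr.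
  exists (xi s i l @^-1` N); split.
  - by rewrite -[X in measurable X]setTI; apply: measurable_funP.
  - have [_ law _ _] := scheme.
    by have := law s i l dr N mN; rewrite N0.
  - by move=> w /= /not_implyP[_ /contrapT].
have h2 : {ae P, forall w, forall s, run s -> clipped w s = r s w}.
  apply: ae_foralln => s.
  have [rs|nrs] := pselect (run s); last by apply: aeW => w /nrs.
  by apply: filterS (clip_ae (K0 s) (lawr rs)) => w h _; exact: h.
apply: filterS2 h1 h2 => w g1 g2 s rs; split; last exact: g2.
by move=> i l iK lb'; exact: g1.
Qed.

Let run_le s s' : run s -> (0 < s' <= s)%N -> run s'.
Proof.
move=> [_ h] /andP[s0 ss]; split => // t /andP[t0 ts]; apply: h.
by rewrite t0 (leq_trans ts).
Qed.

Lemma output_ae : {ae P, forall w, forall s, (s = 0%N \/ run s) ->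
  regular_output s w = stage_output p th x0 (fun s i j => u s i j w) (fun s i j => xi s i j w)
    (fun s => r s w) s}.
Proof.
apply: filterS regular_ae => w good s [->//|rs].
apply: stage_output_regularized => s' ss'.
have [g1 g2] := good _ (run_le rs ss'); split => //.
by rewrite -g2; exact: clip_lt.
Qed.

Let qual' s : run s -> {ae P, forall w j, (j < K s)%N ->
  beta k * norm2 (con p' (st_x (state s w j.+1))) <=
  dist2 (con_gradT p' (st_x (state s w j.+1)) (con p' (st_x (state s w j.+1))))
    [set - v | v in normal_cone X (st_x (state s w j.+1))]}.
Proof.
move=> rs; apply: filterS3 qual regular_ae output_ae => w q good out j jK.
have -> : st_x (state s w j.+1) = stage_iterate p th x0 (fun s i j => u s i j w)
    (fun s i j => xi s i j w) (fun s => r s w) s j.+1.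
  rewrite /stage_state iterate_regularized; last first.
    by move=> i l ij; apply: (good s rs).1; exact: leq_ltn_trans jK.
  rewrite out//; case: s rs {q jK} => [[]//|[|s]] rs; [by left|right].
  exact: run_pred rs.
exact: q.
Qed.

Section one_stage.
Variable s : nat.
Hypothesis rs : run s.
Hypothesis x_adapted : adapted (past run th u xi r s 0 0) (regular_output s.-1).
Hypothesis x_C : mean P (fun w => norm2 (con p (regular_output s.-1 w)) ^+ 2) <= C_bar k m eps s.

Definition multiplier w : 'rV[R]_m :=
  stage_multiplier p' (th s) (u s) (xi s) (regular_output s.-1) (clipped w s) w.

Let x_Delta : gap k + 2 * m%:R * rho k * Mbc k ^+ 2 +
  st_mu (th s) / 2 * mean P (fun w => norm2 (con p (regular_output s.-1 w)) ^+ 2) <=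
  Delta_bar k m eps s.
Proof.
have m0 := mu_gt0 k m eps s.
apply: (@le_trans _ _ (B_X k m + mu k m eps s / 2 * C_bar k m eps s)).
  by rewrite lerD2l; apply: ler_wpM2l; [exact: divr_ge0 (ltW m0) (ler0n R 2)|exact: x_C].
rewrite /C_bar /Delta_bar; case: eqP => _; rewrite lerD2l.
  by rewrite le_eqVlt; apply/orP; left; apply/eqP; field.
have -> // : mu k m eps s / 2 * (2 * gamma k m ^+ 2 / mu k m eps s) = gamma k m ^+ 2.
by field; rewrite gt_eqF.
Qed.

Let xs j w := st_x (state s w j).

Let ofeas : forall w, X (regular_output s.-1 w) := output_feas s.-1.

Let adapted_stage j (jK : (j < K s)%N) :=
  stage_adapted (rp rs) XD (ro rs) rad d3 (sc s) (sf rs) x_adapted ofeas jK.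

Let pastK j : (j < K s)%N -> past run th u xi r s j 0 `<=` past run th u xi r s (K s) 0.
Proof. by move=> jK; apply: past_batch; exact: ltnW. Qed.

Let Gm j : past run th u xi r s j 0 `<=` measurable.
Proof. exact: past_measurable. Qed.

Let indr A B := @index_independent _ _ _ _ _ _ _ _ _ _ _ _ _ _ scheme s (K s) A B rs.

Let lawr' j (jK : (j < K s)%N) := lawr rs jK.

Lemma output_index w : (0 < s)%N -> regular_output s w = xs (clipped w s) w.
Proof. by rewrite /xs; case: (s). Qed.

Lemma stage_end : adapted (past run th u xi r s.+1 0 0) (regular_output s) /\
  mean P (fun w => norm2 (con p (regular_output s w)) ^+ 2) <= eps_ k m eps s ^+ 2.
Proof.
have s0 : (0 < s)%N by have [] := rs.
have oE : regular_output s = (fun w => xs (clipped w s) w).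
  by apply/funext => w; exact: output_index.
have KR : 0 < (K s)%:R :> R by rewrite ltr0n K0.
split.
  rewrite oE; apply: (measurable_random_index (K0 s) (@past_next _ _ _ _ _ _ _ run th u xi r s (K s)) (past_index th u xi rs)).
  by move=> j jK; apply: adapted_sub (pastK jK) _; exact: (adapted_stage jK).1.
have fE := stage_feasibility (rp rs) XD (ro rs) rad d3 (sc s) (sf rs) x_adapted ofeas x_C
  x_Delta (qual' rs).
pose Y j w := norm2 (con p (xs j w)) ^+ 2.
have [] := random_index (Gm (j := K s)) (K0 s) indr lawr' (Y := Y).
- move=> j jK; apply: measurable_funX; apply: measurable_norm2.
  apply: (measurable_con (rp rs)).
  exact: adapted_sub (pastK jK) (adapted_stage jK).1.
- move=> j jK; apply: (summable_con P (rp rs)).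
    exact: adapted_measurable (Gm (j := j)) (adapted_stage jK).1.
  by move=> w; exact: (stage_feas (th s) (rp rs)).
move=> _ h; rewrite oE; apply: (le_trans h).
by rewrite ler_pdivrMl.
Qed.

Lemma stage_end_stationarity :
  measurable_fun setT (multiplier : Om -> rvec R m) /\
  summable1 P (fun w => norm2 (gradient_mapping X (reg p) (st_eta (th s)) (regular_output s w)
    (grad (obj p) (regular_output s w) + con_gradT p (regular_output s w) (multiplier w))) ^+ 2) /\
  mean P (fun w => norm2 (gradient_mapping X (reg p) (st_eta (th s)) (regular_output s w)
    (grad (obj p) (regular_output s w) + con_gradT p (regular_output s w) (multiplier w))) ^+ 2) <=
  eps_ k m eps s ^+ 2.
Proof.
have s0 : (0 < s)%N by have [] := rs.
have KR : 0 < (K s)%:R :> R by rewrite ltr0n K0.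
split.
  apply: (@adapted_measurable _ _ _ _ (past run th u xi r s.+1 0 0)).
    exact: past_measurable.
  apply: (measurable_random_index (Y := fun j => stage_multiplier p' (th s) (u s) (xi s) (regular_output s.-1) j)
    (K0 s) (@past_next _ _ _ _ _ _ _ run th u xi r s (K s)) (past_index th u xi rs)).
  by move=> j jK; apply: adapted_sub (pastK jK) _; exact: (adapted_stage jK).2.
have fE := stage_stationarity (rp rs) XD (ro rs) rad d3 (sc s) (sf rs) x_adapted ofeas
  x_Delta.
pose Y j w := norm2 (stage_gradmap p' (th s) (u s) (xi s) (regular_output s.-1) (st_eta (th s)) j w) ^+ 2.
have YE w : norm2 (gradient_mapping X (reg p) (st_eta (th s)) (regular_output s w)
    (grad (obj p) (regular_output s w) + con_gradT p (regular_output s w) (multiplier w))) ^+ 2 = Y (clipped w s) w.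
  by rewrite (output_index w s0).
under eq_fun do rewrite YE.
have [] := random_index (Gm (j := K s)) (K0 s) indr lawr' (Y := Y).
- move=> j jK; apply: measurable_funX; apply: measurable_norm2.
  apply: (measurable_gradmap (rp rs) (sc s)).
    exact: adapted_sub (pastK jK) (adapted_stage jK).1.
  exact: adapted_sub (pastK jK) (adapted_stage jK).2.
- by move=> j jK; have [] := stage_gradmap_summable (rp rs) XD (ro rs) rad d3 (sc s) (sf rs) x_adapted ofeas jK.
move=> sY h; split => //; apply: (le_trans h).
by rewrite ler_pdivrMl.
Qed.

End one_stage.

Lemma output_bounds s : run s ->
  adapted (past run th u xi r s 0 0) (regular_output s.-1) /\
  mean P (fun w => norm2 (con p (regular_output s.-1 w)) ^+ 2) <= C_bar k m eps s.
Proof.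
case: s => [[]//|s]; elim: s => [|s ih] rs.
  split; first exact: measurable_cst.
  by rewrite /= mean_cst; exact: (con_sqr_bound (rp run1) x0_feas).
have rs' := run_pred (ltn0Sn s) rs.
have [ad mC] := ih rs'.
have [ad' me] := stage_end rs' ad mC.
split; first exact: ad'.
apply: (le_trans me); rewrite /C_bar /= /eps_ expr_div_n.
have g2 : 0 <= gamma k m ^+ 2 by exact: sqr_ge0.
have m0 := mu_gt0 k m eps s.+1.
rewrite -mulrA mulrCA ler_wpM2l//.
rewrite ler_pdivlMr ?mu_gt0// mulrC ler_pdivrMr ?exprn_gt0//.
by rewrite muS// ge_min lexx.
Qed.

End multi_stage_analysis.

Theorem corollary6p2 (R : realType) (m : nat) (k : constants R)
    (m_ge1 : (1 <= m)%N) (k_pos : constants_positive k) :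
  exists C : R,
  forall (d : nat) (eps : R), (3 <= d)%N -> 0 < eps < 1 ->
  forall (dXi : measure_display) (Xi : measurableType dXi)
    (PXi : probability Xi R) (p : problem R d m Xi) (DX Phiinf : R)
    (Pu : probability (rvec R d) R) (O : nat -> set 'rV[R]_d),
  let th := stagewise k m d (sixth_moment Pu) eps in
  let run := stage_run k m eps in
  standing_assumptions p PXi ->
  rademacher Pu ->
  0 < DX -> A1_feasible_set p DX ->
  A1_regularizer k p -> A1_constraints k p -> A1_lower_bound p Phiinf ->
  ereal_sup [set (composite p x - Phiinf%:E)%E | x in feas p] = (gap k)%:E ->
  (forall s, run s ->
     [/\ open (O s), enlarged_set p Pu (st_nu (th s)) `<=` O s,
         A1_objective k p (O s), A2 k p PXi (O s) & A3 k p PXi (O s)]) ->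
  forall (dOm : measure_display) (Om : measurableType dOm)
    (P : probability Om R)
    (u : nat -> nat -> nat -> {RV P >-> rvec R d})
    (xi : nat -> nat -> nat -> {RV P >-> Xi})
    (r : nat -> {RV P >-> nat}) (x0 : 'rV[R]_d),
  let iterate w := stage_iterate p th x0 (fun s i j => u s i j w)
                     (fun s i j => xi s i j w) (fun s => r s w) in
  let output w := stage_output p th x0 (fun s i j => u s i j w)
                    (fun s i j => xi s i j w) (fun s => r s w) in
  feas p x0 ->
  sampling_scheme Pu PXi run th u xi r ->
  {ae P, forall w s i, run s -> (i <= st_K (th s))%N ->
     beta k * norm2 (con p (iterate w s i)) <=
       dist2 (con_gradT p (iterate w s i) (con p (iterate w s i)))
             [set - v | v in normal_cone (feas p) (iterate w s i)]} ->
  exists T : nat,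
    [/\ last_stage k m eps T,
        eps_KKT p P eps (st_eta (th T)) (fun w => output w T) &
        (\sum_(1 <= s < T.+1) oracle_calls (th s))%:R
          <= C * (d%:R * eps ^- 3)].
Proof.
exists (complexity_constant k m) => d eps d3 eps01 dXi Xi PXi p DX Phiinf Pu O th run sa rad
  DX0 fs rg cs lb ub hO dOm Om P u xi r x0 iterate output x0_feas scheme qual.
have [T lT] := last_stage_exists k m eps.
exists T; split => //; last exact: (total_oracle_calls k_pos).
have [rT _] := lT.
have [_ _ _ [N [mN N0 NC]] _] := sa.
have NC1 z : ~ N z -> continuously_differentiable (so p ^~ z).
  by move=> Nz; apply: contrapT => h; apply: Nz; exact: (NC z h).
have [aT mT] := output_bounds k_pos d3 sa rad fs rg cs lb ub hO x0_feas scheme qual mN N0 NC1 rT.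
have [aT1 cT] := stage_end k_pos d3 sa rad fs rg cs lb ub hO x0_feas scheme qual mN N0 NC1 rT aT mT.
have [ml [sg gT]] := stage_end_stationarity k_pos d3 sa rad fs rg cs lb ub hO x0_feas scheme
  mN N0 NC1 rT aT mT.
have ae := output_ae p k_pos d3 rad x0 scheme mN N0.
have {ae} oE : {ae P, forall w, output w T = regular_output k eps p Pu u xi r x0 N T w}.
  by apply: filterS ae => w h; exact: esym (h T (or_intror rT)).
have mx := adapted_measurable (past_measurable (s := T.+1) (j := 0%N) (l := 0%N)) aT1.
have eT : eps_ k m eps T ^+ 2 <= eps ^+ 2.
  have e0 := eps_gt0 m eps k_pos T; have /andP[e1 _] := eps01.
  have h := last_eps eps01 lT.
  by rewrite ler_pXn2r ?nnegrE ?(ltW e0) ?(ltW e1) ?h.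
have [Oo Os fO _ _] := hO _ rT.
have rp := standing_regular_problem k_pos sa rad fs rg cs lb ub Oo Os fO.
split.
- by exists (mfun_Sub (mem_set mx)); exact: oE.
- by move=> w; exact: (stage_output_feas _ _ _ _ _ rp x0_feas).
exists (multiplier k eps p Pu u xi r x0 N T); first by exists (mfun_Sub (mem_set ml)); exact: aeW.
split.
- rewrite unlock; apply: le_trans (integral_le_mean _ sg _) _.
  + by move=> w; exact: sqr_ge0.
  + by apply: filterS oE => w /= ->.
  + by rewrite lee_fin; exact: le_trans eT.
- have sC := summable_con P rp mx (output_feas k_pos sa rad fs rg cs lb ub hO u xi r x0_feas N T).
  rewrite unlock; apply: le_trans (integral_le_mean _ sC _) _.
  + by move=> w; exact: sqr_ge0.
  + by apply: filterS oE => w /= ->.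
  + by rewrite lee_fin; exact: le_trans eT.
Qed.
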